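(* The general Bronowski threefold of degree $9$ in $\mathbb P^7$ is an OADP variety.
   Context: Work over $\mathbb C$. Let $X\subset\mathbb P^7$ be an irreducible non-degenerate threefold, $x\in X$ general. The tangential projection $\tau=\tau_x:X\dashrightarrow\mathbb P^3$ is the projection from the embedded tangent space $T_xX$; $X$ is Bronowski if $\tau$ is birational. If $E\cong\mathbb P^2$ is the exceptional divisor of the blow-up of $X$ at $x$, $\tau$ induces $\bar\tau:E\dashrightarrow\mathbb P^3$, given by a linear system of conics and birational onto the fundamental surface $V$. The inverse $\sigma=\tau^{-1}$ is defined by a linear system $\mathcal X$ on $\mathbb P^3$. ''The general Bronowski threefold of degree 9'' means: $X$ is a normal Bronowski threefold such that $\mathcal X$ has degree nine and base locus of pure dimension one except for the point $p$ below, $V$ is Steiner's Roman surface, projectively equivalent to $x_1^2x_2^2-x_0x_1x_2x_3+x_1^2x_3^2+x_2^2x_3^2=0$, with triple point $p$ and three distinct double lines $\ell_1,\ell_2,\ell_3$ through $p$; $\mathcal X$ consists of the surfaces of degree nine with multiplicity six at $p$, four along each $\ell_i$ and two along a degree six curve $C_6\subset V$ (the image under $\bar\tau$ of a plane cubic of $E$); and $C_6$ is smooth, does not contain $p$ and intersects the lines $\ell_i$ transversally. OADP: $X\subset\mathbb P^7$ is a variety with one apparent double point if through a general point of $\mathbb P^7$ there passes exactly one secant line of $X$ (i.e. the projection to $\mathbb P^7$ of the abstract secant variety of $X$, the closure of $\{((x_1,x_2),z):x_1\neq x_2,\ z\in\langle x_1,x_2\rangle\}$, is birational). *)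

(* Defs.v *)
From mathcomp Require Import all_boot all_order all_algebra.
From mathcomp Require Export classical_sets reals complex mpoly.

Set Implicit Arguments.
Unset Strict Implicit.
Unset Printing Implicit Defensive.

Import GRing.Theory.
Local Open Scope ring_scope.
Local Open Scope classical_set_scope.

(* Conventions.  A point of P^(n-1) is a nonzero row vector v : 'rV[K]_n up to
   a scalar; u and v are the same point iff (u == v)%MS (equal row spaces).
   A subset of P^(n-1) is a set of nonzero row vectors stable under scaling.
   A rational map to P^(m-1) is an m-tuple of forms of the same degree.       *)

Section Projective.

Variable K : closedFieldType.

Definition pspace n : set 'rV[K]_n := [set v : 'rV[K]_n | v != 0].

Definition vanishes n (f : {mpoly K[n]}) (X : set 'rV[K]_n) : Prop :=
  forall v, X v -> f.@[v 0] = 0.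

Definition zeros n (S : set {mpoly K[n]}) : set 'rV[K]_n :=
  [set v : 'rV[K]_n | v != 0 /\ forall f, S f -> f.@[v 0] = 0].

Definition zclosed n (X : set 'rV[K]_n) : Prop :=
  exists S : set {mpoly K[n]},
    (forall f, S f -> exists d, f \is d.-homog) /\ X = zeros S.

Definition zclosure n (X : set 'rV[K]_n) : set 'rV[K]_n :=
  zeros [set f : {mpoly K[n]} | (exists d, f \is d.-homog) /\ vanishes f X].

Definition irreducible n (X : set 'rV[K]_n) : Prop :=
  [/\ zclosed X, X !=set0 &
    forall Z1 Z2, zclosed Z1 -> zclosed Z2 -> X `<=` Z1 `|` Z2 ->
      X `<=` Z1 \/ X `<=` Z2].

Definition irreducible_component n (Z X : set 'rV[K]_n) : Prop :=
  [/\ irreducible Z, Z `<=` X &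
    forall Z', irreducible Z' -> Z' `<=` X -> Z `<=` Z' -> Z = Z'].

Definition has_chain n (X : set 'rV[K]_n) (k : nat) : Prop :=
  exists Z : 'I_k.+1 -> set 'rV[K]_n,
    (forall i, irreducible (Z i) /\ Z i `<=` X) /\
    (forall i j : 'I_k.+1, (i < j)%N -> Z i `<` Z j).

Definition dim n (X : set 'rV[K]_n) (d : nat) : Prop :=
  has_chain X d /\ ~ has_chain X d.+1.

Definition nondegenerate n (X : set 'rV[K]_n) : Prop :=
  forall h : 'cV[K]_n, (forall v, X v -> v *m h = 0) -> h = 0.

(* "P holds at the general point of X"; meant for irreducible X. *)
Definition general n (X : set 'rV[K]_n) (P : 'rV[K]_n -> Prop) : Prop :=
  exists Z, [/\ zclosed Z, ~ (X `<=` Z) & forall v, X v -> ~ Z v -> P v].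

(* The linear subspace of K^n whose projectivization is T_x X. *)
Definition tangent_space n (X : set 'rV[K]_n) (x : 'rV[K]_n) : set 'rV[K]_n :=
  [set v : 'rV[K]_n | forall f d, f \is d.-homog -> vanishes f X ->
     \sum_(i < n) (f^`M(i)).@[x 0] * v 0 i = 0].

(* Smoothness at x of a closed set all of whose components through x have
   dimension d. *)
Definition smooth_at n d (X : set 'rV[K]_n) (x : 'rV[K]_n) : Prop :=
  exists T : 'M[K]_(d.+1, n),
    row_free T /\ forall v, tangent_space X x v <-> (v <= T)%MS.

(* The element f/g of the function field of X is integral over O_(X,x). *)
Definition integral_at n (X : set 'rV[K]_n) (x : 'rV[K]_n)
    (f g : {mpoly K[n]}) : Prop :=
  exists (m : nat) (a b : 'I_m -> {mpoly K[n]}),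
    (forall i, exists d, [/\ a i \is d.-homog, b i \is d.-homog
                           & (b i).@[x 0] != 0]) /\
    (forall v, X v -> g.@[v 0] != 0 -> (forall i, (b i).@[v 0] != 0) ->
       (f.@[v 0] / g.@[v 0]) ^+ m
       + \sum_(i < m) (a i).@[v 0] / (b i).@[v 0]
                      * (f.@[v 0] / g.@[v 0]) ^+ i = 0).

(* The element f/g of the function field of X lies in O_(X,x). *)
Definition regular_at n (X : set 'rV[K]_n) (x : 'rV[K]_n)
    (f g : {mpoly K[n]}) : Prop :=
  exists (a b : {mpoly K[n]}) (d : nat),
    [/\ a \is d.-homog, b \is d.-homog, b.@[x 0] != 0 &
      forall v, X v -> f.@[v 0] * b.@[v 0] = a.@[v 0] * g.@[v 0]].

(* Normality of the variety X (not projective normality). *)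
Definition normal n (X : set 'rV[K]_n) : Prop :=
  forall x, X x -> forall (f g : {mpoly K[n]}) (d : nat),
    f \is d.-homog -> g \is d.-homog -> ~ vanishes g X ->
    integral_at X x f g -> regular_at X x f g.

Definition eval_map n m (phi : 'I_m -> {mpoly K[n]}) (v : 'rV[K]_n) :
    'rV[K]_m :=
  \row_j (phi j).@[v 0].

Definition rational_map n m (X : set 'rV[K]_n)
    (phi : 'I_m -> {mpoly K[n]}) : Prop :=
  (exists d, forall j, phi j \is d.-homog) /\
  (exists2 v, X v & eval_map phi v != 0).

Definition birational_inverse n m (X : set 'rV[K]_n) (Y : set 'rV[K]_m)
    (phi : 'I_m -> {mpoly K[n]}) (psi : 'I_n -> {mpoly K[m]}) : Prop :=
  [/\ rational_map X phi, rational_map Y psi,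
    general X (fun v => Y (eval_map phi v) /\
                        (eval_map psi (eval_map phi v) == v)%MS) &
    general Y (fun w => X (eval_map psi w) /\
                        (eval_map phi (eval_map psi w) == w)%MS)].

Definition birational n m (X : set 'rV[K]_n) (Y : set 'rV[K]_m)
    (phi : 'I_m -> {mpoly K[n]}) : Prop :=
  exists psi, birational_inverse X Y phi psi.

(* The map v |-> v *m A. *)
Definition lin_map n m (A : 'M[K]_(n, m)) (j : 'I_m) : {mpoly K[n]} :=
  \sum_(i < n) A i j *: 'X_i.

(* Order of vanishing of f at z at least m; for a form f, this is the
   multiplicity at z of the hypersurface f = 0. *)
Definition mult_ge n (m : nat) (f : {mpoly K[n]}) (z : 'rV[K]_n) : Prop :=
  forall k : 'X_{1..n}, (mdeg k < m)%N -> (f^`M[k]).@[z 0] = 0.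

Definition mult_ge_along n (m : nat) (f : {mpoly K[n]}) (Z : set 'rV[K]_n) :
    Prop :=
  forall z, Z z -> mult_ge m f z.

(* The general hyperplane section of the curve Z consists of r points. *)
Definition curve_degree n (Z : set 'rV[K]_n) (r : nat) : Prop :=
  general (@pspace n) (fun h =>
    exists q : 'I_r -> 'rV[K]_n,
      [/\ forall i, Z (q i) /\ q i *m h^T = 0,
          forall i j, (q i == q j)%MS -> i = j &
          forall z, Z z -> z *m h^T = 0 -> exists i, (z == q i)%MS]).

Definition plinear k n (L : 'M[K]_(k, n)) : set 'rV[K]_n :=
  [set z : 'rV[K]_n | z != 0 /\ (z <= L)%MS].

(* A : 'M_(n, m) is a projection P^(n-1) -> P^(m-1) from T_x X. *)
Definition tangential_projection n m (X : set 'rV[K]_n) (x : 'rV[K]_n)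
    (A : 'M[K]_(n, m)) : Prop :=
  \rank A = m /\ forall v, tangent_space X x v <-> v *m A = 0.

(* B : 'M_(n+1, n) is a projection P^n -> P^(n-1) from the point x. *)
Definition point_projection n (x : 'rV[K]_n.+1) (B : 'M[K]_(n.+1, n)) : Prop :=
  \rank B = n /\ x *m B = 0.

Definition bihomog n1 n2 (a b : nat) (f : {mpoly K[n1 + n2]}) : Prop :=
  forall k : 'X_{1..n1 + n2}, k \in msupp f ->
    (\sum_(i < n1) k (lshift n2 i))%N = a /\
    (\sum_(j < n2) k (rshift n1 j))%N = b.

(* The blow-up of X at x: the closure in P^n x P^(n-1) of the graph of the
   projection of X from x. *)
Definition blow_up n (X : set 'rV[K]_n.+1) (B : 'M[K]_(n.+1, n)) :
    set ('rV[K]_n.+1 * 'rV[K]_n) :=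
  [set u : 'rV[K]_n.+1 * 'rV[K]_n | [/\ u.1 != 0, u.2 != 0 &
    forall a b (f : {mpoly K[n.+1 + n]}), bihomog a b f ->
      (forall y, X y -> y *m B != 0 -> f.@[row_mx y (y *m B) 0] = 0) ->
      f.@[row_mx u.1 u.2 0] = 0]].

Definition exceptional_divisor n (X : set 'rV[K]_n.+1) (x : 'rV[K]_n.+1)
    (B : 'M[K]_(n.+1, n)) : set 'rV[K]_n :=
  [set w : 'rV[K]_n | blow_up X B (x, w)].

(* The rational map v |-> v *m A on X, lifted to the blow-up of X at x, is
   represented by bihomogeneous forms h not all zero on the exceptional divisor
   E; its restriction to E is then w |-> h(x, w), given by the degree e forms
   g. *)
Definition induced_on_exceptional n m (e : nat) (X : set 'rV[K]_n.+1)
    (x : 'rV[K]_n.+1) (A : 'M[K]_(n.+1, m)) (B : 'M[K]_(n.+1, n))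
    (g : 'I_m -> {mpoly K[n]}) : Prop :=
  [/\ forall j, g j \is e.-homog,
      (exists2 w, exceptional_divisor X x B w & eval_map g w != 0) &
      exists (a : nat) (h : 'I_m -> {mpoly K[n.+1 + n]}),
        [/\ forall j, bihomog a e (h j),
            forall y, X y -> y *m B != 0 -> forall j k,
              (h j).@[row_mx y (y *m B) 0] * (y *m A) 0 k =
              (h k).@[row_mx y (y *m B) 0] * (y *m A) 0 j &
            forall (w : 'rV[K]_n) j, (g j).@[w 0] = (h j).@[row_mx x w 0]]].

Definition image_closure n m (S : set 'rV[K]_n) (phi : 'I_m -> {mpoly K[n]}) :
    set 'rV[K]_m :=
  zclosure [set z : 'rV[K]_m | z != 0 /\ exists2 w, S w & z = eval_map phi w].

Definition base_locus n m (s : 'I_m -> {mpoly K[n]}) : set 'rV[K]_n :=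
  [set z : 'rV[K]_n | z != 0 /\ forall i, (s i).@[z 0] = 0].

Definition no_fixed_part n m (s : 'I_m -> {mpoly K[n]}) : Prop :=
  forall q : {mpoly K[n]}, (forall i, exists r, s i = r * q) ->
    exists c : K, q = c%:MP.

Definition steiner_form : {mpoly K[4]} :=
  let X (i : nat) : {mpoly K[4]} := 'X_(inord i) in
  X 1%N ^+ 2 * X 2%N ^+ 2 - X 0%N * X 1%N * X 2%N * X 3%N
  + X 1%N ^+ 2 * X 3%N ^+ 2 + X 2%N ^+ 2 * X 3%N ^+ 2.

(* The form z |-> f (z *m M). *)
Definition lin_subst n m (M : 'M[K]_(n, m)) (f : {mpoly K[m]}) : {mpoly K[n]} :=
  f \mPo [tuple lin_map M j | j < m].

Definition bronowski (X : set 'rV[K]_8) : Prop :=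
  general X (fun x => exists A : 'M[K]_(8, 4),
    tangential_projection X x A /\ birational X (@pspace 4) (lin_map A)).

(* F is an equation of the fundamental surface V, which is a Steiner surface
   with triple point p and double lines L i. *)
Record steiner_surface (V : set 'rV[K]_4) (p : 'rV[K]_4)
    (L : 'I_3 -> 'M[K]_(2, 4)) : Prop := SteinerSurface {
  steiner_equation : exists M : 'M[K]_4, let F := lin_subst M steiner_form in
    [/\ M \in unitmx,
        V = zeros [set F],
        mult_ge 3 F p /\ ~ mult_ge 4 F p &
        forall i, mult_ge_along 2 F (plinear (L i)) /\
                  ~ mult_ge_along 3 F (plinear (L i))];
  steiner_point : p != 0;
  steiner_lines : forall i, row_free (L i) /\ (p <= L i)%MS;
  steiner_lines_distinct : forall i j, (L i == L j)%MS -> i = j }.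

(* tau = lin_map A is the tangential projection at x, sigma = s its inverse,
   whose components span the linear system; E the exceptional divisor at x;
   g the conics defining the induced map on E; C the image of a plane cubic. *)
Record degree9_data (X : set 'rV[K]_8) (x : 'rV[K]_8) (A : 'M[K]_(8, 4))
    (s : 'I_8 -> {mpoly K[4]}) (B : 'M[K]_(8, 7)) (g : 'I_4 -> {mpoly K[7]})
    (E : set 'rV[K]_7) (V : set 'rV[K]_4) (p : 'rV[K]_4)
    (L : 'I_3 -> 'M[K]_(2, 4)) (C : set 'rV[K]_4) : Prop := Degree9Data {
  d9_tau : tangential_projection X x A;
  d9_sigma : birational_inverse X (@pspace 4) (lin_map A) s;
  d9_degree : (forall i, s i \is 9.-homog) /\ no_fixed_part s;
  d9_point_projection : point_projection x B;
  d9_E : E = exceptional_divisor X x B;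
  d9_conics : induced_on_exceptional 2 X x A B g;
  d9_V : V = image_closure E g;
  d9_V_birational : birational E V g;
  d9_steiner : steiner_surface V p L;
  d9_base_locus : forall Z, irreducible_component Z (base_locus s) ->
    dim Z 1 \/ Z = plinear p;
  d9_curve : dim C 1 /\ curve_degree C 6;
  d9_cubic : exists c : {mpoly K[7]},
    [/\ c \is 3.-homog, ~ vanishes c E &
        C = image_closure [set w : 'rV[K]_7 | E w /\ c.@[w 0] = 0] g];
  d9_C_V : C `<=` V;
  d9_system : forall f : {mpoly K[4]}, f \is 9.-homog ->
    ((exists a : 'I_8 -> K, f = \sum_(i < 8) a i *: s i) <->
     [/\ mult_ge 6 f p, forall i, mult_ge_along 4 f (plinear (L i))
       & mult_ge_along 2 f C]);
  d9_C_smooth : forall z, C z -> smooth_at 1 C z;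
  d9_C_p : ~ C p;
  d9_C_transversal : forall i z, C z -> (z <= L i)%MS ->
    forall v, tangent_space C z v -> (v <= L i)%MS -> (v <= z)%MS }.

Definition general_bronowski_degree9 (X : set 'rV[K]_8) : Prop :=
  [/\ irreducible X /\ dim X 3,
      nondegenerate X,
      normal X,
      bronowski X &
      general X (fun x => exists A s B g E V p L C,
        degree9_data X x A s B g E V p L C)].

(* z lies on the secant line of X spanned by the distinct points x1 and x2. *)
Definition on_secant n (X : set 'rV[K]_n) (z x1 x2 : 'rV[K]_n) : Prop :=
  [/\ X x1, X x2, ~~ (x1 == x2)%MS & (z <= x1 + x2)%MS].

(* Exactly one unordered pair {x1, x2}: the secant through z is unique as a
   point of the abstract secant variety, hence also as a line. *)
Definition one_apparent_double_point n (X : set 'rV[K]_n) : Prop :=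
  general (@pspace n) (fun z => exists x1 x2,
    on_secant X z x1 x2 /\
    forall y1 y2, on_secant X z y1 y2 ->
      ((y1 == x1)%MS && (y2 == x2)%MS) || ((y1 == x2)%MS && (y2 == x1)%MS)).

End Projective.

(* Main.v *)
(* Let phi (y0 y1 y2)^2 be the equation of the Steiner surface V at the point
   nu(y, phi) = (|y|^2 - phi, y1 y2, y0 y2, y0 y1) of P^3.  Multiplicity four along
   the double lines gives every form of the system the restriction
   (y0 y1 y2)^4 (h6 + phi h4 + phi^2 h2 + phi^3 h0) to nu, where h_k is a ternary
   form of degree k and h6 + h4 + h2 + h0 vanishes at the coordinate vertices.
   Multiplicity two along C_6 means that h6 is singular along, and h4 vanishes on,
   the preimage D of C_6 in the plane.  D has no isolated points and lies on no
   conic, so a count of dimensions puts D on a cubic c such that all h6 are multiples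
   of c^2 and all h4 multiples of c.  Let c_j be the coefficient of y_(j-1)^3 in c.
   In terms of T_0 = c - phi sum c_j y_(j-1), T_j = phi y_(j-1) and
   S = phi^3 - sum T_j^2, where 1 <= j <= 3, the system is then, up to a linear
   change of coordinates in P^7, (T_0^2, T_0 T_j, T_j T_k (j < k), S), and X is the
   closure of the set of these points with (T_0 + sum c_j T_j) S = G(T) for a cubic
   form G.

   For z = w + w' with w, w' on this cone, the minors z_00 z_jk - z_0j z_0k are the
   products d_j d_k with d_j = t_0 t'_j - t'_0 t_j, so z determines d up to sign, and
   the pair (t_0, t'_0) lies on the conic t_0^2 + t'_0^2 = z_00; the equation left for
   the last coordinate is linear in t_0^2 - t'_0^2 and t_0 t'_0.  These determine
   {w, w'} uniquely. *)

Require Import Defs.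
From mathcomp Require Import all_boot all_order all_algebra separable.
From mathcomp Require Import boolp ring zify.

Set Implicit Arguments.
Unset Strict Implicit.
Unset Printing Implicit Defensive.

Import GRing.Theory Num.Theory.
Local Open Scope ring_scope.
Local Open Scope classical_set_scope.

(** * Polynomial functions and their density *)

Section PolynomialFunctions.

Variable K : numFieldType.

(** The equation of the cone is forced by the choice of T: [lin T] is the value of the cubic c at y,
    and c evaluated at (T_1, T_2, T_3) is phi^3 c, so [lin T * S] is the cubic form [gam T]. No
    equation of D is available at the start; it is produced by elimination. In an affine chart, a
    polynomial of least degree in one variable among those vanishing on D generates the others up to
    factors in the other variable. Removing such factors is harmless only away from finitely many
    points, so isolated points must be excluded: this is where smoothness of C_6 enters. A conic
    through D is excluded because the equation of V would then divide the whole system. Uniqueness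
    concerns every secant of X, also those meeting X in the hyperplane w_0 = 0 where the
    parametrization says nothing. It is therefore derived from equations valid on all of X, and the
    polynomial [psi] keeps a general z away from that boundary. Each condition of generality is a
    polynomial shown to be nonzero at an explicit point. *)

Lemma poly_vanishing (p : {poly K}) : (forall x, p.[x] = 0) -> p = 0.
Proof.
move=> p0; apply/eqP/negPn/negP => /max_poly_roots H.
have := H [seq i%:R | i <- iota 0 (size p)].
rewrite size_map size_iota ltnn => H'.
suff: false by []. apply: H'.
  by apply/allP => x _; rewrite rootE p0.
rewrite map_inj_uniq ?iota_uniq // => i j /eqP; rewrite eqr_nat => /eqP //.
Qed.

(** Induction on the number of variables: [muni] isolates the last one, and the univariate
    polynomial obtained for each value of the others vanishes, hence so do its coefficients. *)
Lemma mpoly_vanishing n (P : {mpoly K[n]}) : (forall v, P.@[v] = 0) -> P = 0.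
Proof.
elim: n P => [|n IHn] P P0.
  rewrite (nvar0_mpolyC P); have := P0 (fun _ => 0).
  by rewrite {1}(nvar0_mpolyC P) mevalC => ->; rewrite mpolyC0.
pose ext (v : 'I_n -> K) x (i : 'I_n.+1) : K := if unlift ord_max i is Some j then v j else x.
have lm (i : 'I_n) : widen_ord (leqnSn n) i = lift ord_max i.
  by apply/val_inj; rewrite /= /bump leqNgt ltn_ord.
have ev v x : P.@[ext v x] = (map_poly (meval v) (muni P)).[x].
  rewrite mevalE muniE rmorph_sum horner_sum; apply: eq_bigr => m _ /=.
  rewrite map_polyZ hornerZ map_polyXn hornerXn /= mevalZ mevalX.
  rewrite big_ord_recr /= mulrA; congr (_ * _ * _).
    apply: eq_bigr => i _; rewrite mnmE /ext lm liftK.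
    by congr (_ ^+ _).
  by rewrite /ext unlift_none.
have mu0 : muni P = 0.
  apply/polyP => i; rewrite coef0; apply: IHn => v.
  have := poly_vanishing (fun x => etrans (esym (ev v x)) (P0 _)).
  by move/(congr1 (fun p : {poly K} => p`_i)); rewrite coef_map coef0.
apply/mpolyP => m; rewrite mcoeff0.
(* [w m] forgets the last exponent; together with that exponent it determines [m]. *)
pose w (m : 'X_{1..n.+1}) := [multinom m (widen_ord (leqnSn n) i) | i < n].
have winj m' : w m' = w m -> m' ord_max = m ord_max -> m' = m.
  move=> e em; apply/mnmP => i; case: (unliftP ord_max i) => [j ->|-> //].
  by move/mnmP/(_ j): e; rewrite !mnmE lm.
have : ((muni P)`_(m ord_max))@_(w m) = 0.
  by rewrite mu0 coef0 mcoeff0.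
rewrite muniE coef_sum raddf_sum /=.
have -> : \sum_(i <- msupp P) (P@_i *: 'X_[w i] *: 'X^(i ord_max))`_(m ord_max)@_(w m)
   = \sum_(i <- msupp P) P@_i * (i == m)%:R.
  apply: eq_bigr => m' _; rewrite coefZ coefXn -scalerAl mcoeffZ eq_sym.
  congr (_ * _); case: (eqVneq m' m) => [->|ne].
    by rewrite eqxx mulr1 mcoeffX eqxx.
  case: eqP => e; last by rewrite mulr0 mcoeff0.
  rewrite mulr1 mcoeffX; case: eqP => // /winj H.
  by rewrite H ?eqxx // in ne.
case: (boolP (m \in msupp P)) => [mP|/memN_msupp_eq0 //].
rewrite (bigD1_seq m) ?msupp_uniq //= eqxx mulr1 big1 ?addr0 // => m' /negbTE ->.
by rewrite mulr0.
Qed.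

Lemma poly_nonroot (p : {poly K}) : p != 0 -> exists x, p.[x] != 0.
Proof.
move=> p0; apply: contrapT => H; case/eqP: p0.
by apply: poly_vanishing => x; apply/eqP/negPn/negP => h; apply: H; exists x.
Qed.

(** Only the existence of the polynomial is kept: the density arguments need no more, and [polyf]
    derives it from the shape of the function. *)
Definition polyfun n (f : 'rV[K]_n -> K) : Prop :=
  exists P : {mpoly K[n]}, forall v, f v = P.@[v 0].

Lemma polyfun_cst n c : polyfun (fun _ : 'rV[K]_n => c).
Proof. by exists c%:MP => v; rewrite mevalC. Qed.

Lemma polyfun_coord n i : polyfun (fun v : 'rV[K]_n => v 0 i).
Proof. by exists 'X_i => v; rewrite mevalXU. Qed.

Lemma polyfun_add n (f g : 'rV[K]_n -> K) :
  polyfun f -> polyfun g -> polyfun (fun v => f v + g v).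
Proof. by move=> [P fP] [Q gQ]; exists (P + Q) => v; rewrite mevalD fP gQ. Qed.

Lemma polyfun_opp n (f : 'rV[K]_n -> K) : polyfun f -> polyfun (fun v => - f v).
Proof. by move=> [P fP]; exists (- P) => v; rewrite mevalN fP. Qed.

Lemma polyfun_mul n (f g : 'rV[K]_n -> K) :
  polyfun f -> polyfun g -> polyfun (fun v => f v * g v).
Proof. by move=> [P fP] [Q gQ]; exists (P * Q) => v; rewrite mevalM fP gQ. Qed.

Lemma polyfun_exp n (f : 'rV[K]_n -> K) k : polyfun f -> polyfun (fun v => f v ^+ k).
Proof. by move=> [P fP]; exists (P ^+ k) => v; rewrite rmorphXn /= fP. Qed.

Lemma polyfun_sum n (I : Type) (r : seq I) (f : I -> 'rV[K]_n -> K) :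
  (forall i, polyfun (f i)) -> polyfun (fun v => \sum_(i <- r) f i v).
Proof.
move=> fP; elim: r => [|i r [P IH]].
  by exists 0 => v; rewrite big_nil meval0.
by have [Q fQ] := fP i; exists (Q + P) => v; rewrite big_cons mevalD fQ IH.
Qed.

Lemma polyfun_prod n (I : Type) (r : seq I) (f : I -> 'rV[K]_n -> K) :
  (forall i, polyfun (f i)) -> polyfun (fun v => \prod_(i <- r) f i v).
Proof.
move=> fP; elim: r => [|i r [P IH]].
  by exists 1 => v; rewrite big_nil meval1.
by have [Q fQ] := fP i; exists (Q * P) => v; rewrite big_cons mevalM fQ IH.
Qed.

Lemma polyfun_meval n m (P : {mpoly K[m]}) (f : 'I_m -> 'rV[K]_n -> K) :
  (forall i, polyfun (f i)) -> polyfun (fun v => P.@[fun i => f i v]).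
Proof.
move=> fP; have -> : (fun v => P.@[fun i => f i v]) =
    (fun v => \sum_(m <- msupp P) P@_m * \prod_i f i v ^+ m i).
  by apply: funext => v; rewrite mevalE.
apply: polyfun_sum => k; apply: polyfun_mul; first exact: polyfun_cst.
by apply: polyfun_prod => i; apply: polyfun_exp.
Qed.

Lemma polyfun_eq n (f g : 'rV[K]_n -> K) : f =1 g -> polyfun f -> polyfun g.
Proof. by move=> fg [P fP]; exists P => v; rewrite -fg. Qed.

Lemma polyfun_mulmx n m (A : 'M[K]_(n, m)) j :
  polyfun (fun v : 'rV[K]_n => (v *m A) 0 j).
Proof.
apply: (@polyfun_eq _ (fun v : 'rV[K]_n => \sum_i v 0 i * A i j)) => [v|].
  by rewrite mxE.
by apply: polyfun_sum => i; apply: polyfun_mul;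
  [apply: polyfun_coord | apply: polyfun_cst].
Qed.

(** The product of [f] and [g] vanishes identically and the polynomial ring is a domain; thus an
    identity need only be checked where [g] is nonzero. *)
Lemma polyfun_dense n (f g : 'rV[K]_n -> K) v0 :
  polyfun f -> polyfun g -> g v0 != 0 -> (forall v, g v != 0 -> f v = 0) ->
  forall v, f v = 0.
Proof.
move=> [P fP] [Q gQ] gv0 fg v; rewrite fP.
suff /eqP : P * Q = 0.
  rewrite mulf_eq0 => /orP [/eqP -> |/eqP Q0]; first by rewrite meval0.
  by rewrite gQ Q0 meval0 eqxx in gv0.
apply: mpoly_vanishing => w; rewrite mevalM.
have -> : P.@[w] = f (\row_i w i) by rewrite fP; apply: meval_eq => i; rewrite mxE.
have -> : Q.@[w] = g (\row_i w i) by rewrite gQ; apply: meval_eq => i; rewrite mxE.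
by case: (eqVneq (g (\row_i w i)) 0) => [->|/fg ->]; rewrite ?mulr0 ?mul0r.
Qed.

Lemma polyfun_nonzero_mul n (f g : 'rV[K]_n -> K) :
  polyfun f -> polyfun g -> (exists v, f v != 0) -> (exists v, g v != 0) ->
  exists v, f v * g v != 0.
Proof.
move=> pf pg [v fv] [w gw]; apply: contrapT => H; case/eqP: fv.
apply: (polyfun_dense pf pg gw) => u gu; apply/eqP/negPn/negP => fu.
by apply: H; exists u; rewrite mulf_neq0.
Qed.

Lemma meval_homog n d (P : {mpoly K[n]}) a (v : 'I_n -> K) :
  P \is d.-homog -> P.@[fun i => a * v i] = a ^+ d * P.@[v].
Proof.
move/dhomogP => hP; rewrite !mevalE mulr_sumr; apply: eq_big_seq => m /hP <-.
rewrite mulrCA; congr (_ * _); rewrite -[a ^+ _]/(a ^+ mdeg m) mdegE -prodrXr -big_split /=.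
by apply: eq_bigr => i _; rewrite exprMn.
Qed.

Lemma meval_homogZ n d (P : {mpoly K[n]}) a (v : 'rV[K]_n) :
  P \is d.-homog -> P.@[(a *: v) 0] = a ^+ d * P.@[v 0].
Proof.
by move/(meval_homog a (v 0)) => <-; apply: meval_eq => i; rewrite mxE.
Qed.

Definition curve n (f : {mpoly K[n]}) (h : 'I_n -> {poly K}) : {poly K} :=
  mmap (@polyC K) h f.

Lemma horner_curve n (f : {mpoly K[n]}) h t :
  (curve f h).[t] = f.@[fun i => (h i).[t]].
Proof.
rewrite mevalE /curve /mmap horner_sum; apply: eq_bigr => m _.
rewrite hornerM hornerC; congr (_ * _); rewrite /mmap1 horner_prod.
by apply: eq_bigr => i _; rewrite horner_exp.
Qed.

Lemma meval_curve n (P : {mpoly K[n]}) (h : 'I_n -> {poly K}) :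
  exists q : {poly K}, forall t, P.@[fun i => (h i).[t]] = q.[t].
Proof. by eexists => t; rewrite -horner_curve. Qed.

End PolynomialFunctions.

Ltac polyf := lazymatch goal with
  | |- polyfun (fun _ => ?c) => apply: polyfun_cst
  | |- polyfun (fun w => @?f w + @?g w) => apply: (@polyfun_add _ _ f g); polyf
  | |- polyfun (fun w => @?f w * @?g w) => apply: (@polyfun_mul _ _ f g); polyf
  | |- polyfun (fun w => - @?f w) => apply: (@polyfun_opp _ _ f); polyf
  | |- polyfun (fun w => @?f w ^+ ?k) => apply: (@polyfun_exp _ _ f k); polyf
  | _ => eauto
  end.

Section Generic.

Variable K : numClosedFieldType.

(* Some homogeneous component of [f] does not vanish at [v0], and where it does
   not vanish [f] does not vanish at some multiple of the point. *)
Lemma general_pspace n (P : 'rV[K]_n -> Prop) (f : 'rV[K]_n -> K) v0 :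
  (forall v a, a != 0 -> P (a *: v) -> P v) -> polyfun f -> v0 != 0 ->
  f v0 != 0 -> (forall v, v != 0 -> f v != 0 -> P v) ->
  general (@pspace K n) P.
Proof.
move=> PZ [F fF] v00 fv0 fP.
pose G d := pihomog mdeg d F.
have FE v : F.@[v] = \sum_(d < msize F) (G d).@[v].
  by rewrite {1}(pihomog_partitionE (leqnn (msize F))) raddf_sum.
have [d Gd] : exists d : 'I_(msize F), (G d).@[v0 0] != 0.
  apply: contrapT => H; case/eqP: fv0; rewrite fF FE big1 // => d _.
  by apply/eqP/negPn/negP => h; apply: H; exists d.
exists (zeros [set G d]%classic); split.
- exists [set G d]%classic; split=> // _ ->; exists d; exact: pihomogP.
- move/(_ v0 v00) => [_ /(_ _ erefl)/eqP]; exact/negP.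
move=> v vn0 nZ.
have Gv : (G d).@[v 0] != 0.
  by apply/negP => /eqP h; apply: nZ; split=> // _ ->.
(* The factor ['X] ensures that the value [a] found below is nonzero. *)
pose p : {poly K} := 'X * \poly_(i < msize F) (G i).@[v 0].
have : p != 0.
  rewrite mulf_neq0 ?polyX_eq0 //; apply/eqP => /polyP/(_ d).
  by rewrite coef_poly coef0 ltn_ord => /eqP; exact/negP.
move/poly_nonroot => [a]; rewrite hornerM hornerX mulf_eq0 negb_or => /andP [a0 pa].
apply: (PZ _ _ a0); apply: fP; first by rewrite scaler_eq0 negb_or a0.
rewrite fF FE; apply: contraNneq pa => h; rewrite horner_poly; apply/eqP.
rewrite -[RHS]h; apply: eq_bigr => i _.
by rewrite (meval_homogZ _ _ (pihomogP _ _ _)) mulrC.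
Qed.

End Generic.

(** * The explicit threefold *)

Section Model.

Variable K : numClosedFieldType.
Variable c : nat -> K.
Implicit Types (t u z d : nat -> K).

(** The coefficients of the three cubes carry the index of their variable because they reappear in
    [lin]. *)
Definition cub t : K :=
  c 1 * t 1%N ^+ 3 + c 2 * t 2%N ^+ 3 + c 3 * t 3%N ^+ 3
  + c 4 * t 1%N ^+ 2 * t 2%N + c 5 * t 1%N ^+ 2 * t 3%N
  + c 6 * t 2%N ^+ 2 * t 1%N + c 7 * t 2%N ^+ 2 * t 3%N
  + c 8 * t 3%N ^+ 2 * t 1%N + c 9 * t 3%N ^+ 2 * t 2%N
  + c 0 * t 1%N * t 2%N * t 3%N.

Definition lin t : K := t 0%N + c 1 * t 1%N + c 2 * t 2%N + c 3 * t 3%N.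

(** At the parametrized points [lin T] is the value of the plane cubic and [cub T] is [phi ^+ 3]
    times it, so [gam T / lin T] is the last coordinate [phi ^+ 3 - \sum T_j ^+ 2]. *)
Definition gam t : K := cub t - lin t * (t 1%N ^+ 2 + t 2%N ^+ 2 + t 3%N ^+ 2).

Definition comb (a b : K) t u (i : nat) : K := a * t i + b * u i.

Lemma linD a b t u : lin (comb a b t u) = a * lin t + b * lin u.
Proof. by rewrite /lin /comb; ring. Qed.

Lemma linZ a t : lin (fun i => a * t i) = a * lin t.
Proof. by rewrite /lin; ring. Qed.

Lemma cubZ a t : cub (fun i => a * t i) = a ^+ 3 * cub t.
Proof. by rewrite /cub; ring. Qed.

Lemma gamZ a t : gam (fun i => a * t i) = a ^+ 3 * gam t.
Proof. by rewrite /gam linZ cubZ; ring. Qed.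

Lemma eq_lin t u : (forall i, (i < 4)%N -> t i = u i) -> lin t = lin u.
Proof. by move=> e; rewrite /lin !e. Qed.

Lemma eq_gam t u : (forall i, (i < 4)%N -> t i = u i) -> gam t = gam u.
Proof. by move=> e; rewrite /gam /cub (eq_lin e) !e. Qed.

(* Found by polarization of the binary cubic [(p, q) |-> gam (p z - q d)]. *)
Definition g02 z d := (gam (comb 1 (-1) z d) + gam (comb 1 1 z d)) / 2%:R.
Definition g13 z d := (gam (comb 1 (-1) z d) - gam (comb 1 1 z d)) / 2%:R.

Lemma gam_comb z d p q : gam (comb p (- q) z d) =
  gam z * p ^+ 3 + (g13 z d + gam d) * p ^+ 2 * q
  + (g02 z d - gam z) * p * q ^+ 2 - gam d * q ^+ 3.
Proof. by rewrite /g02 /g13 /gam /cub /lin /comb; field. Qed.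

Definition cA z d := - gam z * lin d - gam d * lin z.
Definition cB z d := g02 z d * lin z + g13 z d * lin d.
Definition ca z d (s : K) := cA z d + z 0%N * s * lin z * lin d.
Definition cb z d s := cB z d - z 0%N * s * (lin z ^+ 2 - lin d ^+ 2).

(** Let T and T' be the two combinations. At q = i p one has T' = i T, and the two terms cancel as
    [lin] and [gam] have degrees 1 and 3; likewise at q = - i p. Hence the factor p^2 + q^2. The
    quarter turn (p, q) -> (q, -p) sends (T, T') to (T', -T) and changes the sign of the left side,
    so only p^2 - q^2 and p q occur in the cofactor. *)
Lemma secant_eq z d p q :
  gam (comb p (- q) z d) * lin (comb q p z d) +
  gam (comb q p z d) * lin (comb p (- q) z d) =
  (p ^+ 2 + q ^+ 2) * (- cA z d * (p ^+ 2 - q ^+ 2) + cB z d * (p * q)).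
Proof.
have := gam_comb z d q (- p); rewrite opprK => ->.
by rewrite gam_comb !linD /cA /cB; ring.
Qed.

Lemma lin_comb_mul z d p q :
  lin (comb p (- q) z d) * lin (comb q p z d) =
  lin z * lin d * (p ^+ 2 - q ^+ 2) + (lin z ^+ 2 - lin d ^+ 2) * (p * q).
Proof. by rewrite !linD; ring. Qed.

(* A decomposition [z = vecn T s + vecn T' s'] has [z0 T = p z - q d] and
   [z0 T' = q z + p d] with [p = T 0], [q = T' 0], [d = wedge T T']; the remaining
   equation, for the last coordinate, is linear in [p ^+ 2 - q ^+ 2] and [p * q]. *)
Lemma secant_eqP z d s p q : z 0%N != 0 -> p ^+ 2 + q ^+ 2 = z 0%N ->
  let T := comb p (- q) z d in let T' := comb q p z d in
  gam T * lin T' + gam T' * lin T = z 0%N ^+ 2 * s * lin T * lin T' <->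
  ca z d s * (p ^+ 2 - q ^+ 2) = cb z d s * (p * q).
Proof.
move=> z0 pq /=; rewrite secant_eq pq -[_ * lin (comb p _ _ _) * _]mulrA lin_comb_mul.
rewrite /ca /cb; split=> H.
  apply: (mulfI z0); apply/eqP; rewrite -subr_eq0; apply/eqP.
  move/eqP: H; rewrite -subr_eq0 => /eqP H.
  by apply: etrans (_ : -1 * 0 = 0); [rewrite -H; ring | rewrite mulr0].
apply/eqP; rewrite -subr_eq0; apply/eqP.
move/eqP: H; rewrite -subr_eq0 => /eqP H.
by apply: etrans (_ : - z 0%N * 0 = 0); [rewrite -H; ring | rewrite mulr0].
Qed.

(** Points of the line are multiples k (b, a), and there the conic reads D k^2 = n^2 with D the
    nonzero discriminant. It is applied to P = p^2 - q^2, Q = p q and n = p^2 + q^2. *)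
Lemma conic_line_unique (a b n P Q P' Q' : K) : b ^+ 2 + 4%:R * a ^+ 2 != 0 ->
  a * P = b * Q -> P ^+ 2 + 4%:R * Q ^+ 2 = n ^+ 2 ->
  a * P' = b * Q' -> P' ^+ 2 + 4%:R * Q' ^+ 2 = n ^+ 2 ->
  P' = P /\ Q' = Q \/ P' = - P /\ Q' = - Q.
Proof.
move=> D0 e1 e2 e1' e2'; set D := _ + _ in D0.
pose k := (b * P + 4%:R * a * Q) / D; pose k' := (b * P' + 4%:R * a * Q') / D.
have PE x y : a * x = b * y -> x = b * ((b * x + 4%:R * a * y) / D).
  move=> e; apply: (mulIf D0); rewrite mulrA divfK //.
  by rewrite /D; transitivity (b * b * x + 4%:R * a * (a * x)); [ring|rewrite e; ring].
have QE x y : a * x = b * y -> y = a * ((b * x + 4%:R * a * y) / D).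
  move=> e; apply: (mulIf D0); rewrite mulrA divfK //.
  by rewrite /D; transitivity (b * (b * y) + 4%:R * a * a * y); [ring|rewrite -e; ring].
have kk : k' ^+ 2 = k ^+ 2.
  apply: (mulfI D0); transitivity (n ^+ 2).
    by rewrite -e2' {1}(PE _ _ e1') -/k' {1}(QE _ _ e1') -/k' /D; ring.
  by rewrite -e2 {1}(PE _ _ e1) -/k {1}(QE _ _ e1) -/k /D; ring.
have /orP [/eqP kE|/eqP kE] : (k' == k) || (k' == - k) by rewrite -eqf_sqr kk.
  by left; rewrite (PE _ _ e1') (PE _ _ e1) -/k -/k' [Q'](QE _ _ e1') [Q](QE _ _ e1) -/k -/k' kE.
right; rewrite (PE _ _ e1') (PE _ _ e1) -/k -/k' [Q'](QE _ _ e1') [Q](QE _ _ e1) -/k -/k' kE.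
by rewrite !mulrN.
Qed.

Lemma sqr_pair_unique (p q p' q' : K) :
  p' ^+ 2 = p ^+ 2 -> q' ^+ 2 = q ^+ 2 -> p' * q' = p * q ->
  p' = p /\ q' = q \/ p' = - p /\ q' = - q.
Proof.
move=> ep eq_ epq; have /orP [/eqP E|/eqP E] : (p' == p) || (p' == - p) by rewrite -eqf_sqr ep.
  case: (eqVneq p 0) => p0; last first.
    by left; split=> //; apply: (mulfI p0); rewrite -epq E.
  have /orP [/eqP F|/eqP F] : (q' == q) || (q' == - q) by rewrite -eqf_sqr eq_.
    by left.
  by right; rewrite E p0 oppr0.
case: (eqVneq p 0) => p0; last first.
  by right; split=> //; apply: (mulfI p0); rewrite mulrN -epq E; ring.
have /orP [/eqP F|/eqP F] : (q' == q) || (q' == - q) by rewrite -eqf_sqr eq_.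
  by left; rewrite E p0 oppr0.
by right.
Qed.

(* The squares [t_i ^+ 2] with [i != 0] are missing: in the parametrization of the
   threefold they are absorbed into the last coordinate [s]. *)
Definition vecn t (s : K) (k : nat) : K :=
  nth 0 [:: t 0%N ^+ 2; t 0%N * t 1%N; t 0%N * t 2%N; t 0%N * t 3%N;
            t 1%N * t 2%N; t 1%N * t 3%N; t 2%N * t 3%N; s] k.

Definition dec z t s u r := forall k, (k < 8)%N -> z k = vecn t s k + vecn u r k.

Definition b12 z := z 0%N * z 4%N - z 1%N * z 2%N.
Definition b13 z := z 0%N * z 5%N - z 1%N * z 3%N.
Definition b23 z := z 0%N * z 6%N - z 2%N * z 3%N.

Definition root_of_b z d :=
  [/\ d 0%N = 0, d 1%N * d 2%N = b12 z, d 1%N * d 3%N = b13 z & d 2%N * d 3%N = b23 z].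

Definition wedge t u (i : nat) : K := t 0%N * u i - u 0%N * t i.

Lemma dec_wedge z t s u r : dec z t s u r -> root_of_b z (wedge t u).
Proof.
move=> zE; rewrite /root_of_b /wedge /b12 /b13 /b23 !zE //= /vecn /=.
by split; ring.
Qed.

Lemma dec_comb z t s u r i : dec z t s u r -> (i < 4)%N ->
  z 0%N * t i = comb (t 0%N) (- u 0%N) z (wedge t u) i /\
  z 0%N * u i = comb (u 0%N) (t 0%N) z (wedge t u) i.
Proof.
move=> zE; rewrite /comb /wedge; case: i => [|[|[|[|i]]]] // _;
by rewrite !zE // /vecn /=; split; ring.
Qed.

Lemma eq_vecn t u s r k : (k < 8)%N -> s = r ->
  (forall i, (i < 4)%N -> u i = t i) \/ (forall i, (i < 4)%N -> u i = - t i) ->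
  vecn u r k = vecn t s k.
Proof.
by move=> k8 <- [] e; rewrite /vecn !e // ?sqrrN ?mulrNN.
Qed.

(** Both [lin] and [gam] are odd, so [t] and [- t] have the same last coordinate [gam / lin]. *)
Lemma eq_on_curve t u s r : lin t != 0 ->
  lin t * s = gam t -> lin u * r = gam u ->
  (forall i, (i < 4)%N -> u i = t i) \/ (forall i, (i < 4)%N -> u i = - t i) ->
  forall k, (k < 8)%N -> vecn u r k = vecn t s k.
Proof.
move=> lt e1 e2 H k k8; apply: eq_vecn => //; apply: (mulfI lt).
case: H => H; first by rewrite e1 -(eq_lin H) e2 (eq_gam H).
have := eq_lin (u := fun i => -1 * t i) (fun i h => etrans (H i h) (esym (mulN1r _))).
have := eq_gam (u := fun i => -1 * t i) (fun i h => etrans (H i h) (esym (mulN1r _))).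
rewrite linZ gamZ => e3 e4; rewrite e4 e3 in e2; rewrite e1.
by apply: oppr_inj; transitivity ((-1) ^+ 3 * gam t); [ring | rewrite -e2; ring].
Qed.

Lemma dec_eq z t s u r : z 0%N != 0 -> lin t * s = gam t -> lin u * r = gam u ->
  dec z t s u r ->
  ca z (wedge t u) (z 7%N) * (t 0%N ^+ 2 - u 0%N ^+ 2) =
  cb z (wedge t u) (z 7%N) * (t 0%N * u 0%N).
Proof.
move=> z0 ht hu zE; apply/secant_eqP => //; first by rewrite zE.
have lt : z 0%N * lin t = lin (comb (t 0%N) (- u 0%N) z (wedge t u)).
  by rewrite -linZ; apply: eq_lin => i /(dec_comb zE) [].
have lu : z 0%N * lin u = lin (comb (u 0%N) (t 0%N) z (wedge t u)).
  by rewrite -linZ; apply: eq_lin => i /(dec_comb zE) [].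
have gt : z 0%N ^+ 3 * gam t = gam (comb (t 0%N) (- u 0%N) z (wedge t u)).
  by rewrite -gamZ; apply: eq_gam => i /(dec_comb zE) [].
have gu : z 0%N ^+ 3 * gam u = gam (comb (u 0%N) (t 0%N) z (wedge t u)).
  by rewrite -gamZ; apply: eq_gam => i /(dec_comb zE) [].
rewrite -lt -lu -gt -gu -ht -hu [z 7%N]zE //= /vecn /=; ring.
Qed.

(** The two solutions of [conic_line_unique] are exchanged by (p, q) -> (q, -p), which turns (T, T')
    into (T', -T) and hence gives the same pair of points in the other order. *)
Lemma dec_unique_wedge z t s t' s' u r u' r' : z 0%N != 0 ->
  cb z (wedge t t') (z 7%N) ^+ 2 + 4%:R * ca z (wedge t t') (z 7%N) ^+ 2 != 0 ->
  lin t != 0 -> lin t' != 0 ->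
  lin t * s = gam t -> lin t' * s' = gam t' ->
  lin u * r = gam u -> lin u' * r' = gam u' ->
  dec z t s t' s' -> dec z u r u' r' ->
  (forall i, (i < 4)%N -> wedge u u' i = wedge t t' i) ->
  (forall k, (k < 8)%N -> vecn u r k = vecn t s k /\ vecn u' r' k = vecn t' s' k) \/
  (forall k, (k < 8)%N -> vecn u r k = vecn t' s' k /\ vecn u' r' k = vecn t s k).
Proof.
move=> z0 D0 lt lt' ht ht' hu hu' dt du ew.
have E := dec_eq z0 ht ht' dt; have E' := dec_eq z0 hu hu' du.
have eca : ca z (wedge u u') (z 7%N) = ca z (wedge t t') (z 7%N).
  by rewrite /ca /cA (eq_lin ew) (eq_gam ew).
have eqcomb a b i : (i < 4)%N -> comb a b z (wedge u u') i = comb a b z (wedge t t') i.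
  by move=> h; rewrite /comb ew.
have ecb : cb z (wedge u u') (z 7%N) = cb z (wedge t t') (z 7%N).
  by rewrite /cb /cB /g02 /g13 !(eq_gam (eqcomb _ _)) (eq_lin ew).
rewrite eca ecb in E'.
have n1 : t 0%N ^+ 2 + t' 0%N ^+ 2 = z 0%N by rewrite dt.
have n2 : u 0%N ^+ 2 + u' 0%N ^+ 2 = z 0%N by rewrite du.
have two0 : 2%:R != 0 :> K by rewrite pnatr_eq0.
have [] := conic_line_unique (n := z 0%N) D0 E _ E' _.
- by rewrite -n1; ring.
- by rewrite -n2; ring.
- move=> [eP eQ]; left => k k8.
  have ep : u 0%N ^+ 2 = t 0%N ^+ 2.
    apply: (mulfI two0); transitivity (z 0%N + (u 0%N ^+ 2 - u' 0%N ^+ 2)).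
      by rewrite -n2; ring.
    by rewrite eP -n1; ring.
  have eq_ : u' 0%N ^+ 2 = t' 0%N ^+ 2.
    by apply: (addrI (u 0%N ^+ 2)); rewrite n2 ep n1.
  have [[ea eb]|[ea eb]] := sqr_pair_unique ep eq_ eQ.
    split; apply: eq_on_curve => //; left => i i4; apply: (mulfI z0).
      by rewrite (dec_comb du i4).1 (dec_comb dt i4).1 eqcomb // ea eb.
    by rewrite (dec_comb du i4).2 (dec_comb dt i4).2 eqcomb // ea eb.
  split; apply: eq_on_curve => //; right => i i4; apply: (mulfI z0).
    by rewrite mulrN (dec_comb du i4).1 (dec_comb dt i4).1 eqcomb // ea eb /comb; ring.
  by rewrite mulrN (dec_comb du i4).2 (dec_comb dt i4).2 eqcomb // ea eb /comb; ring.
move=> [eP eQ]; right => k k8.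
have ep : u 0%N ^+ 2 = t' 0%N ^+ 2.
  apply: (mulfI two0); transitivity (z 0%N + (u 0%N ^+ 2 - u' 0%N ^+ 2)).
    by rewrite -n2; ring.
  by rewrite eP -n1; ring.
have eq_ : u' 0%N ^+ 2 = (- t 0%N) ^+ 2.
  by rewrite sqrrN; apply: (addrI (u 0%N ^+ 2)); rewrite n2 ep -n1 addrC.
have eQ' : u 0%N * u' 0%N = t' 0%N * - t 0%N by rewrite eQ; ring.
have [[ea eb]|[ea eb]] := sqr_pair_unique ep eq_ eQ'.
  split; apply: eq_on_curve => //.
    left => i i4; apply: (mulfI z0).
    by rewrite (dec_comb du i4).1 (dec_comb dt i4).2 eqcomb // ea eb /comb; ring.
  right => i i4; apply: (mulfI z0); rewrite mulrN.
  by rewrite (dec_comb du i4).2 (dec_comb dt i4).1 eqcomb // ea eb /comb; ring.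
split; apply: eq_on_curve => //.
  right => i i4; apply: (mulfI z0); rewrite mulrN.
  by rewrite (dec_comb du i4).1 (dec_comb dt i4).2 eqcomb // ea eb /comb; ring.
left => i i4; apply: (mulfI z0).
by rewrite (dec_comb du i4).2 (dec_comb dt i4).1 eqcomb // ea eb /comb; ring.
Qed.

(** The square of [d 1] is [b12 z * b13 z / b23 z], and [d 1] determines [d 2] and [d 3]. *)
Lemma root_of_b_unique z d d' : b12 z != 0 -> b13 z != 0 -> b23 z != 0 ->
  root_of_b z d -> root_of_b z d' ->
  (forall i, (i < 4)%N -> d' i = d i) \/ (forall i, (i < 4)%N -> d' i = - d i).
Proof.
move=> n12 n13 n23 [d0 e12 e13 e23] [d0' e12' e13' e23'].
have [d1 d2] : d 1%N != 0 /\ d 2%N != 0.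
  by apply/andP; rewrite -negb_or -mulf_eq0 e12.
have sq : d' 1%N ^+ 2 = d 1%N ^+ 2.
  apply: (mulIf n23); rewrite -{1}e23' -e23.
  transitivity (d' 1%N * d' 2%N * (d' 1%N * d' 3%N)); first by ring.
  by rewrite e12' e13' -e12 -e13; ring.
have /orP [/eqP E|/eqP E] : (d' 1%N == d 1%N) || (d' 1%N == - d 1%N) by rewrite -eqf_sqr sq.
  left; case=> [|[|[|[|i]]]] // _; rewrite ?d0 ?d0' //; apply: (mulfI d1); rewrite -{1}E.
    by rewrite e12 e12'.
  by rewrite e13 e13'.
right; case=> [|[|[|[|i]]]] // _; rewrite ?d0 ?d0' ?oppr0 //; apply: (mulfI d1).
  by apply: oppr_inj; rewrite mulrN opprK -mulNr -E e12 e12'.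
by apply: oppr_inj; rewrite mulrN opprK -mulNr -E e13 e13'.
Qed.

(** Replacing [u'] by [- u'] changes the sign of the wedge but not [vecn u' r']; this removes the
    ambiguity left by [root_of_b_unique]. *)
Lemma dec_unique z t s t' s' u r u' r' : z 0%N != 0 ->
  b12 z != 0 -> b13 z != 0 -> b23 z != 0 ->
  (forall d, root_of_b z d -> cb z d (z 7%N) ^+ 2 + 4%:R * ca z d (z 7%N) ^+ 2 != 0) ->
  lin t != 0 -> lin t' != 0 ->
  lin t * s = gam t -> lin t' * s' = gam t' ->
  lin u * r = gam u -> lin u' * r' = gam u' ->
  dec z t s t' s' -> dec z u r u' r' ->
  (forall k, (k < 8)%N -> vecn u r k = vecn t s k /\ vecn u' r' k = vecn t' s' k) \/
  (forall k, (k < 8)%N -> vecn u r k = vecn t' s' k /\ vecn u' r' k = vecn t s k).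
Proof.
move=> z0 n12 n13 n23 D0 lt lt' ht ht' hu hu' dt du.
have W := dec_wedge dt; have W' := dec_wedge du.
have [ew|ew] := root_of_b_unique n12 n13 n23 W W'.
  by apply: (dec_unique_wedge z0 (D0 _ W)).
have vN k : (k < 8)%N -> vecn (fun i => -1 * u' i) r' k = vecn u' r' k.
  by move=> k8; apply: eq_vecn => //; right=> i _; rewrite mulN1r.
have du' : dec z u r (fun i => -1 * u' i) r'.
  by move=> k k8; rewrite vN // du.
have := dec_unique_wedge z0 (D0 _ W) lt lt' ht ht' hu _ dt du'.
case.
- by rewrite linZ gamZ -mulrA hu'; ring.
- by move=> i i4; rewrite -[RHS]opprK -ew // /wedge; ring.
- by move=> H; left => k k8; have [] := H k k8; rewrite vN.
by move=> H; right => k k8; have [] := H k k8; rewrite vN.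
Qed.

(* [eb z] is a multiple of every [d] with [root_of_b z d]: indeed
   [d = eta * eb z] where [eta ^+ 2 = (beta z)^-1]. *)
Definition eb z (i : nat) : K :=
  nth 0 [:: 0; b12 z * b13 z; b12 z * b23 z; b13 z * b23 z] i.
Definition beta z := b12 z * b13 z * b23 z.

(* [disc] and [res] express, as polynomials in [z], that the line of [secant_eqP]
   meets the conic of [conic_line_unique] properly, and that [lin] vanishes at
   neither of the two summands. *)
Definition disc_a z := - beta z * gam z * lin (eb z) - gam (eb z) * lin z
  + beta z * z 0%N * z 7%N * lin z * lin (eb z).
Definition disc_b z := beta z * (beta z * gam z + g02 z (eb z) - gam z) * lin z
  + lin (eb z) * (beta z * (g13 z (eb z) + gam (eb z)) - gam (eb z))
  - z 0%N * z 7%N * (beta z ^+ 2 * lin z ^+ 2 - beta z * lin (eb z) ^+ 2).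
Definition disc z := disc_b z ^+ 2 + 4%:R * beta z * disc_a z ^+ 2.

Definition res z := cub (comb (lin (eb z)) (- lin z) z (eb z)).

Lemma root_of_bP z d : beta z != 0 -> root_of_b z d ->
  exists2 eta, eta ^+ 2 * beta z = 1 & forall i, (i < 4)%N -> d i = eta * eb z i.
Proof.
rewrite /beta !mulf_eq0 !negb_or => /andP [/andP [n12 n13] n23] [d0 e12 e13 e23].
have [d1 d2] : d 1%N != 0 /\ d 2%N != 0.
  by apply/andP; rewrite -negb_or -mulf_eq0 e12.
have d3 : d 3%N != 0 by apply: contraNneq n13 => h; rewrite -e13 h mulr0.
exists (d 1%N / (b12 z * b13 z)).
  by rewrite -e12 -e13 -e23; field; rewrite d1 d2 d3.
case=> [|[|[|[|i]]]] // _; rewrite /eb /= -e12 -e13 -?e23 ?d0; field; rewrite ?d1 ?d2 ?d3 //.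
Qed.

Lemma g02_scale z e a : g02 z (fun i => a * e i) = gam z + a ^+ 2 * (g02 z e - gam z).
Proof. by rewrite /g02 /gam /cub /lin /comb; field. Qed.

Lemma g13_scale z e a :
  g13 z (fun i => a * e i) = a * (g13 z e + gam e) - a ^+ 3 * gam e.
Proof. by rewrite /g13 /gam /cub /lin /comb; field. Qed.

Lemma eq_comb a b z d e : (forall i, (i < 4)%N -> d i = e i) ->
  forall i, (i < 4)%N -> comb a b z d i = comb a b z e i.
Proof. by move=> h i i4; rewrite /comb h. Qed.

(** In [d] the coefficient [ca] is odd and [cb] is even. After clearing denominators with
    [eta ^+ 2 * beta z = 1], the root [eta] therefore survives only in [ca], and it disappears from
    [ca ^+ 2]. *)
Lemma disc_neq0 z d : beta z != 0 -> disc z != 0 -> root_of_b z d ->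
  cb z d (z 7%N) ^+ 2 + 4%:R * ca z d (z 7%N) ^+ 2 != 0.
Proof.
move=> bz dz /(root_of_bP bz) [eta eE dE].
have aE : beta z * ca z d (z 7%N) = eta * disc_a z.
  rewrite /ca /cA (eq_lin dE) (eq_gam dE) linZ gamZ /disc_a.
  transitivity (eta * (- beta z * gam z * lin (eb z)
     - (eta ^+ 2 * beta z) * gam (eb z) * lin z + beta z * z 0%N * z 7%N * lin z * lin (eb z))).
    by ring.
  by rewrite eE mul1r.
have bE : beta z ^+ 2 * cb z d (z 7%N) = disc_b z.
  rewrite /cb /cB (eq_lin dE) linZ.
  have -> : g02 z d = g02 z (fun i => eta * eb z i).
    by rewrite /g02 !(eq_gam (eq_comb _ _ _ dE)).
  have -> : g13 z d = g13 z (fun i => eta * eb z i).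
    by rewrite /g13 !(eq_gam (eq_comb _ _ _ dE)).
  rewrite g02_scale g13_scale /disc_b.
  transitivity (beta z * (beta z * gam z + (eta ^+ 2 * beta z) * (g02 z (eb z) - gam z)) * lin z
   + (eta ^+ 2 * beta z) * lin (eb z) * (beta z * (g13 z (eb z) + gam (eb z))
       - (eta ^+ 2 * beta z) * gam (eb z))
   - z 0%N * z 7%N * (beta z ^+ 2 * lin z ^+ 2
       - (eta ^+ 2 * beta z) * beta z * lin (eb z) ^+ 2)); first by ring.
  by rewrite eE; ring.
apply: contraNneq dz => h; apply/eqP.
transitivity (beta z ^+ 4 * (cb z d (z 7%N) ^+ 2 + 4%:R * ca z d (z 7%N) ^+ 2)); last first.
  by rewrite h mulr0.
transitivity ((beta z ^+ 2 * cb z d (z 7%N)) ^+ 2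
   + 4%:R * beta z ^+ 2 * (beta z * ca z d (z 7%N)) ^+ 2); last by ring.
rewrite aE bE /disc; congr (_ + _).
by transitivity (4%:R * beta z * (eta ^+ 2 * beta z) * disc_a z ^+ 2); [rewrite eE; ring|ring].
Qed.

(** On the line through [z] and [d] this is the point where [lin] vanishes, and there [gam] agrees
    with [cub]. *)
Lemma gam_res z d eta : (forall i, (i < 4)%N -> d i = eta * eb z i) ->
  gam (comb (lin d) (- lin z) z d) = eta ^+ 3 * res z.
Proof.
move=> dE; rewrite (eq_gam (eq_comb _ _ _ dE)) (eq_lin dE).
rewrite {1}/gam (_ : lin (comb _ _ _ _) = 0); last by rewrite linD; ring.
by rewrite mul0r subr0 linZ /res -cubZ /cub /comb; ring.
Qed.

(** The argument of [secant_eqP] is run backwards: (P, Q) is a point where the line a P = b Q meets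
    the conic, and p, q are extracted from it. It remains to see that [lin] vanishes at neither
    summand, which [res z] guarantees. *)
Lemma dec_exists z : z 0%N != 0 -> beta z != 0 -> disc z != 0 -> res z != 0 ->
  exists t s u r, [/\ lin t != 0, lin u != 0, lin t * s = gam t,
    lin u * r = gam u & dec z t s u r].
Proof.
move=> z0 bz dz rz.
pose eta := sqrtC (beta z)^-1.
have eE : eta ^+ 2 * beta z = 1 by rewrite sqrtCK mulVf.
pose d i := eta * eb z i.
have dR : root_of_b z d.
  rewrite /root_of_b /d /eb /= mulr0; split=> //.
  - transitivity (eta ^+ 2 * beta z * b12 z); [rewrite /beta; ring | by rewrite eE mul1r].
  - transitivity (eta ^+ 2 * beta z * b13 z); [rewrite /beta; ring | by rewrite eE mul1r].
  transitivity (eta ^+ 2 * beta z * b23 z); [rewrite /beta; ring | by rewrite eE mul1r].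
have D0 := disc_neq0 bz dz dR.
set b := cb z d (z 7%N) in D0 *; set a := ca z d (z 7%N) in D0 *.
pose rho := sqrtC (b ^+ 2 + 4%:R * a ^+ 2).
have rE : rho ^+ 2 = b ^+ 2 + 4%:R * a ^+ 2 by rewrite sqrtCK.
have r0 : rho != 0 by rewrite sqrtC_eq0.
pose P := z 0%N * b / rho; pose Q := z 0%N * a / rho.
have PQ : P ^+ 2 + 4%:R * Q ^+ 2 = z 0%N ^+ 2.
  transitivity (z 0%N ^+ 2 * (b ^+ 2 + 4%:R * a ^+ 2) / rho ^+ 2).
    by rewrite /P /Q; field.
  by rewrite -rE mulfK // expf_neq0.
have [p [q [p2 q2 pq]]] : exists p q, [/\ p ^+ 2 + q ^+ 2 = z 0%N,
    p ^+ 2 - q ^+ 2 = P & p * q = Q].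
  pose p := sqrtC ((z 0%N + P) / 2%:R); pose q := sqrtC ((z 0%N - P) / 2%:R).
  have pE : p ^+ 2 = (z 0%N + P) / 2%:R by rewrite sqrtCK.
  have qE : q ^+ 2 = (z 0%N - P) / 2%:R by rewrite sqrtCK.
  have sq : (p * q) ^+ 2 = Q ^+ 2.
    rewrite exprMn pE qE; transitivity ((z 0%N ^+ 2 - P ^+ 2) / 4%:R); first by field.
    by rewrite -PQ; field.
  (* The squares fix [p] and [q] only up to sign; the sign of [q] is adjusted to obtain the product
     [Q]. *)
  have /orP [/eqP E|/eqP E] : (p * q == Q) || (p * q == - Q) by rewrite -eqf_sqr sq.
    by exists p, q; rewrite pE qE; split=> //; field.
  by exists p, (- q); rewrite sqrrN mulrN E pE qE; split; [field|field|ring].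
pose T := comb p (- q) z d; pose U := comb q p z d.
(* Up to the factor z_0 / rho, the product [lin T * lin U] is the resultant of [lin] and [gam] on
   the line through [z] and [d]. *)
have key : lin T * lin U * rho = z 0%N * gam (comb (lin d) (- lin z) z d).
  rewrite lin_comb_mul q2 pq gam_comb.
  transitivity (z 0%N * (lin z * lin d * b + (lin z ^+ 2 - lin d ^+ 2) * a)).
    by rewrite /P /Q; field.
  by rewrite /b /a /cb /ca /cA /cB; ring.
have resd : gam (comb (lin d) (- lin z) z d) = eta ^+ 3 * res z.
  exact: gam_res.
have eta0 : eta != 0.
  by apply/eqP => h; move: eE; rewrite h expr0n mul0r => /esym/eqP; rewrite oner_eq0.
have /andP [lT lU] : (lin T != 0) && (lin U != 0).
  rewrite -negb_or -mulf_eq0; apply: contraNneq rz => h.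
  move/eqP: key; rewrite h mul0r eq_sym mulf_eq0 (negbTE z0) resd mulf_eq0.
  by rewrite expf_eq0 (negbTE eta0).
have E : gam T * lin U + gam U * lin T = z 0%N ^+ 2 * z 7%N * lin T * lin U.
  apply/secant_eqP => //; rewrite q2 pq /P /Q -/a -/b; ring.
pose t i := (z 0%N)^-1 * T i; pose u i := (z 0%N)^-1 * U i.
have lt : lin t != 0 by rewrite linZ mulf_neq0 ?invr_eq0.
have lu : lin u != 0 by rewrite linZ mulf_neq0 ?invr_eq0.
exists t, (gam t / lin t), u, (gam u / lin u); split=> //.
- by rewrite mulrCA divff ?mulr1.
- by rewrite mulrCA divff ?mulr1.
have [d0 e12 e13 e23] := dR.
have eij i j : (z 0%N)^-1 * T i * ((z 0%N)^-1 * T j) + (z 0%N)^-1 * U i * ((z 0%N)^-1 * U j)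
   = (z i * z j + d i * d j) / z 0%N.
  rewrite /T /U /comb; transitivity ((p ^+ 2 + q ^+ 2) * (z i * z j + d i * d j) / z 0%N ^+ 2).
    by field.
  by rewrite p2; field.
case=> [|[|[|[|[|[|[|[|k]]]]]]]] // _; rewrite /vecn /= /t /u ?eij.
- by rewrite d0; field.
- by rewrite d0; field.
- by rewrite d0; field.
- by rewrite d0; field.
- by rewrite e12 /b12; field.
- by rewrite e13 /b13; field.
- by rewrite e23 /b23; field.
rewrite -/t -/u /t /u !gamZ !linZ.
apply: (mulIf lT); apply: (mulIf lU); apply: (mulfI (expf_neq0 2 z0)).
rewrite [_ ^+ 2 * _](_ : _ = z 0%N ^+ 2 * z 7%N * lin T * lin U); last by ring.
by rewrite -E; field; rewrite z0 lT lU.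
Qed.

(** With x = t_1 t_2, y = t_1 t_3, w = t_2 t_3, this is t_1 t_2 t_3 times the part of [gam t] free
    of t_0; the cubes in that part cancel. *)
Definition cub3 (x y w : K) :=
  (c 4 - c 2) * x ^+ 2 * y + (c 5 - c 3) * x * y ^+ 2
  + (c 6 - c 1) * x ^+ 2 * w + (c 7 - c 3) * x * w ^+ 2
  + (c 8 - c 1) * y ^+ 2 * w + (c 9 - c 2) * y * w ^+ 2 + c 0 * x * y * w.

(** Homogeneous equations, which therefore extend from parametrized points to their closure.
    [model_lin] and [model_cub] are [lin t * s = gam t] multiplied by t_0^3 and by t_1 t_2 t_3; the
    latter still restricts the points with [w 0 = 0]. *)
Record model_eqs (w : nat -> K) : Prop := ModelEqs {
  model_b12 : b12 w = 0;
  model_b13 : b13 w = 0;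
  model_b23 : b23 w = 0;
  model_165 : w 1%N * w 6%N = w 2%N * w 5%N;
  model_164 : w 1%N * w 6%N = w 3%N * w 4%N;
  model_lin : lin w * w 0%N * w 7%N = gam w;
  model_cub : (w 1%N * w 6%N + c 1 * w 4%N * w 5%N + c 2 * w 4%N * w 6%N
                + c 3 * w 5%N * w 6%N) * w 7%N
    = cub3 (w 4%N) (w 5%N) (w 6%N)
      - (w 1%N * w 4%N * w 5%N + w 2%N * w 4%N * w 6%N + w 3%N * w 5%N * w 6%N) }.

Lemma model_eqs_vecn t s : lin t * s = gam t -> model_eqs (vecn t s).
Proof.
move=> e; split; rewrite /b12 /b13 /b23 /vecn /=; try ring.
- transitivity (t 0%N ^+ 3 * (lin t * s)); first by rewrite /lin /=; ring.
  by rewrite e /gam /cub /lin /=; ring.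
transitivity (t 1%N * t 2%N * t 3%N * (lin t * s)); first by rewrite /lin /=; ring.
by rewrite e /gam /cub /lin /cub3 /=; ring.
Qed.

Lemma model_eqsZ a w : model_eqs w -> model_eqs (fun k => a * w k).
Proof.
case=> e1 e2 e3 e4 e5 e6 e7; split; rewrite ?linZ ?gamZ.
- by transitivity (a ^+ 2 * b12 w); [rewrite /b12; ring | rewrite e1 mulr0].
- by transitivity (a ^+ 2 * b13 w); [rewrite /b13; ring | rewrite e2 mulr0].
- by transitivity (a ^+ 2 * b23 w); [rewrite /b23; ring | rewrite e3 mulr0].
- by rewrite mulrACA e4; ring.
- by rewrite mulrACA e5; ring.
- by rewrite -e6; ring.
transitivity (a ^+ 3 * ((w 1%N * w 6%N + c 1 * w 4%N * w 5%N + c 2 * w 4%N * w 6%N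
                + c 3 * w 5%N * w 6%N) * w 7%N)); first by ring.
by rewrite e7 /cub3; ring.
Qed.

Lemma model_param w : model_eqs w -> w 0%N != 0 ->
  exists t s, lin t * s = gam t /\ forall k, (k < 8)%N -> w k = vecn t s k.
Proof.
case=> e1 e2 e3 _ _ e6 _ w0.
pose t0 := sqrtC (w 0%N); have t0E : t0 ^+ 2 = w 0%N by rewrite sqrtCK.
have t00 : t0 != 0 by rewrite sqrtC_eq0.
exists (fun i => t0^-1 * w i), (w 7%N); split.
  rewrite linZ gamZ -e6; apply: (mulfI (expf_neq0 3 t00)).
  by rewrite -t0E; field.
have wij i j x : w 0%N * x - w i * w j = 0 -> x = t0^-1 * w i * (t0^-1 * w j).
  move/subr0_eq => h; apply: (mulfI w0); rewrite h -t0E; field => //.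
case=> [|[|[|[|[|[|[|[|k]]]]]]]] // _; rewrite /vecn /=; try exact: wij.
- by rewrite -t0E; field.
- by rewrite -t0E; field.
- by rewrite -t0E; field.
by rewrite -t0E; field.
Qed.

(** If z = w + w' with [w 0 = 0], then w_1, w_2, w_3 vanish, z_0 w_4, z_0 w_5, z_0 w_6 are the three
    [b]'s, and w_7 is given by [model_lin] for w'. Then [psi z = 0] is [model_cub] for w with
    denominators cleared. *)
Definition psi z := (c 1 * b12 z * b13 z + c 2 * b12 z * b23 z + c 3 * b13 z * b23 z)
  * (z 0%N * lin z * z 7%N - gam z) - lin z * cub3 (b12 z) (b13 z) (b23 z).

Lemma sum_coord0 z w w' : z 0%N != 0 -> beta z != 0 -> psi z != 0 ->
  model_eqs w -> model_eqs w' -> (forall k, (k < 8)%N -> z k = w k + w' k) ->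
  w 0%N != 0.
Proof.
move=> z0 bz pz [e1 e2 e3 e4 e5 e6 e7] [f1 f2 f3 _ _ f6 _] zE.
apply: contraNneq pz => w0.
move: bz; rewrite /beta !mulf_eq0 !negb_or => /andP [/andP [n12 n13] n23].
have w0' : w' 0%N = z 0%N by rewrite zE // w0 add0r.
have prod0 x y r : w 0%N * r - x * y = 0 -> x != 0 -> y = 0.
  by rewrite w0 mul0r sub0r => /eqP; rewrite oppr_eq0 mulf_eq0 => /orP [/eqP -> /eqP|/eqP].
(* If [w 1] were nonzero, the quadratic equations with [w 0 = 0] would kill w_2, w_3 and w_6, and
   [b23 z] would reduce to [b23 w' = 0]. The next two claims are analogous. *)
have w1 : w 1%N = 0.
  apply: contraNeq n23 => h.
  have w2 := prod0 _ _ _ e1 h; have w3 := prod0 _ _ _ e2 h.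
  have w6 : w 6%N = 0 by apply: (mulfI h); rewrite mulr0 e4 w2 mul0r.
  by rewrite /b23 !zE // w0 w2 w3 w6 !add0r -/(b23 w') f3.
have w2 : w 2%N = 0.
  apply: contraNeq n13 => h.
  have w3 := prod0 _ _ _ e3 h.
  have w5 : w 5%N = 0 by apply: (mulfI h); rewrite mulr0 -e4 w1 mul0r.
  by rewrite /b13 !zE // w0 w1 w3 w5 !add0r -/(b13 w') f2.
have w3 : w 3%N = 0.
  apply: contraNeq n12 => h.
  have w4 : w 4%N = 0 by apply: (mulfI h); rewrite mulr0 -e5 w1 mul0r.
  by rewrite /b12 !zE // w0 w1 w2 w4 !add0r -/(b12 w') f1.
have z1 : z 1%N = w' 1%N by rewrite zE // w1 add0r.
have z2 : z 2%N = w' 2%N by rewrite zE // w2 add0r.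
have z3 : z 3%N = w' 3%N by rewrite zE // w3 add0r.
have zw i : (i < 4)%N -> w' i = z i.
  by case: i => [|[|[|[|i]]]] // _; rewrite ?w0' ?z1 ?z2 ?z3.
have B12 : b12 z = z 0%N * w 4%N.
  by rewrite /b12 [z 4%N]zE // mulrDr -addrA z1 z2 -w0' -/(b12 w') f1 addr0.
have B13 : b13 z = z 0%N * w 5%N.
  by rewrite /b13 [z 5%N]zE // mulrDr -addrA z1 z3 -w0' -/(b13 w') f2 addr0.
have B23 : b23 z = z 0%N * w 6%N.
  by rewrite /b23 [z 6%N]zE // mulrDr -addrA z2 z3 -w0' -/(b23 w') f3 addr0.
have Z7 : z 0%N * lin z * z 7%N - gam z = z 0%N * lin z * w 7%N.
  by rewrite [z 7%N]zE // -(eq_lin zw) -(eq_gam zw) -f6 w0'; ring.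
rewrite /psi B12 B13 B23 Z7; apply/eqP.
transitivity (z 0%N ^+ 3 * lin z * ((w 1%N * w 6%N + c 1 * w 4%N * w 5%N
   + c 2 * w 4%N * w 6%N + c 3 * w 5%N * w 6%N) * w 7%N
   - cub3 (w 4%N) (w 5%N) (w 6%N))); first by rewrite w1 /cub3; ring.
by rewrite e7 w1 w2 w3; ring.
Qed.

End Model.

(** * General points of P^7 and secants of the model *)

Section ModelGeneric.

Variable K : numClosedFieldType.
Variable c : nat -> K.

Definition co (w : 'rV[K]_8) (k : nat) : K := if (k < 8)%N then w 0 (inord k) else 0.

Lemma polyfun_co k : polyfun (fun w => co w k).
Proof.
by rewrite /co; case: (k < 8)%N; [apply: polyfun_coord | apply: polyfun_cst].
Qed.

Lemma co_row (l : seq K) : size l = 8 -> co (\row_j nth 0 l j) = nth 0 l.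
Proof.
move=> sl; apply: funext => k; rewrite /co; case: ltnP => k8; last by rewrite nth_default ?sl.
by rewrite mxE inordK.
Qed.

Lemma coZ a w : co (a *: w) = (fun k => a * co w k).
Proof. by apply: funext => k; rewrite /co; case: ifP => _; rewrite ?mxE ?mulr0. Qed.

Lemma coD w w' k : co (w + w') k = co w k + co w' k.
Proof. by rewrite /co; case: ifP => _; rewrite ?mxE ?addr0. Qed.

Lemma co_inj w w' : (forall k, (k < 8)%N -> co w k = co w' k) -> w = w'.
Proof.
by move=> h; apply/rowP => j; have := h j (ltn_ord j); rewrite /co ltn_ord inord_val.
Qed.

Definition gen (z : nat -> K) : K :=
  z 0%N * (beta z * (disc c z * (res c z * (lin c z * psi c z)))).

Hint Resolve polyfun_co : core.

Lemma polyfun_lin (f : nat -> 'rV[K]_8 -> K) : (forall k, polyfun (f k)) ->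
  polyfun (fun w => lin c (f^~ w)).
Proof. by move=> fP; rewrite /lin; polyf. Qed.

Lemma polyfun_cub (f : nat -> 'rV[K]_8 -> K) : (forall k, polyfun (f k)) ->
  polyfun (fun w => cub c (f^~ w)).
Proof. by move=> fP; rewrite /cub; polyf. Qed.

Lemma polyfun_gam (f : nat -> 'rV[K]_8 -> K) : (forall k, polyfun (f k)) ->
  polyfun (fun w => gam c (f^~ w)).
Proof. by move=> fP; move: (polyfun_cub fP) (polyfun_lin fP) => ? ?; rewrite /gam; polyf. Qed.

Lemma polyfun_gen_factors : [/\ polyfun (fun w => beta (co w)),
  polyfun (fun w => disc c (co w)), polyfun (fun w => res c (co w)),
  polyfun (fun w => lin c (co w)) & polyfun (fun w => psi c (co w))].
Proof.
have p12 : polyfun (fun w => b12 (co w)) by rewrite /b12; polyf.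
have p13 : polyfun (fun w => b13 (co w)) by rewrite /b13; polyf.
have p23 : polyfun (fun w => b23 (co w)) by rewrite /b23; polyf.
have pe k : polyfun (fun w => eb (co w) k).
  by rewrite /eb; case: k => [|[|[|[|k]]]] /=; rewrite ?nth_nil; polyf.
have pb : polyfun (fun w => beta (co w)) by rewrite /beta; polyf.
have pl := polyfun_lin (f := fun k w => co w k) polyfun_co.
have ple := polyfun_lin (f := fun k w => eb (co w) k) pe.
have pg := polyfun_gam (f := fun k w => co w k) polyfun_co.
have pge := polyfun_gam (f := fun k w => eb (co w) k) pe.
have pgc (a b : K) : polyfun (fun w => gam c (comb a b (co w) (eb (co w)))).
  apply: (polyfun_gam (f := fun k w => comb a b (co w) (eb (co w)) k)) => k.
  by rewrite /comb; polyf.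
have pr : polyfun (fun w => res c (co w)).
  apply: (polyfun_cub (f := fun k w =>
    comb (lin c (eb (co w))) (- lin c (co w)) (co w) (eb (co w)) k)) => k.
  by rewrite /comb; polyf.
have pp : polyfun (fun w => psi c (co w)) by rewrite /psi /cub3; polyf.
have pd : polyfun (fun w => disc c (co w)).
  by rewrite /disc /disc_a /disc_b /g02 /g13; polyf.
by split.
Qed.

Lemma polyfun_gen : polyfun (fun w => gen (co w)).
Proof. by have [? ? ? ? ?] := polyfun_gen_factors; rewrite /gen; polyf. Qed.

(** At the point (n, 0, 0, 0, 1, 1, 1, s) the discriminant is a polynomial of degree at most two in
    s whose coefficient of s^2 is n^16 (n + sg^2)^2; one of n = 1, 2 makes it nonzero. *)
Lemma disc_nonzero : exists z7 z0, disc c (nth 0 [:: z0; 0; 0; 0; 1; 1; 1; z7]) != 0.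
Proof.
pose sg := c 1 + c 2 + c 3.
have [n n0 nsg] : exists2 n : K, n != 0 & n + sg ^+ 2 != 0.
  case: (eqVneq (1 + sg ^+ 2) 0) => h; last by exists 1; rewrite ?oner_neq0.
  exists 2%:R; first by rewrite pnatr_eq0.
  by rewrite (_ : _ + _ = 1 + (1 + sg ^+ 2)); [rewrite h addr0 oner_neq0 | ring].
pose Z s := nth 0 [:: n; 0; 0; 0; 1; 1; 1; s] : nat -> K.
suff [s Ds] : exists s, disc c (Z s) != 0 by exists s, n.
apply: contrapT => H.
have D0 s : disc c (Z s) = 0 by apply/eqP/negPn/negP => h; apply: H; exists s.
have Z0 s : Z s 0%N = n by []. have Z7 s : Z s 7%N = s by [].
have gE s : gam c (Z s) = gam c (Z 0) by [].
have lE s : lin c (Z s) = n by rewrite /lin /Z /=; ring.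
have bE s : beta (Z s) = n ^+ 3 by rewrite /beta /b12 /b13 /b23 /Z /=; ring.
have eE s : eb (Z s) = eb (Z 0) by [].
have leE : lin c (eb (Z 0)) = sg * n ^+ 2.
  by rewrite /lin /eb /b12 /b13 /b23 /sg /Z /=; ring.
have g2 s : g02 c (Z s) (eb (Z 0)) = g02 c (Z 0) (eb (Z 0)) by [].
have g3 s : g13 c (Z s) (eb (Z 0)) = g13 c (Z 0) (eb (Z 0)) by [].
have aE s : disc_a c (Z s) = disc_a c (Z 0) + s * (sg * n ^+ 7).
  by rewrite /disc_a !eE !gE !lE !bE !leE !Z0 !Z7; ring.
have dE s : disc_b c (Z s) = disc_b c (Z 0) - s * (n ^+ 9 - sg ^+ 2 * n ^+ 8).
  by rewrite /disc_b !eE !gE !lE !bE !leE !g2 !g3 !Z0 !Z7; ring.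
have DE s : disc c (Z s) = (disc_b c (Z 0) - s * (n ^+ 9 - sg ^+ 2 * n ^+ 8)) ^+ 2
    + 4%:R * n ^+ 3 * (disc_a c (Z 0) + s * (sg * n ^+ 7)) ^+ 2.
  by rewrite /disc bE aE dE.
(* The second difference in the last coordinate isolates twice the leading coefficient. *)
have : 2%:R * n ^+ 16 * (n + sg ^+ 2) ^+ 2 = disc c (Z 1) + disc c (Z (-1)) - 2%:R * disc c (Z 0).
  by rewrite !DE; ring.
rewrite !D0 mulr0 addr0 subr0; apply/eqP.
by rewrite !mulf_neq0 ?expf_neq0 ?pnatr_eq0.
Qed.

(** At these points [psi] is q s - cub3 with s the last coordinate. Unless q is identically zero, s
    can be chosen; otherwise c_1 = c_2 = c_3 = 0 and [cub3] becomes a multiple of [cub]. *)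
Lemma psi_nonzero t : cub c t != 0 -> t 1%N * t 2%N * t 3%N != 0 ->
  exists z7 z4 z5 z6, psi c (nth 0 [:: 1; 0; 0; 0; z4; z5; z6; z7]) != 0.
Proof.
move=> ct tn.
pose q x y w := c 1 * x * y + c 2 * x * w + c 3 * y * w.
have psiE x y w s : psi c (nth 0 [:: 1; 0; 0; 0; x; y; w; s]) = q x y w * s - cub3 c x y w.
  by rewrite /psi /b12 /b13 /b23 /gam /cub /lin /q /=; rewrite /cub3; ring.
case: (pselect (exists x y w, q x y w != 0)) => [[x [y [w qn]]]|qn].
  exists ((1 + cub3 c x y w) / q x y w), x, y, w.
  by rewrite psiE mulrC divfK // addrK oner_neq0.
have q0 x y w : q x y w = 0.
  by apply/eqP/negPn/negP => h; apply: qn; exists x, y, w.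
have c1 : c 1 = 0 by rewrite -(q0 1 1 0) /q; ring.
have c2 : c 2 = 0 by rewrite -(q0 1 0 1) /q; ring.
have c3 : c 3 = 0 by rewrite -(q0 0 1 1) /q; ring.
exists 0, (t 1%N * t 2%N), (t 1%N * t 3%N), (t 2%N * t 3%N).
rewrite psiE q0 mul0r sub0r oppr_eq0.
apply: contraNneq ct => h; apply/eqP/(mulfI tn); rewrite mulr0 -h.
by rewrite /cub /cub3 c1 c2 c3; ring.
Qed.

(** At the chosen point the entries 1, 2, 3 of [eb] are t_1 t_2 t_3 times those of [t], and [lin] is
    1. *)
Lemma res_nonzero t : cub c t != 0 -> t 1%N * t 2%N * t 3%N != 0 ->
  exists z4 z5 z6, res c (nth 0 [:: 1; 0; 0; 0; z4; z5; z6; 0]) != 0.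
Proof.
move=> ct tn; exists (t 1%N * t 2%N), (t 1%N * t 3%N), (t 2%N * t 3%N).
rewrite (_ : res c _ = (- (t 1%N * t 2%N * t 3%N)) ^+ 3 * cub c t).
  by rewrite mulf_neq0 // expf_neq0 // oppr_eq0.
by rewrite -cubZ /res /cub /comb /lin /eb /b12 /b13 /b23 /=; ring.
Qed.

Lemma gen_nonzero t : cub c t != 0 -> t 1%N * t 2%N * t 3%N != 0 ->
  exists w, gen (co w) != 0.
Proof.
move=> ct tn; have [pb pd pr pl pp] := polyfun_gen_factors.
have wit (F : (nat -> K) -> K) l : size l = 8 -> F (nth 0 l) != 0 ->
    exists w, F (co w) != 0.
  by move=> sl Fl; exists (\row_j nth 0 l j); rewrite co_row.
rewrite /gen; apply: polyfun_nonzero_mul; [by polyf | by polyf | |].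
  by apply: (wit (fun z => z 0%N) [:: 1; 0; 0; 0; 0; 0; 0; 0]); rewrite ?oner_neq0.
apply: polyfun_nonzero_mul; [by polyf | by polyf | |].
  apply: (wit _ [:: 1; 0; 0; 0; 1; 1; 1; 0]) => //.
  by rewrite /beta /b12 /b13 /b23 /= !(mul0r, mul1r, subr0) oner_neq0.
apply: polyfun_nonzero_mul; [by polyf | by polyf | |].
  by have [z7 [z0 h]] := disc_nonzero; apply: wit h.
apply: polyfun_nonzero_mul; [by polyf | by polyf | |].
  by have [z4 [z5 [z6 h]]] := res_nonzero ct tn; apply: wit h.
apply: polyfun_nonzero_mul; [by polyf | by polyf | |].
  apply: (wit _ [:: 1; 0; 0; 0; 1; 1; 1; 0]) => //.
  by rewrite /lin /= !(mulr0, addr0) oner_neq0.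
by have [z7 [z4 [z5 [z6 h]]]] := psi_nonzero ct tn; apply: wit h.
Qed.

Definition vec (t : nat -> K) (s : K) : 'rV[K]_8 := \row_(j < 8) vecn t s j.

Lemma co_vec t s k : (k < 8)%N -> co (vec t s) k = vecn t s k.
Proof. by move=> k8; rewrite /co k8 mxE inordK. Qed.

Lemma addsmx_rowP n (z x y : 'rV[K]_n) : (z <= x + y)%MS ->
  exists a b, z = a *: x + b *: y.
Proof.
case/sub_addsmxP => [[A B]] /= ->.
by exists (A 0 0), (B 0 0); rewrite [A]mx11_scalar [B]mx11_scalar !mul_scalar_mx !mxE !eqxx !mulr1n.
Qed.

Lemma eq_model_eqs w w' : (forall k, (k < 8)%N -> w k = w' k) -> model_eqs c w -> model_eqs c w'.
Proof.
move=> e [e1 e2 e3 e4 e5 e6 e7]; have e' : forall i, (i < 4)%N -> w i = w' i.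
  by move=> i i4; apply: e; apply: ltn_trans i4 _.
by split; rewrite /b12 /b13 /b23 -?(eq_lin c e') -?(eq_gam c e') -!e.
Qed.

(** Existence of the secant uses the points that [X] contains by parametrization; uniqueness uses
    the equations satisfied by all its points. The matrix [N] is the coordinate change to the
    model. *)
Lemma model_oadp (X : set 'rV[K]_8) (N : 'M[K]_8) t0 :
  cub c t0 != 0 -> t0 1%N * t0 2%N * t0 3%N != 0 -> N \in unitmx ->
  (forall v, X v -> v != 0) -> (forall v a, a != 0 -> X v -> X (a *: v)) ->
  (forall t s, lin c t != 0 -> lin c t * s = gam c t -> vec t s != 0 ->
     X (vec t s *m N)) ->
  (forall v, X v -> model_eqs c (co (v *m invmx N))) ->
  one_apparent_double_point X.
Proof.
move=> ct tn uN Xn0 XZ Xvec Xeqs.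
have [w0 gw0] := gen_nonzero ct tn.
have [P PE] := polyfun_gen.
apply: (@general_pspace K 8 _ (fun v => gen (co (v *m invmx N))) (w0 *m N)).
- move=> v a a0 [x1 [x2 [[X1 X2 n12 s12] H]]]; exists x1, x2; split.
    split=> //; apply: submx_trans s12; rewrite -{1}[v]scale1r -(mulVf a0) -scalerA.
    exact: scalemx_sub.
  move=> y1 y2 [Y1 Y2 n s]; apply: H; split=> //.
  exact: scalemx_sub.
- apply: (polyfun_eq (fun v => esym (PE (v *m invmx N)))).
  exact: (polyfun_meval P (f := fun i v => (v *m invmx N) 0 i) (polyfun_mulmx _)).
- apply: contraNneq gw0 => h; rewrite /gen.
  have -> : w0 = 0 by rewrite -[w0](mulmxK uN) h mul0mx.
  by rewrite {1}/co /= mxE mul0r.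
- by rewrite mulmxK.
move=> v v0; set z := v *m invmx N => gz.
have vE : v = z *m N by rewrite mulmxKV.
move: gz; rewrite /gen mulf_eq0 negb_or => /andP [z0].
rewrite mulf_eq0 negb_or => /andP [bz]; rewrite mulf_eq0 negb_or => /andP [dz].
rewrite mulf_eq0 negb_or => /andP [rz]; rewrite mulf_eq0 negb_or => /andP [lz pz].
(* The vector [v] is off the cone over [X], on which [b12] vanishes; so in a decomposition of [v]
   both summands are nonzero and they are not proportional. *)
have b0 : forall a w, X w -> v <> a *: w.
  move=> a w Xw vw; have := Xeqs w Xw; move/(model_eqsZ a).
  rewrite -coZ scalemxAl -vw -/z => -[e12 _ _ _ _ _ _].
  by move: bz; rewrite /beta e12 !mul0r eqxx.
have cone t s : lin c t != 0 -> lin c t * s = gam c t -> vec t s != 0 ->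
    X (vec t s *m N) by exact: Xvec.
have [t [s [u [r [lt lu ht hu zE]]]]] := dec_exists z0 bz dz rz.
have zv : z = vec t s + vec u r.
  by apply: co_inj => k k8; rewrite coD !co_vec // zE.
have vv : v = vec t s *m N + vec u r *m N by rewrite vE zv mulmxDl.
have nt : vec t s != 0.
  apply/eqP => h; move: vv; rewrite h mul0mx add0r => vu.
  have nu : vec u r != 0.
    by apply: contraNneq v0 => h'; rewrite vu h' mul0mx.
  by apply: (b0 1 _ (cone _ _ lu hu nu)); rewrite scale1r.
have Xt := cone _ _ lt ht nt.
have nu : vec u r != 0.
  apply/eqP => h; move: vv; rewrite h mul0mx addr0 => vu.
  by apply: (b0 1 _ Xt); rewrite scale1r.
have Xu := cone _ _ lu hu nu.
exists (vec t s *m N), (vec u r *m N); split.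
  split=> //.
    apply/negP => /andP [_ /sub_rVP [a ua]].
    by apply: (b0 (1 + a) _ Xt); rewrite scalerDl scale1r -ua -vv.
  by rewrite vv addmx_sub_adds.
move=> y1 y2 [Y1 Y2 _ /addsmx_rowP [a [b vab]]].
have a0 : a != 0.
  by apply/eqP => h; apply: (b0 b _ Y2); rewrite vab h scale0r add0r.
have bn0 : b != 0.
  by apply/eqP => h; apply: (b0 a _ Y1); rewrite vab h scale0r addr0.
(* The coefficients are absorbed into the points, which makes [z] the sum of two vectors of the
   cone. *)
pose w1 := a *: (y1 *m invmx N); pose w2 := b *: (y2 *m invmx N).
have e1 : model_eqs c (co w1) by rewrite coZ; apply/model_eqsZ/Xeqs.
have e2 : model_eqs c (co w2) by rewrite coZ; apply/model_eqsZ/Xeqs.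
have zw k : (k < 8)%N -> co z k = co w1 k + co w2 k.
  by move=> _; rewrite -coD /z vab mulmxDl -!scalemxAl.
have zw' k : (k < 8)%N -> co z k = co w2 k + co w1 k by move/zw; rewrite addrC.
have w10 := sum_coord0 z0 bz pz e1 e2 zw.
have w20 := sum_coord0 z0 bz pz e2 e1 zw'.
have [t' [s' [ht' wt']]] := model_param e1 w10.
have [u' [r' [hu' wu']]] := model_param e2 w20.
have zE' : dec (co z) t' s' u' r' by move=> k k8; rewrite zw // wt' // wu'.
have zE2 : dec (co z) u' r' t' s' by move=> k k8; rewrite zE' // addrC.
have bz' := bz.
move: bz; rewrite /beta !mulf_eq0 !negb_or => /andP [/andP [n12 n13] n23].
have yE y x w k : k != 0 -> w = k *: (y *m invmx N) -> w = x -> (y == x *m N)%MS.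
  move=> k0 -> <-; rewrite -scalemxAl mulmxKV //.
  by apply/eqmxP/eqmx_sym/eqmx_scale.
have vE' w x q : (forall k, (k < 8)%N -> co w k = vecn x q k) -> w = vec x q.
  by move=> h; apply: co_inj => k k8; rewrite co_vec // h.
have [H|H] := dec_unique z0 n12 n13 n23 (fun d => disc_neq0 bz' dz (d := d)) lt lu ht hu ht' hu' zE zE'.
  apply/orP; left; apply/andP; split.
    by apply: yE a0 (erefl w1) _; apply: vE' => k k8; rewrite wt' // (H k k8).1.
  by apply: yE bn0 (erefl w2) _; apply: vE' => k k8; rewrite wu' // (H k k8).2.
apply/orP; right; apply/andP; split.
  by apply: yE a0 (erefl w1) _; apply: vE' => k k8; rewrite wt' // (H k k8).1.
by apply: yE bn0 (erefl w2) _; apply: vE' => k k8; rewrite wu' // (H k k8).2.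
Qed.

End ModelGeneric.

(** * Plane curves without isolated points *)

Section Bivariate.

Variable K : numFieldType.
Implicit Types (p q f : {poly {poly K}}) (s : {poly K}).

(** The outer indeterminate takes the value [v]; the coefficients are polynomials in [u]. *)
Definition ev p (u v : K) : K := p.[v%:P].[u].

Definition red (u : K) p : {poly K} := map_poly (horner_eval u) p.

Lemma ev_red p u v : ev p u v = (red u p).[v].
Proof.
rewrite /ev /red; have := horner_map (horner_eval u) p v%:P.
by rewrite /= /horner_eval hornerC.
Qed.

Lemma evD p q u v : ev (p + q) u v = ev p u v + ev q u v.
Proof. by rewrite /ev !hornerD. Qed.

Lemma evB p q u v : ev (p - q) u v = ev p u v - ev q u v.
Proof. by rewrite /ev !hornerE. Qed.

Lemma evM p q u v : ev (p * q) u v = ev p u v * ev q u v.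
Proof. by rewrite /ev !hornerM. Qed.

Lemma evZ s p u v : ev (s *: p) u v = s.[u] * ev p u v.
Proof. by rewrite /ev hornerZ hornerM. Qed.

Lemma ev_vanishing p : (forall u v, ev p u v = 0) -> p = 0.
Proof.
move=> p0; apply/polyP => i; rewrite coef0; apply: poly_vanishing => u.
have : red u p = 0 by apply: poly_vanishing => v; rewrite -ev_red.
by move/(congr1 (fun r : {poly K} => r`_i)); rewrite coef_map coef0.
Qed.

Lemma deriv_bivariate_neq0 p : (1 < size p)%N -> p^`() != 0.
Proof.
move=> sp; apply/eqP => /polyP/(_ (size p).-2).
rewrite coef_deriv coef0 (_ : (size p).-2.+1 = (size p).-1); last by lia.
move=> h; have : lead_coef p == 0.
  apply/eqP/polyP => i; move/polyP/(_ i): h; rewrite coefMn !coef0 => /eqP.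
  by rewrite mulrn_eq0 => /orP [/eqP|/eqP //]; lia.
by rewrite lead_coef_eq0 => /eqP p0; rewrite p0 size_poly0 in sp.
Qed.

Section Vanishing.

Variable S : K -> K -> Prop.

Definition van p := forall u v, S u v -> ev p u v = 0.

Lemma vanD p q : van p -> van q -> van (p + q).
Proof. by move=> hp hq u v h; rewrite evD hp ?hq ?addr0. Qed.

Lemma vanB p q : van p -> van q -> van (p - q).
Proof. by move=> hp hq u v h; rewrite evB hp ?hq ?subr0. Qed.

Lemma vanM p q : van q -> van (p * q).
Proof. by move=> hq u v h; rewrite evM hq ?mulr0. Qed.

Lemma vanZ s p : van p -> van (s *: p).
Proof. by move=> hq u v h; rewrite evZ hq ?mulr0. Qed.

(** Over the field K(u), [g] generates the ideal of polynomials vanishing on [S]: [size] sees only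
    the degree in the outer variable. *)
Definition minimal_van g :=
  [/\ van g, g != 0 & forall f, van f -> (size f < size g)%N -> f = 0].

Lemma minimal_van_exists f : van f -> f != 0 -> exists g, minimal_van g.
Proof.
move=> vf f0.
have ex : exists n, `[< exists2 g, van g & g != 0 /\ size g = n >].
  by exists (size f); apply/asboolP; exists f.
case: (ex_minnP ex) => n /asboolP [g vg [g0 sg]] H; exists g; split=> // h vh sh.
apply: contrapT => /eqP h0; move: sh; rewrite ltnNge sg => /negP; apply.
by apply: H; apply/asboolP; exists h.
Qed.

Variable g : {poly {poly K}}.
Hypothesis gmin : minimal_van g.

(* On [{poly {poly K}}], [%|] is pseudo-divisibility: [g] divides the product of
   [f] and some nonzero element of [{poly K}]. *)
Lemma minimal_van_dvd f : van f -> g %| f.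
Proof.
have [vg g0 Hg] := gmin; move=> vf; rewrite /dvdp; apply/eqP/Hg.
  have -> : f %% g = lead_coef g ^+ scalp f g *: f - f %/ g * g.
    by rewrite Pdiv.Idomain.divp_eq addrAC subrr add0r.
  by apply: vanB; [apply: vanZ | apply: vanM].
by rewrite Pdiv.Idomain.ltn_modp.
Qed.

(** If [s *: g = k * u ^+ 2], then [k * u] vanishes on [S], because its square is a multiple of [g];
    but its degree is smaller. *)
Lemma minimal_van_separable : separable_poly g.
Proof.
have [vg g0 Hg] := gmin.
apply/separable_polyP; split; last by move=> u _; apply: deriv_bivariate_neq0.
apply/poly_square_freeP => u su; apply/negP.
move/Pdiv.Idomain.dvdpP => [[s k] /= s0 E].
have sg0 : s *: g != 0 by rewrite scale_poly_eq0 negb_or s0.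
have [k0 u0] : k != 0 /\ u != 0.
  by move: sg0; rewrite E mulf_eq0 negb_or expf_eq0 /= => /andP.
have h0 : k * u = 0.
  apply: Hg.
    move=> a b Sab; have : ev ((k * u) ^+ 2) a b = 0.
      have -> : (k * u) ^+ 2 = k * (s *: g) by rewrite E; ring.
      by rewrite evM evZ vg // !mulr0.
    by rewrite expr2 evM => /eqP; rewrite mulf_eq0 orbb => /eqP.
  have := congr1 (fun p : {poly {poly K}} => size p) E.
  rewrite size_scale // !size_mul ?expf_neq0 // => ->.
  have : (0 < size u)%N by rewrite size_poly_gt0.
  have : (0 < size k)%N by rewrite size_poly_gt0.
  have : size (u ^+ 2) = (size u + size u).-1 by rewrite expr2 size_mul.
  by move: su; lia.
by move/eqP: h0; rewrite mulf_eq0 (negbTE k0) (negbTE u0).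
Qed.

Lemma minimal_van_dvd_sqr f : van f -> van f^`() -> g * g %| f.
Proof.
move=> vf vf'; have := minimal_van_dvd vf.
move/Pdiv.Idomain.dvdpP => [[s k] /= s0 E].
have gk : g %| k.
  have := minimal_van_separable; rewrite separable_poly.unlock => cop.
  rewrite -(Gauss_dvdpl k cop).
  have -> : k * g^`() = s *: f^`() - k^`() * g by rewrite -derivZ E derivM; ring.
  rewrite dvdp_sub // ?dvdp_mull // Pdiv.Idomain.dvdpZr //.
  exact: minimal_van_dvd.
rewrite -(Pdiv.Idomain.dvdpZr _ _ s0) E.
exact: dvdp_mul.
Qed.

End Vanishing.

Definition tdeg_le (n : nat) p := forall i k, (n < i + k)%N -> p`_i`_k = 0.

(** The part of degree [n], dehomogenized. It is multiplicative, which makes total degrees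
    additive. *)
Definition top (n : nat) p : {poly K} := \poly_(i < n.+1) p`_i`_(n - i).

Lemma tdeg_leD n p q : tdeg_le n p -> tdeg_le n q -> tdeg_le n (p + q).
Proof. by move=> hp hq i k h; rewrite !coefD hp ?hq ?addr0. Qed.

Lemma tdeg_leW m n p : (m <= n)%N -> tdeg_le m p -> tdeg_le n p.
Proof. by move=> mn h i k ik; apply: h; lia. Qed.

Lemma tdeg_leC a : tdeg_le 0 a%:P%:P.
Proof. by case=> [|i] [|k] //; rewrite !coefC ?coef0. Qed.

Lemma tdeg_leM n m p q : tdeg_le n p -> tdeg_le m q -> tdeg_le (n + m) (p * q).
Proof.
move=> hp hq i k ik; rewrite coefM coef_sum big1 // => j _.
rewrite coefM big1 // => l _.
have := ltn_ord j; have := ltn_ord l => hl hj.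
case: (ltnP n (j + l)) => h; first by rewrite hp ?mul0r.
by rewrite hq ?mulr0 //; lia.
Qed.

Lemma tdeg_le_size n p : tdeg_le n p -> (size p <= n.+1)%N.
Proof.
by move=> h; apply/leq_sizeP => j nj; apply/polyP => k; rewrite coef0 h //; lia.
Qed.

Lemma tdeg_le_coef_size n p i : tdeg_le n p -> (size (p`_i)%R <= n.+1 - i)%N.
Proof. by move=> h; apply/leq_sizeP => k nk; rewrite h //; lia. Qed.

Lemma tdeg_le_exists p : exists n, tdeg_le n p.
Proof.
exists (size p + \max_(i < size p) size (p`_i)%R)%N => i k ik.
case: (ltnP i (size p)) => hi; last by rewrite (nth_default _ hi) coef0.
rewrite nth_default //.
apply: leq_trans (@leq_bigmax _ (fun j : 'I_(size p) => size p`_j) (Ordinal hi)) _.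
by move: ik; set M := (\max_(_ < _) _)%N => ik; apply: (@leq_trans M); lia.
Qed.

Lemma topM n m p q : tdeg_le n p -> tdeg_le m q -> top (n + m) (p * q) = top n p * top m q.
Proof.
move=> hp hq; apply/polyP => i; rewrite coef_poly coefM.
case: ifP => hi.
  rewrite coefM coef_sum; apply: eq_bigr => j _.
  have hj : (j <= i)%N by rewrite -ltnS.
  rewrite !coef_poly coefM; case: (leqP j n) => jn; last first.
    rewrite ltnS leqNgt jn mul0r big1 // => l _.
    by rewrite hp ?mul0r //; lia.
  rewrite ltnS jn; case: (leqP (i - j) m) => im; last first.
    rewrite ltnS leqNgt im mulr0 big1 // => l _.
    by rewrite hq ?mulr0 //; have := ltn_ord l; lia.
  rewrite ltnS im.
  have hl : (n - j < (n + m - i).+1)%N by lia.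
  rewrite (bigD1 (Ordinal hl)) //= big1 ?addr0; last first.
    move=> l /negP lne; have := ltn_ord l => hl'.
    case: (ltnP n (j + l)) => h; first by rewrite hp ?mul0r.
    rewrite hq ?mulr0 //; have : (l : nat) != (n - j)%N.
      by apply/negP => /eqP e; apply: lne; apply/eqP/val_inj.
    by lia.
  by congr (_ * _`_ _); lia.
rewrite big1 // => j _; rewrite !coef_poly; have := ltn_ord j => hj.
case: ifP => h1; last by rewrite mul0r.
case: ifP => h2; last by rewrite mulr0.
by lia.
Qed.

Lemma top_eq0 n p : tdeg_le n p -> top n p = 0 -> p = 0 \/ (0 < n)%N /\ tdeg_le n.-1 p.
Proof.
move=> hp /polyP t0.
have c0 i k : (i + k = n)%N -> p`_i`_k = 0.
  move=> e; have := t0 i; rewrite coef_poly coef0 ltnS.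
  have -> : (i <= n)%N by lia.
  by have -> : (n - i = k)%N by lia.
case: n hp {t0} c0 => [|n] hp c0.
  left; apply/polyP => i; apply/polyP => k; rewrite !coef0.
  by case: (posnP (i + k)) => h; [apply: c0 | apply: hp].
right; split=> // i k /= h; case: (ltnP n.+1 (i + k)) => h'; first exact: hp.
by apply: c0; lia.
Qed.

Lemma tdeg_le_minimal p : p != 0 -> exists2 n, tdeg_le n p & top n p != 0.
Proof.
move=> p0.
have ex : exists n, `[< tdeg_le n p >] by have [n h] := tdeg_le_exists p; exists n; apply/asboolP.
case: (ex_minnP ex) => n /asboolP hn H; exists n => //; apply/eqP.
move=> /(top_eq0 hn) [/eqP|[n0 h]]; first exact/negP.
by have := H n.-1; rewrite asboolT // => /(_ isT); lia.
Qed.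

(** Total degrees add, and that of [q] is at least its degree in the outer variable. *)
Lemma tdeg_le_factor d p q : tdeg_le d (p * q) -> q != 0 -> tdeg_le (d - (size q).-1) p.
Proof.
move=> hpq q0; case: (eqVneq p 0) => [->|p0]; first by move=> i k _; rewrite !coef0.
have [n hn tn] := tdeg_le_minimal p0; have [m hm tm] := tdeg_le_minimal q0.
have nm : (n + m <= d)%N.
  rewrite leqNgt; apply/negP => dnm.
  have : top (n + m) (p * q) != 0 by rewrite topM // mulf_neq0.
  case/eqP; apply/polyP => i; rewrite coef_poly coef0; case: ifP => // hi.
  by apply: hpq; lia.
apply: tdeg_leW hn; have := tdeg_le_size hm; move: (size q) => b; lia.
Qed.

End Bivariate.

(** * Gauss's lemma over K[u] *)

Section Gauss.

Variable K : numClosedFieldType.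
Implicit Types (p q f g : {poly {poly K}}) (s : {poly K}).

Lemma red_eq0 u p : red u p = 0 -> exists p', p = ('X - u%:P) *: p'.
Proof.
move=> r0; exists (\poly_(i < size p) (p`_i %/ ('X - u%:P))).
apply/polyP => i; rewrite coefZ coef_poly; case: ltnP => hi; last first.
  by rewrite nth_default // mulr0.
rewrite mulrC divpK // dvdp_XsubCl /root.
by move/polyP/(_ i): r0; rewrite coef_map coef0 /= /horner_eval => ->.
Qed.

Lemma redM u p q : red u (p * q) = red u p * red u q.
Proof. exact: rmorphM. Qed.

Lemma redZ u s p : red u (s *: p) = s.[u] *: red u p.
Proof. by rewrite /red map_polyZ. Qed.

(** The roots of [s] are removed one at a time: at a root [u] the reduction of [g * k] vanishes,
    hence that of one factor, which is then divisible by ['X - u%:P]. The last clause records that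
    [g] and [g'] differ by a factor from K(u). *)
Lemma gauss_factor a g k s : s != 0 -> s *: a = g * k -> g != 0 ->
  exists g' k', [/\ a = g' * k', size g' = size g &
     exists2 c, c != 0 & exists c', c *: g = c' *: g'].
Proof.
move=> s0 E g0.
suff [g' [k' [b [b0 E' sg [c c0 [c' cg]]]]]] : exists g' k' b,
    [/\ b != 0, b%:P *: a = g' * k', size g' = size g &
     exists2 c, c != 0 & exists c', c *: g = c' *: g'].
  exists g', (b^-1%:P *: k'); split=> //; last by exists c => //; exists c'.
  by rewrite -scalerAr -E' scalerA -polyCM mulVf // scale1r.
have H1 : exists2 c, c != 0 & exists c', c *: g = c' *: g.
  by exists 1; rewrite ?oner_neq0 //; exists 1.
have [n sn] := ubnP (size s).
suff gen : forall s g' k', s != 0 -> (size s < n)%N -> s *: a = g' * k' ->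
    size g' = size g -> (exists2 c, c != 0 & exists c', c *: g = c' *: g') ->
    exists g' k' b, [/\ b != 0, b%:P *: a = g' * k', size g' = size g &
     exists2 c, c != 0 & exists c', c *: g = c' *: g'].
  exact: gen s0 sn E _ H1.
move=> {s s0 E sn H1 k}.
elim: n => // n IH s g' k' s0 sn E sg [c c0 [c' cg]].
case: (leqP (size s) 1) => s1.
  move/size1_polyC: s1 => sE; exists g', k', s`_0.
  split=> //.
  - by apply: contraNneq s0 => h; rewrite sE h polyC0.
  - by rewrite -sE.
  by exists c => //; exists c'.
have [u su] : exists u, root s u.
  by apply/closed_rootP; rewrite neq_ltn s1 orbT.
have [s' sE] := factor_theorem _ _ su.
have X0 : 'X - u%:P != 0 by rewrite polyXsubC_eq0.
have s'0 : s' != 0 by apply: contraNneq s0 => h; rewrite sE h mul0r.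
have s's : (size s' < n)%N.
  by move: sn; rewrite sE size_Mmonic ?monicXsubC // size_XsubC addn2.
have /eqP : red u g' * red u k' = 0.
  by rewrite -redM -E redZ (eqP su) scale0r.
have canc (x y : {poly {poly K}}) : ('X - u%:P) *: x = ('X - u%:P) *: y -> x = y.
  by rewrite -!mul_polyC => /mulfI; apply; rewrite polyC_eq0.
rewrite mulf_eq0 => /orP [/eqP/red_eq0 [h hE]|/eqP/red_eq0 [h hE]].
  apply: (IH s' h k' s'0 s's).
  - by apply: canc; rewrite scalerA mulrC -sE E hE scalerAl.
  - by rewrite -sg hE size_scale.
  by exists c => //; exists (c' * ('X - u%:P)); rewrite cg hE scalerA.
apply: (IH s' g' h s'0 s's) => //; last by exists c => //; exists c'.
by apply: canc; rewrite scalerA mulrC -sE E hE scalerAr.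
Qed.

End Gauss.

(** * Ternary forms in an affine chart *)

Section Dehomogenize.

Variable K : numClosedFieldType.
Variables al be : K.
Implicit Types (P Q : {mpoly K[3]}) (p q : {poly {poly K}}).

(* Dehomogenization after a change of coordinates depending on [al] and [be], which
   are chosen so that the coefficient of the highest power of ['X] is nonzero. *)
Definition shear (i : 'I_3) : {poly {poly K}} :=
  nth 0 [:: 1 + al%:P%:P * 'X; 'X%:P + be%:P%:P * 'X; 'X] i.

Definition pt (u v : K) : 'rV[K]_3 := \row_i nth 0 [:: 1 + al * v; u + be * v; v] i.

Definition deh P : {poly {poly K}} :=
  \sum_(m <- msupp P) (P@_m)%:P%:P * \prod_i shear i ^+ m i.

Lemma ev_shear i u v : ev (shear i) u v = pt u v 0 i.
Proof.
rewrite mxE /shear; case: i => [[|[|[|i]]] //= _]; rewrite /ev !hornerE //=.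
Qed.

Lemma ev_deh P u v : ev (deh P) u v = P.@[pt u v 0].
Proof.
rewrite mevalE /deh /ev !horner_sum; apply: eq_bigr => m _.
rewrite !hornerM !hornerC; congr (_ * _); rewrite !horner_prod; apply: eq_bigr => i _.
by rewrite !horner_exp -ev_shear.
Qed.

Lemma deh_is_linear a b P Q : deh (a *: P + b *: Q) = a%:P *: deh P + b%:P *: deh Q.
Proof.
apply/subr0_eq/ev_vanishing => u v.
by rewrite evB evD !evZ !hornerC !ev_deh mevalD !mevalZ subrr.
Qed.

Lemma dehM P Q : deh (P * Q) = deh P * deh Q.
Proof. by apply/subr0_eq/ev_vanishing => u v; rewrite evB evM !ev_deh mevalM subrr. Qed.

Lemma tdeg_le_shear i : tdeg_le 1 (shear i).
Proof.
rewrite /shear; case: i => [[|[|[|i]]] //= _] j k jk.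
- rewrite coefD coef1 coefCM coefX coefD.
  by case: j jk => [|[|j]] //=; case: k => [|k] //; rewrite ?mulr0 ?mulr1 ?coef0 ?coef1 ?coefC ?addr0.
- rewrite coefD coefC coefCM coefX coefD.
  by case: j jk => [|[|j]] //=; case: k => [|[|k]] //; rewrite ?mulr0 ?mulr1 ?coef0 ?coefX ?coefC ?addr0.
rewrite coefX; case: j jk => [|[|j]] //=; case: k => [|k] //; rewrite ?coef0 ?coef1 //.
Qed.

Lemma tdeg_le_deh n P : P \is n.-homog -> tdeg_le n (deh P).
Proof.
move/dhomogP => hP; rewrite /deh big_seq.
apply: (big_ind (fun p => tdeg_le n p)) => [i k _|p q|m /hP mn]; rewrite ?coef0 //; first exact: tdeg_leD.
rewrite -[n]add0n; apply: tdeg_leM; first exact: tdeg_leC.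
rewrite -mn -[X in tdeg_le X _]/(mdeg m) mdegE.
apply: (big_ind2 (fun (n : nat) p => tdeg_le n p)) => [|n1 p1 n2 p2|i _]; first exact: tdeg_leC.
  exact: tdeg_leM.
elim: (m i) => [|k IH]; first exact: tdeg_leC.
by rewrite exprS -add1n; apply: tdeg_leM => //; apply: tdeg_le_shear.
Qed.

Definition unshear (i : nat) : {mpoly K[3]} :=
  nth 0 [:: 'X_(inord 0) - al *: 'X_(inord 2); 'X_(inord 1) - be *: 'X_(inord 2);
            'X_(inord 2)] i.

Definition homogenize n p : {mpoly K[3]} :=
  \sum_(i < n.+1) \sum_(k < n.+1 - i) p`_i`_k *:
    (unshear 0 ^+ (n - i - k) * unshear 1 ^+ k * unshear 2 ^+ i).

Lemma unshear_homog i : (i < 3)%N -> unshear i \is 1.-homog.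
Proof.
have X j : ('X_j : {mpoly K[3]}) \is 1.-homog by rewrite dhomogX; apply/eqP; apply: mdeg1.
by case: i => [|[|[|i]]] // _; rewrite /unshear /= ?rpredB ?rpredZ.
Qed.

Lemma homogenize_homog n p : homogenize n p \is n.-homog.
Proof.
apply: rpred_sum => i _; apply: rpred_sum => k _; apply: rpredZ.
have e : n = (1 * (n - i - k) + 1 * k + 1 * i)%N by have := ltn_ord i; have := ltn_ord k; lia.
have H : unshear 0 ^+ (n - i - k) * unshear 1 ^+ k * unshear 2 ^+ i
    \is (1 * (n - i - k) + 1 * k + 1 * i).-homog.
  by do ?[apply: dhomogM]; apply: dhomogMn; apply: unshear_homog.
by rewrite -e in H.
Qed.

Lemma meval_homogenize n p (y : 'rV[K]_3) : (homogenize n p).@[y 0] =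
  \sum_(i < n.+1) \sum_(k < n.+1 - i) p`_i`_k * ((y 0 (inord 0) - al * y 0 (inord 2)) ^+ (n - i - k)
    * (y 0 (inord 1) - be * y 0 (inord 2)) ^+ k * y 0 (inord 2) ^+ i).
Proof.
rewrite raddf_sum; apply: eq_bigr => i _ /=; rewrite raddf_sum; apply: eq_bigr => k _ /=.
by rewrite mevalZ !rmorphM !rmorphXn /unshear /= !mevalB !mevalZ !mevalXU.
Qed.

Lemma meval_homogenize_pt n p u v : tdeg_le n p -> (homogenize n p).@[pt u v 0] = ev p u v.
Proof.
move=> hp; rewrite meval_homogenize !mxE !inordK //= /ev.
rewrite !addrK (horner_coef_wide _ (tdeg_le_size hp)) horner_sum.
apply: eq_bigr => i _; rewrite hornerM (horner_coef_wide _ (tdeg_le_coef_size i hp)) mulr_suml.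
rewrite -polyC_exp hornerC; apply: eq_bigr => k _.
by rewrite expr1n mul1r mulrA.
Qed.

Lemma homogenizeK n p : tdeg_le n p -> deh (homogenize n p) = p.
Proof.
move=> hp; apply/subr0_eq/ev_vanishing => u v.
by rewrite evB ev_deh meval_homogenize_pt // subrr.
Qed.

Lemma pt_scale (y : 'rV[K]_3) (y0 := y 0 (inord 0) - al * y 0 (inord 2)) : y0 != 0 ->
  y = y0 *: pt ((y 0 (inord 1) - be * y 0 (inord 2)) / y0) (y 0 (inord 2) / y0).
Proof.
move=> h; apply/rowP => j; rewrite !mxE.
have jE (k : nat) (k3 : (k < 3)%N) : Ordinal k3 = inord k :> 'I_3 by apply/val_inj; rewrite /= inordK.
case: j => [[|[|[|k]]] //= k3]; rewrite jE; try by field.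
by transitivity (y0 + al * y 0 (inord 2)); [rewrite /y0; ring | field].
Qed.

Lemma deh_inj n P : P \is n.-homog -> deh P = 0 -> P = 0.
Proof.
move=> hP dP; apply: mpoly_vanishing => w.
have -> : P.@[w] = P.@[(\row_i w i) 0] by apply: meval_eq => i; rewrite mxE.
apply: (@polyfun_dense K 3 (fun y => P.@[y 0])
  (fun y => y 0 (inord 0) - al * y 0 (inord 2)) (pt 0 0)).
- by exists P.
- apply: polyfun_add; first exact: polyfun_coord.
  by apply/polyfun_opp/polyfun_mul; [apply: polyfun_cst | apply: polyfun_coord].
- by rewrite !mxE !inordK //= !mulr0 addr0 subr0 oner_neq0.
move=> y /pt_scale ->; rewrite (meval_homogZ _ _ hP) -ev_deh dP.
by rewrite /ev !horner0 mulr0.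
Qed.

Lemma deh0 : deh 0 = 0.
Proof. by apply/ev_vanishing => u v; rewrite ev_deh meval0. Qed.

End Dehomogenize.

Lemma roots_seq (K : closedFieldType) (p : {poly K}) : p != 0 ->
  exists rs : seq K, forall x, p.[x] = 0 -> x \in rs.
Proof.
move=> p0; have [rs E] := closed_field_poly_normal p; exists rs => x.
move/eqP; rewrite {1}E hornerZ mulf_eq0 lead_coef_eq0 (negbTE p0) /=.
by rewrite -[_ == 0]/(root _ x) root_prod_XsubC.
Qed.

(** * The cubic through a plane curve on no conic *)

Section Cubic.

Variable K : numClosedFieldType.
Variable D : 'rV[K]_3 -> Prop.

Definition van_on (P : {mpoly K[3]}) := forall y, D y -> P.@[y 0] = 0.

(** Singularity is stated as order two on every line through the point: this is what arcs provide,
    and the partial derivative in the chart is read off from it. *)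
Definition double_on (P : {mpoly K[3]}) := forall y, D y -> forall w : 'rV[K]_3,
  exists q : {poly K}, forall t, P.@[(y + t *: w) 0] = t ^+ 2 * q.[t].

Hypothesis D_scale : forall y a, a != 0 -> D y -> D (a *: y).
Hypothesis D_isolated : forall n (P : {mpoly K[3]}) (l : seq 'rV[K]_3), P \is n.-homog ->
  (forall y, D y -> P.@[y 0] = 0 \/ exists x a, x \in l /\ y = a *: x) -> van_on P.
Hypothesis D_low : forall n (P : {mpoly K[3]}), (n <= 2)%N -> P \is n.-homog ->
  van_on P -> P = 0.

Lemma double_on_van P : double_on P -> van_on P.
Proof.
move=> dP y Dy; have [q /(_ 0)] := dP y Dy 0.
by rewrite scale0r addr0 expr0n mul0r.
Qed.

Section Coordinates.

Variables al be : K.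
Let S u v := D (pt al be u v).
Let dh := deh al be.

Lemma van_deh P : van_on P -> van S (dh P).
Proof. by move=> vP u v h; rewrite ev_deh vP. Qed.

(** Increasing [v] moves [pt al be u v] in the direction (al, be, 1), along which [P] vanishes to
    order two. *)
Lemma van_deh_deriv P : double_on P -> van S (dh P)^`().
Proof.
move=> dP u v Suv; rewrite ev_red /red -deriv_map -/(red u (dh P)).
pose w : 'rV[K]_3 := \row_i nth 0 [:: al; be; 1] i.
have [q qE] := dP _ Suv w.
have E : red u (dh P) \Po ('X + v%:P) = 'X^2 * q.
  apply/subr0_eq/poly_vanishing => t; rewrite hornerD hornerN horner_comp -ev_red ev_deh.
  rewrite !hornerE; apply/eqP; rewrite subr_eq0 -qE; apply/eqP.
  congr (_.@[_]); congr (fun_of_matrix _ _); apply/rowP => i; rewrite !mxE.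
  by case: i => [[|[|[|i]]] //= _]; ring.
have := congr1 (fun p : {poly K} => p^`().[0]) E.
rewrite deriv_comp derivM derivXn derivD derivX derivC addr0 mulr1.
by rewrite horner_comp !hornerE expr0n mul0r.
Qed.

(** The lines u = const of the chart meet at infinity in (al : be : 1). This point is the limit at x
    = 0 of [x *: pt al be 0 x^-1], which is polynomial in x. *)
Lemma deh_lead n A : A \is n.-homog ->
  (dh A)`_n`_0 = A.@[(\row_i nth 0 [:: al; be; 1] i) 0].
Proof.
move=> hA; have hw := tdeg_le_deh al be hA.
pose h (i : 'I_3) : {poly K} := nth 0 [:: 'X + al%:P; be%:P; 1%:P] i.
have [q qE] := meval_curve A h.
pose r : {poly K} := \sum_(i < n.+1) (dh A)`_i`_0 *: 'X^(n - i).
have rq : 'X * (r - q) = 0.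
  apply: poly_vanishing => x; rewrite hornerM hornerX.
  case: (eqVneq x 0) => [->|x0]; first by rewrite mul0r.
  suff -> : (r - q).[x] = 0 by rewrite mulr0.
  rewrite hornerD hornerN -qE; apply/eqP; rewrite subr_eq0; apply/eqP.
  have -> : A.@[fun i => (h i).[x]] = A.@[(x *: pt al be 0 x^-1) 0].
    apply: meval_eq => i; rewrite !mxE /h.
    by case: i => [[|[|[|i]]] //= _]; rewrite ?hornerD ?hornerX ?hornerC; field.
  rewrite (meval_homogZ _ _ hA) -ev_deh /ev (horner_coef_wide _ (tdeg_le_size hw)).
  rewrite !horner_sum mulr_sumr; apply: eq_bigr => i _.
  rewrite hornerZ hornerXn hornerM horner_coef0 -polyC_exp hornerC mulrCA; congr (_ * _).
  by rewrite exprVn -expfB_cond // (negbTE x0) add0n -ltnS.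
have {}rq : r = q.
  by apply/subr0_eq; move/eqP: rq; rewrite mulf_eq0 polyX_eq0 => /eqP.
have -> : (dh A)`_n`_0 = r.[0].
  rewrite horner_sum big_ord_recr /= subnn hornerZ hornerXn expr0 mulr1 big1 ?add0r // => i _.
  by rewrite hornerZ hornerXn expr0n subn_eq0 leqNgt ltn_ord mulr0.
rewrite rq -qE; apply: meval_eq => i; rewrite mxE /h.
by case: i => [[|[|[|i]]] //= _]; rewrite ?hornerD ?hornerX ?hornerC ?add0r.
Qed.

(** By Gauss's lemma [g] can be replaced by a true factor [g'] of [deh A] of the same size. It
    vanishes on [D] outside finitely many points, hence on all of [D] by [D_isolated], and [D_low]
    excludes degrees up to two. *)
Lemma minimal_van_size n A g : A \is n.-homog -> van_on A ->
  A.@[(\row_i nth 0 [:: al; be; 1] i) 0] != 0 ->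
  minimal_van S g -> (3 < size g)%N.
Proof.
move=> hA vA A0 gmin; rewrite ltnNge; apply/negP => sg.
have [vg g0 _] := gmin.
have hw := tdeg_le_deh al be hA; rewrite -/dh in hw.
have lead := deh_lead hA.
have sa : size (dh A) = n.+1.
  apply/eqP; rewrite eqn_leq tdeg_le_size //= ltnNge; apply/negP => h.
  by move/eqP: A0; rewrite -lead (nth_default _ h) coef0.
have an u : ((dh A)`_n).[u] = (dh A)`_n`_0.
  have : (size ((dh A)`_n)%R <= 1)%N by have := tdeg_le_coef_size n hw; rewrite subSnn.
  by move/size1_polyC => e; rewrite {1}e hornerC.
have ra u : red u (dh A) != 0.
  apply/eqP => /polyP/(_ n); rewrite coef_map coef0 /= /horner_eval an lead.
  by move/eqP: A0.
have [[s k] /= s0 E] := Pdiv.Idomain.dvdpP _ _ (minimal_van_dvd gmin (van_deh vA)).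
rewrite mulrC in E.
have [g' [k' [aE sg' [c c0 [c' cg]]]]] := gauss_factor s0 E g0.
have g'0 : g' != 0 by rewrite -size_poly_eq0 sg' size_poly_eq0.
have c'0 : c' != 0.
  apply: contraNneq g0 => h; have /eqP := cg; rewrite h scale0r scale_poly_eq0.
  by rewrite (negbTE c0).
(* The polynomial [deh A] attains its total degree in the outer variable, and so does its factor
   [g']. *)
have wg : tdeg_le (size g').-1 g'.
  have [k'0 e] : k' != 0 /\ (size g' + size k').-1 = n.+1.
    have k'0 : k' != 0 by apply/eqP => h; move: sa; rewrite aE h mulr0 size_poly0.
    by rewrite -size_mul // -aE.
  have := @tdeg_le_factor _ n g' k'; rewrite -aE => /(_ hw k'0); apply: tdeg_leW.
  have : (0 < size k')%N by rewrite size_poly_gt0.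
  by move: (size g') (size k') e => x y; lia.
pose G := homogenize al be (size g').-1 g'.
suff G0 : G = 0.
  by move/eqP: g'0; apply; rewrite -(homogenizeK al be wg) -/G G0 deh0.
apply: (D_low (n := (size g').-1)); [by rewrite sg'; case: (size g) sg => [|[|[|[|]]]] | exact: homogenize_homog |].
have [rs rsP] := roots_seq c'0.
pose h (i : 'I_3) : {poly K} := nth 0 [:: al%:P; 'X; 1%:P] i.
have [q qE] := meval_curve A h.
have q0 : q != 0.
  apply: contraNneq A0 => e; have := qE be; rewrite e horner0 => <-.
  apply/eqP/meval_eq => i; rewrite mxE /h.
  by case: i => [[|[|[|i]]] //= _]; rewrite ?hornerD ?hornerX ?hornerC ?add0r.
have [rq rqP] := roots_seq q0.
have [ru ruP] : exists ru : K -> seq K, forall u v, ev (dh A) u v = 0 -> v \in ru u.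
  have : forall u, exists r : seq K, forall v, ev (dh A) u v = 0 -> v \in r.
    by move=> u; have [r rP] := roots_seq (ra u); exists r => v; rewrite ev_red => /rP.
  by move/choice => [ru ruP]; exists ru.
(* The possible exceptions: at infinity, (0 : 1 : 0) and the zeros (al : x : 1) of [A]; in the
   chart, the zeros of [A] over the roots of [c']. *)
pose l := (\row_i nth 0 [:: 0; 1; 0] i : 'rV[K]_3)
   :: [seq (\row_i nth 0 [:: al; x; 1] i : 'rV[K]_3) | x <- rq]
   ++ [seq pt al be u v | u <- rs, v <- ru u].
apply: (D_isolated (n := (size g').-1) (l := l)); first exact: homogenize_homog.
move=> y Dy; pose y0 := y 0 (inord 0) - al * y 0 (inord 2).
have jE (k0 : nat) (k3 : (k0 < 3)%N) : Ordinal k3 = inord k0 :> 'I_3.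
  by apply/val_inj; rewrite /= inordK.
case: (eqVneq y0 0) => [y00|yn0].
  right; case: (eqVneq (y 0 (inord 2)) 0) => y2.
    exists (\row_i nth 0 [:: 0; 1; 0] i), (y 0 (inord 1)); split; first exact: mem_head.
    apply/rowP => j; rewrite !mxE; move: y00; rewrite /y0 y2 mulr0 subr0.
    by case: j => [[|[|[|k0]]] //= k3]; rewrite jE ?y2 // ?mulr0 ?mulr1.
  pose x := y 0 (inord 1) / y 0 (inord 2).
  have yE : y = y 0 (inord 2) *: \row_i nth 0 [:: al; x; 1] i.
    apply/rowP => j; rewrite !mxE /x.
    case: j => [[|[|[|k0]]] //= k3]; rewrite jE; try by field.
    by move/subr0_eq: y00 => ->; rewrite mulrC.
  exists (\row_i nth 0 [:: al; x; 1] i), (y 0 (inord 2)); split=> //.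
  rewrite in_cons mem_cat; apply/orP; right; apply/orP; left; apply: map_f; apply: rqP.
  rewrite -qE; have := vA y Dy; rewrite {1}yE (meval_homogZ _ _ hA) => /eqP.
  rewrite mulf_eq0 expf_eq0 (negbTE y2) andbF /= => /eqP <-.
  apply: meval_eq => i; rewrite mxE /h.
  by case: i => [[|[|[|i]]] //= _]; rewrite ?hornerD ?hornerX ?hornerC ?add0r.
have yE := pt_scale be yn0; rewrite -/y0 in yE.
move: yE; set u := _ / y0; set v := _ / y0 => yE.
have Spt : S u v.
  by rewrite /S -[pt _ _ _ _]scale1r -(mulVf yn0) -scalerA -yE; apply: D_scale; rewrite ?invr_eq0.
case: (eqVneq c'.[u] 0) => cu; last first.
  left; rewrite yE (meval_homogZ _ _ (homogenize_homog _ _ _ _)) meval_homogenize_pt //.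
  have := congr1 (fun p => ev p u v) cg; rewrite !evZ vg // mulr0 => /esym/eqP.
  by rewrite mulf_eq0 (negbTE cu) => /eqP ->; rewrite mulr0.
right; exists (pt al be u v), y0; split=> //.
rewrite in_cons mem_cat; apply/orP; right; apply/orP; right.
by apply/allpairsPdep; exists u, v; split=> //; [exact: rsP | apply: ruP; rewrite ev_deh vA].
Qed.

End Coordinates.

Lemma shear_exists n (P : {mpoly K[3]}) : P \is n.-homog -> P != 0 ->
  exists al be, P.@[(\row_i nth 0 [:: al; be; 1] i) 0] != 0.
Proof.
move=> hP P0; apply: contrapT => H; case/eqP: P0; apply: mpoly_vanishing => w.
have -> : P.@[w] = P.@[(\row_i w i) 0] by apply: meval_eq => i; rewrite mxE.
apply: (@polyfun_dense K 3 (fun y => P.@[y 0]) (fun y => y 0 (inord 2)) (const_mx 1)).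
- by exists P.
- exact: polyfun_coord.
- by rewrite mxE oner_neq0.
move=> y y2; apply/eqP/negPn/negP => h; apply: H.
exists (y 0 (inord 0) / y 0 (inord 2)), (y 0 (inord 1) / y 0 (inord 2)).
apply: contraNneq h => e.
have -> : y = y 0 (inord 2) *: \row_i nth 0
    [:: y 0 (inord 0) / y 0 (inord 2); y 0 (inord 1) / y 0 (inord 2); 1] i.
  apply/rowP => j; rewrite !mxE.
  have jE (k0 : nat) (k3 : (k0 < 3)%N) : Ordinal k3 = inord k0 :> 'I_3.
    by apply/val_inj; rewrite /= inordK.
  by case: j => [[|[|[|k0]]] //= k3]; rewrite jE; field.
by rewrite (meval_homogZ _ _ hP) e mulr0.
Qed.

Lemma small_dvd (g f : {poly {poly K}}) : g * g %| f -> (3 < size g)%N ->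
  (size f < 7)%N -> f = 0.
Proof.
move=> gf sg sf; apply: contrapT => /eqP f0.
have := Pdiv.Idomain.dvdp_leq f0 gf.
have g0 : g != 0 by rewrite -size_poly_eq0; case: (size g) sg.
by rewrite size_mul //; move: (size g) (size f) sg sf => x y; lia.
Qed.

Lemma tdeg_le_lead n p : tdeg_le n p -> p`_n = (p`_n`_0)%:P :> {poly K}.
Proof.
by move=> hp; apply/polyP => -[|k]; rewrite coefC //= hp //; lia.
Qed.

Lemma lead_cancel n (p q : {poly {poly K}}) : tdeg_le n p -> tdeg_le n q ->
  (size ((q`_n`_0)%:P *: p + (- p`_n`_0)%:P *: q)%R <= n)%N.
Proof.
move=> hp hq; apply/leq_sizeP => j; rewrite leq_eqVlt coefD !coefZ => /orP [/eqP <-|nj].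
  have ep := tdeg_le_lead hp; have eq := tdeg_le_lead hq; move: ep eq.
  set x := p`_n`_0; set y := q`_n`_0 => -> ->; rewrite -!polyCM -polyCD.
  by rewrite (_ : _ + _ = 0) ?polyC0 //; ring.
have -> : p`_j = 0 by rewrite nth_default //; apply: leq_trans (tdeg_le_size hp) nj.
have -> : q`_j = 0 by rewrite nth_default //; apply: leq_trans (tdeg_le_size hq) nj.
by rewrite !mulr0 addr0.
Qed.

(** The combination that cancels the leading coefficients has degree at most five in the outer
    variable, but it is divisible by the square of [g], whose degree is at least three. *)
Lemma double_on_dep P Q : P \is 6.-homog -> Q \is 6.-homog ->
  double_on P -> double_on Q -> exists a b, (a != 0) || (b != 0) /\ a *: P + b *: Q = 0.
Proof.
move=> hP hQ dP dQ; case: (eqVneq P 0) => [->|P0].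
  by exists 1, 0; rewrite oner_neq0 scaler0 scale0r addr0.
have [al [be Pn0]] := shear_exists hP P0.
have vP := van_deh (al := al) (be := be) (double_on_van dP).
have dehP0 : deh al be P != 0 by apply: contraNneq P0 => /(deh_inj hP) ->.
have [g gmin] := minimal_van_exists vP dehP0.
have sg := minimal_van_size hP (double_on_van dP) Pn0 gmin.
set p := deh al be P in vP dehP0; pose q := deh al be Q.
exists (q`_6`_0), (- p`_6`_0); split.
  by rewrite orbC oppr_eq0 /p deh_lead // Pn0.
apply: (@deh_inj _ al be 6).
  by rewrite rpredD // rpredZ.
rewrite deh_is_linear -/p -/q; apply: (small_dvd _ sg).
  apply: (minimal_van_dvd_sqr gmin).
    by apply: vanD; apply: vanZ; apply: van_deh; apply: double_on_van.
  by rewrite derivD !derivZ; apply: vanD; apply: vanZ; apply: van_deh_deriv.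
by rewrite ltnS; apply: lead_cancel; apply: tdeg_le_deh.
Qed.

Lemma deh_sum al be (I : Type) (r : seq I) (a : I -> K) (P : I -> {mpoly K[3]}) :
  deh al be (\sum_(i <- r) a i *: P i) = \sum_(i <- r) (a i)%:P *: deh al be (P i).
Proof.
elim: r => [|i r IH]; first by rewrite !big_nil deh0.
by rewrite !big_cons -IH -[X in _ + X]scale1r deh_is_linear polyC1 scale1r.
Qed.

Lemma van_on_sum (I : Type) (r : seq I) (a : I -> K) (P : I -> {mpoly K[3]}) :
  (forall i, van_on (P i)) -> van_on (\sum_(i <- r) a i *: P i).
Proof.
move=> h y Dy; rewrite raddf_sum /= big1 // => i _.
by rewrite mevalZ h ?mulr0.
Qed.

(** A polynomial of degree at most two in v that vanishes on [D] is zero, so a quartic through [D]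
    is determined by its coefficients of v^4, v^3 and u v^3. If three quartics realize all values of
    these, their span contains two polynomials with leading terms v^3 and u v^3; the first is the
    cubic. *)
Lemma quartic_cubic :
  (forall P : 'I_3 -> {mpoly K[3]}, (forall i, P i \is 4.-homog /\ van_on (P i)) ->
     exists2 a : 'rV[K]_3, a != 0 & \sum_i a 0 i *: P i = 0) \/
  exists c : {mpoly K[3]}, [/\ c \is 3.-homog, c != 0,
    forall P, P \is 4.-homog -> van_on P -> exists2 l, l \is 1.-homog & P = c * l &
    forall P, P \is 6.-homog -> double_on P -> exists a, P = a *: c ^+ 2].
Proof.
case: (pselect (exists A, [/\ A \is 4.-homog, van_on A & A != 0])); last first.
  move=> H; left => P hP; exists (const_mx 1).
    by apply/eqP => /rowP/(_ 0); rewrite !mxE => /eqP; rewrite oner_eq0.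
  rewrite big1 // => i _; rewrite (_ : P i = 0) ?scaler0 //.
  by apply: contrapT => /eqP h; apply: H; exists (P i); have [] := hP i.
move=> [A [hA vA A0]].
have [al [be An0]] := shear_exists hA A0.
have dehA0 : deh al be A != 0 by apply: contraNneq A0 => /(deh_inj hA) ->.
have [g gmin] := minimal_van_exists (van_deh (al := al) (be := be) vA) dehA0.
have sg := minimal_van_size hA vA An0 gmin.
set S := (fun _ => _) in gmin.
have small f : van S f -> (size f < 4)%N -> f = 0.
  by have [_ _ H] := gmin => vf sf; apply: H => //; apply: leq_trans sf _.
pose phi (f : {poly {poly K}}) (j : 'I_3) : K := nth 0 [:: f`_4`_0; f`_3`_0; f`_3`_1] j.
have phi_coef f : tdeg_le 4 f -> f`_4 = (phi f 0)%:P /\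
    f`_3 = (phi f (inord 1))%:P + (phi f (inord 2))%:P * 'X.
  move=> hf; split; first exact: tdeg_le_lead.
  apply/polyP => k; rewrite coefD coefC coefCM coefX /phi !inordK //=.
  by case: k => [|[|k]] /=; rewrite ?mulr0 ?mulr1 ?addr0 ?add0r // hf //; lia.
have phi_size f : tdeg_le 4 f -> phi f 0 = 0 -> (size f <= 4)%N.
  move=> hf f0; apply/leq_sizeP => j; rewrite leq_eqVlt => /orP [/eqP <-|j4].
    by rewrite (phi_coef f hf).1 f0.
  by rewrite nth_default //; apply: leq_trans (tdeg_le_size hf) j4.
have phi_inj f : van S f -> tdeg_le 4 f -> (forall j, phi f j = 0) -> f = 0.
  move=> vf hf f0; apply: small => //; rewrite ltnS; apply/leq_sizeP => j.
  rewrite leq_eqVlt => /orP [/eqP <-|j3]; first by rewrite (phi_coef f hf).2 !f0 mul0r addr0.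
  by rewrite nth_default //; apply: leq_trans (phi_size f hf (f0 _)) j3.
have phi_sum (a : 'I_3 -> K) (f : 'I_3 -> {poly {poly K}}) j :
    phi (\sum_i (a i)%:P *: f i) j = \sum_i a i * phi (f i) j.
  rewrite /phi; case: j => [[|[|[|j]]] //= _];
  by rewrite !coef_sum; apply: eq_bigr => i _; rewrite coefZ coefCM.
pose M (P : 'I_3 -> {mpoly K[3]}) : 'M[K]_3 := \matrix_(i, j) phi (deh al be (P i)) j.
case: (pselect (exists P, (forall i, P i \is 4.-homog /\ van_on (P i)) /\ M P \in unitmx)).
  move=> [P [hP uM]]; right.
  have comb (e : 'rV[K]_3) : exists f, [/\ van S f, tdeg_le 4 f & forall j, phi f j = e 0 j].
    pose r := e *m invmx (M P).
    exists (deh al be (\sum_i r 0 i *: P i)); split.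
    - by apply: van_deh; apply: van_on_sum => i; have [] := hP i.
    - by apply: tdeg_le_deh; apply: rpred_sum => i _; apply: rpredZ; have [] := hP i.
    move=> j; rewrite deh_sum phi_sum -[e](mulmxKV uM) -/r mxE.
    by apply: eq_bigr => i _; rewrite !mxE.
  have [b [vb wb phib]] := comb (delta_mx 0 (inord 1)).
  have [b' [vb' wb' phib']] := comb (delta_mx 0 (inord 2)).
  have n01 : (0 == inord 1 :> 'I_3) = false by rewrite -val_eqE /= inordK.
  have n02 : (0 == inord 2 :> 'I_3) = false by rewrite -val_eqE /= inordK.
  have n12 : (inord 1 == inord 2 :> 'I_3) = false by rewrite -val_eqE /= !inordK.
  have b3 : b`_3 = 1.
    by rewrite (phi_coef b wb).2 !phib !mxE !eqxx [_ == inord 1]eq_sym n12 mul0r addr0.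
  have sb : size b = 4%N.
    apply/eqP; rewrite eqn_leq phi_size //=; last by rewrite phib mxE n01 andbF.
    by rewrite ltnNge; apply/negP => h; move/eqP: b3; rewrite nth_default // eq_sym oner_eq0.
  (* The difference has degree at most two in the outer variable. The equality also bounds the total
     degree of [b] by three, since that of [b'] is at most four. *)
  have b'E : 'X *: b = b'.
    apply/subr0_eq/small; first by apply: vanB => //; apply: vanZ.
    rewrite ltnS; apply/leq_sizeP => j; rewrite leq_eqVlt coefB coefZ => /orP [/eqP <-|j3].
      by rewrite b3 (phi_coef b' wb').2 !phib' !mxE !eqxx n12 andbF add0r mulr1 mul1r subrr.
    rewrite nth_default ?sb // mulr0 sub0r nth_default ?oppr0 //.
    by apply: leq_trans (phi_size b' wb' _) j3; rewrite phib' mxE n02 andbF.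
  have w3b : tdeg_le 3 b.
    move=> i k ik; have := wb' i k.+1; rewrite -b'E coefZ coefXM /=; apply; lia.
  have bmin : minimal_van S b.
    split=> //; first by rewrite -size_poly_eq0 sb.
    by move=> f vf sf; apply: small; rewrite -?sb.
  have bmon : b \is monic by rewrite monicE lead_coefE sb b3.
  pose c := homogenize al be 3 b.
  have dc : deh al be c = b by apply: homogenizeK.
  have hc : c \is 3.-homog by apply: homogenize_homog.
  exists c; split=> //.
  - apply/eqP => h; move/eqP: sb; rewrite -dc h deh0 size_poly0 //.
  - move=> Q hQ vQ; pose f := deh al be Q.
    have fE := Pdiv.RingMonic.rdivp_eq bmon f.
    set l := Pdiv.CommonRing.rdivp f b in fE; set r := Pdiv.CommonRing.rmodp f b in fE.
    have r0 : r = 0.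
      apply: small.
        have -> : r = f - l * b by rewrite {1}fE addrAC subrr add0r.
        by apply: vanB; [apply: van_deh | apply: vanM].
      by rewrite -sb Pdiv.CommonRing.ltn_rmodp -size_poly_eq0 sb.
    rewrite r0 addr0 in fE.
    have wl : tdeg_le 1 l.
      have := @tdeg_le_factor _ 4 l b; rewrite sb -fE; apply; first exact: tdeg_le_deh.
      by rewrite -size_poly_eq0 sb.
    exists (homogenize al be 1 l); first exact: homogenize_homog.
    apply/subr0_eq/(@deh_inj _ al be 4).
      rewrite rpredB //; have := dhomogM hc (homogenize_homog al be 1 l); exact.
    rewrite -[Q]scale1r -scaleN1r deh_is_linear dehM dc homogenizeK // -/f fE.
    by rewrite polyCN polyC1 scale1r scaleN1r [b * l]mulrC subrr.
  (* Subtracting the right multiple of [b * b] cancels the coefficient of v^6; the rest is still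
     divisible by [b * b], hence zero. *)
  move=> Q hQ dQ; pose f := deh al be Q; exists (f`_6`_0).
  apply/subr0_eq/(@deh_inj _ al be 6).
    rewrite rpredB // rpredZ //; have := dhomogM hc hc; exact.
  rewrite -[X in X - _]scale1r -scaleNr deh_is_linear expr2 dehM dc -/f polyC1 scale1r.
  have sg4 : (3 < size b)%N by rewrite sb.
  apply: (small_dvd _ sg4).
    apply: (minimal_van_dvd_sqr bmin).
      by apply: vanD; [apply: van_deh; apply: double_on_van | apply: vanZ; apply: vanM].
    rewrite derivD derivZ derivM; apply: vanD; first exact: van_deh_deriv.
    by apply: vanZ; rewrite [b * _]mulrC; apply: vanD; apply: vanM.
  have bb6 : (b * b)`_6 = 1.
    have sbb : size (b * b) = 7%N by rewrite size_mul ?sb // -size_poly_eq0 sb.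
    have : lead_coef (b * b) = 1 by apply/eqP; rewrite -monicE monicMl.
    by rewrite lead_coefE sbb.
  have := lead_cancel (tdeg_le_deh al be hQ) (tdeg_leM w3b w3b).
  by rewrite bb6 coef1 polyC1 scale1r.
move=> H; left => P hP.
have /det0P [a a0 aM] : \det (M P) == 0.
  apply/negPn/negP => h; apply: H; exists P; split=> //.
  by rewrite unitmxE unitfE.
exists a => //; apply: (@deh_inj _ al be 4).
  by apply: rpred_sum => i _; apply: rpredZ; have [] := hP i.
rewrite deh_sum; apply: phi_inj.
- by rewrite -deh_sum; apply: van_deh; apply: van_on_sum => i; have [] := hP i.
- by rewrite -deh_sum; apply: tdeg_le_deh; apply: rpred_sum => i _; apply: rpredZ; have [] := hP i.
move=> j; rewrite phi_sum; move/rowP/(_ j): aM; rewrite !mxE => {2}<-.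
by apply: eq_bigr => i _; rewrite !mxE.
Qed.

End Cubic.

(** * Multiplicities *)

Section Multiplicity.

Variable K : numClosedFieldType.
Variable n : nat.
Implicit Types (f g : {mpoly K[n]}) (z : 'rV[K]_n).

Lemma curveD f g h : curve (f + g) h = curve f h + curve g h.
Proof. exact: mmapD. Qed.

Lemma curveM f g h : curve (f * g) h = curve f h * curve g h.
Proof. exact: rmorphM. Qed.

Lemma curve_deriv f h :
  (curve f h)^`() = \sum_i curve (f^`M(i)) h * (h i)^`().
Proof.
pose good f := (curve f h)^`() = \sum_i curve (f^`M(i)) h * (h i)^`().
have goodD p q : good p -> good q -> good (p + q).
  move=> hp hq; rewrite /good curveD derivD hp hq -big_split /=.
  by apply: eq_bigr => i _; rewrite mderivD curveD mulrDl.
have goodM p q : good p -> good q -> good (p * q).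
  move=> hp hq; rewrite /good curveM derivM hp hq mulr_suml mulr_sumr -big_split /=.
  by apply: eq_bigr => i _; rewrite mderivM curveD !curveM; ring.
have goodC c : good c%:MP.
  rewrite /good /curve mmapC derivC big1 // => i _.
  by rewrite mderivC /curve mmap0 mul0r.
have goodX i : good 'X_i.
  rewrite /good /curve mmapX mmap1U (bigD1 i) //= big1 ?addr0.
    rewrite mderivX mnm1E eqxx scale1r (_ : (U_(i) - U_(i))%MM = 0%MM); last first.
      by apply/mnmP => j; rewrite mnmBE mnm0E subnn.
    by rewrite mpolyX0 -[1]/(1%:MP) mmapC mul1r.
  move=> j ji; rewrite mderivX mnm1E eq_sym (negbTE ji) scale0r mmap0 mul0r //.
have goodXn i k : good ('X_i ^+ k).
  elim: k => [|k IH]; first by rewrite expr0 -[1]/(1%:MP).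
  by rewrite exprS; apply: goodM.
rewrite -/(good f) [f]mpolyE; apply: big_ind => [|//|m _].
  by rewrite -[0]mpolyC0; apply: goodC.
rewrite -mul_mpolyC; apply: (goodM) => //; rewrite mpolyXE_id.
apply: big_ind => [|p q|i _]; [rewrite -[1]/(1%:MP); exact: goodC | exact: goodM | exact: goodXn].
Qed.

Lemma mult_geW m k f z : (k <= m)%N -> mult_ge m f z -> mult_ge k f z.
Proof. by move=> km h l lk; apply: h; apply: leq_trans lk km. Qed.

Lemma mult_ge_deriv m f z i : mult_ge m.+1 f z -> mult_ge m f^`M(i) z.
Proof.
move=> h k km; rewrite -mderivmU1m -mderivmDm; apply: h.
by rewrite mdegD mdeg1 add1n ltnS.
Qed.

Lemma mult_geS m f z : f.@[z 0] = 0 -> (forall i, mult_ge m f^`M(i) z) -> mult_ge m.+1 f z.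
Proof.
move=> f0 h k km; case: (eqVneq k 0%MM) => [->|k0]; first by rewrite mderivm0m.
have [i ki] : exists i, k i != 0%N.
  apply: contrapT => H; case/eqP: k0; apply/mnmP => i; rewrite mnm0E.
  by apply/eqP/negPn/negP => hi; apply: H; exists i.
have -> : k = (U_(i) + (k - U_(i)))%MM by rewrite addmC submK // lep1mP.
rewrite mderivmDm mderivmU1m; apply: h.
have := mdegD U_(i) (k - U_(i))%MM; rewrite addmC submK ?lep1mP // mdeg1; lia.
Qed.

Lemma mult_ge_val m f z : mult_ge m.+1 f z -> f.@[z 0] = 0.
Proof. by move/(_ 0%MM); rewrite mderivm0m mdeg0; apply. Qed.

Lemma mult_ge1 f z : f.@[z 0] = 0 -> mult_ge 1 f z.
Proof. by move=> f0; apply: mult_geS => // i k; rewrite ltn0. Qed.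

Lemma mult_geD m f g z : mult_ge m f z -> mult_ge m g z -> mult_ge m (f + g) z.
Proof. by move=> hf hg k km; rewrite mderivmD mevalD hf ?hg ?addr0. Qed.

Lemma mult_geM a b f g z : mult_ge a f z -> mult_ge b g z -> mult_ge (a + b) (f * g) z.
Proof.
have [m ab] : exists m, (a + b)%N = m by exists (a + b)%N.
rewrite ab; elim: m a b ab f g => [|m IH] a b ab f g hf hg; first by move=> k.
apply: mult_geS.
  rewrite mevalM; case: a ab hf => [|a] ab hf; last by rewrite (mult_ge_val hf) mul0r.
  by case: b ab hg => // b ab hg; rewrite (mult_ge_val hg) mulr0.
move=> i; rewrite mderivM; apply: mult_geD.
  case: a ab hf => [|a] ab hf.
    apply: (IH 0%N m) => //; apply: mult_geW hg; lia.
  by apply: (IH a b) => //; [lia | apply: mult_ge_deriv].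
case: b ab hg => [|b] ab hg.
  apply: (IH m 0%N) => //; [lia | apply: mult_geW hf; lia].
by apply: (IH a b) => //; [lia | apply: mult_ge_deriv].
Qed.

(** Induction on [m] by the chain rule: the coefficient of index k + 1 of the restriction to the arc
    is that of index k of its derivative, divided by k + 1. *)
Lemma mult_ge_curve m f z (w : 'I_n -> {poly K}) : mult_ge m f z ->
  exists q : {poly K}, forall t, f.@[fun i => z 0 i + t * (w i).[t]] = t ^+ m * q.[t].
Proof.
pose h i : {poly K} := (z 0 i)%:P + 'X * w i.
have hE g t : g.@[fun i => z 0 i + t * (w i).[t]] = (curve g h).[t].
  by rewrite horner_curve; apply: meval_eq => i; rewrite /h !hornerE.
move=> mf; suff H : forall k, (k < m)%N -> (curve f h)`_k = 0.
  exists (\poly_(i < size (curve f h)) (curve f h)`_(i + m)%N) => t.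
  rewrite hE -hornerXn -hornerM; congr (_.[t]).
  apply/polyP => i; rewrite coefXnM coef_poly; case: ltnP => im; first exact: H.
  rewrite subnK //; case: ltnP => // hi.
  by rewrite nth_default //; apply: leq_trans hi _; apply: leq_subr.
elim: m f mf => // m IH f mf [|k] km.
  rewrite -horner_coef0 -hE; apply: etrans (mult_ge_val mf).
  by apply: meval_eq => i; rewrite mul0r addr0.
have : ((curve f h)^`())`_k = 0.
  rewrite curve_deriv coef_sum big1 // => i _; rewrite coefM big1 // => j _.
  by rewrite (IH _ (mult_ge_deriv i mf)) ?mul0r //; have := ltn_ord j; lia.
by rewrite coef_deriv => /eqP; rewrite mulrn_eq0 => /orP [//|/eqP].
Qed.

End Multiplicity.

(** * Substitution into forms, and weights of monomials *)

Section Composition.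

Variable K : numClosedFieldType.

Lemma comp_mpoly_homog k n d e (f : {mpoly K[k]}) (lq : k.-tuple {mpoly K[n]}) :
  f \is d.-homog -> (forall i, tnth lq i \is e.-homog) -> f \mPo lq \is (e * d).-homog.
Proof.
move=> /dhomogP hf hq; rewrite comp_mpolyEX big_seq.
apply: rpred_sum => m /hf md; apply: rpredZ; rewrite comp_mpolyX.
rewrite -md -[X in (e * X)%N]/(mdeg m) mdegE big_distrr /=.
apply: (big_ind2 (fun (p : {mpoly K[n]}) (n : nat) => p \is n.-homog)) => [|p1 n1 p2 n2|i _].
- exact: dhomog1.
- exact: dhomogM.
by apply: dhomogMn.
Qed.

Lemma comp_mpoly_mult_ge k n d e (f : {mpoly K[k]}) (lq : k.-tuple {mpoly K[n]}) z :
  f \is d.-homog -> (forall i, mult_ge e (tnth lq i) z) -> mult_ge (e * d) (f \mPo lq) z.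
Proof.
move=> /dhomogP hf hq; rewrite comp_mpolyEX big_seq.
apply: (big_ind (fun p => mult_ge (e * d) p z)) => [l _|p q|m /hf md].
- by rewrite raddf0 meval0.
- exact: mult_geD.
rewrite -mul_mpolyC -[(e * d)%N]add0n; apply: mult_geM; first by move=> l.
rewrite comp_mpolyX -md -[X in (e * X)%N]/(mdeg m) mdegE big_distrr /=.
apply: (big_ind2 (fun (p : {mpoly K[n]}) (n : nat) => mult_ge n p z)) => [|p1 n1 p2 n2|i _].
- by move=> l.
- exact: mult_geM.
elim: (m i) => [|j IH]; first by rewrite muln0.
by rewrite exprS mulnS; apply: mult_geM.
Qed.

Lemma meval_lin_map n m (M : 'M[K]_(n, m)) j (v : 'rV[K]_n) :
  (lin_map M j).@[v 0] = (v *m M) 0 j.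
Proof.
rewrite raddf_sum mxE; apply: eq_bigr => i _ /=.
by rewrite mevalZ mevalXU mulrC.
Qed.

Lemma lin_map_homog n m (M : 'M[K]_(n, m)) j : lin_map M j \is 1.-homog.
Proof.
by apply: rpred_sum => i _; apply: rpredZ; rewrite dhomogX; apply/eqP/mdeg1.
Qed.

Lemma meval_lin_subst n m (M : 'M[K]_(n, m)) f (v : 'rV[K]_n) :
  (lin_subst M f).@[v 0] = f.@[(v *m M) 0].
Proof.
rewrite comp_mpoly_meval; apply: meval_eq => i.
by rewrite tnth_mktuple meval_lin_map.
Qed.

Lemma lin_subst_homog n m (M : 'M[K]_(n, m)) f d :
  f \is d.-homog -> lin_subst M f \is d.-homog.
Proof.
move=> hf; rewrite -[d]mul1n; apply: comp_mpoly_homog => // i.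
by rewrite tnth_mktuple lin_map_homog.
Qed.

(** If a monomial of weight j < N occurred, the sum [Q] of the terms of weight j would be nonzero;
    but its value at [x] is the coefficient of t^j, which vanishes for every [x]. *)
Lemma weight_msupp n (om : 'I_n -> nat) N (f : {mpoly K[n]}) :
  (forall x : 'I_n -> K, exists q : {poly K}, forall t,
     f.@[fun i => t ^+ om i * x i] = t ^+ N * q.[t]) ->
  forall k, k \in msupp f -> (N <= \sum_i om i * k i)%N.
Proof.
move=> H k kf; rewrite leqNgt; apply/negP => kN.
set j := (\sum_i _)%N in kN.
pose wt (l : 'X_{1..n}) := (\sum_i om i * l i)%N.
pose Q := \sum_(l <- msupp f | wt l == j) f@_l *: 'X_[l].
have Q0 : Q = 0.
  apply: mpoly_vanishing => x; have [q qE] := H x.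
  pose r : {poly K} := \sum_(l <- msupp f) (f@_l * \prod_i x i ^+ l i) *: 'X^(wt l).
  have rE : r = 'X^N * q.
    apply/subr0_eq/poly_vanishing => t; rewrite hornerD hornerN hornerM hornerXn -qE.
    rewrite mevalE horner_sum; apply/eqP; rewrite subr_eq0; apply/eqP.
    apply: eq_bigr => l _; rewrite hornerZ hornerXn -mulrA; congr (_ * _).
    rewrite /wt -prodrXr -big_split /=; apply: eq_bigr => i _.
    by rewrite exprMn exprM mulrC.
  have := congr1 (fun p : {poly K} => p`_j) rE.
  rewrite coefXnM kN coef_sum => r0.
  rewrite raddf_sum /= -[RHS]r0 big_mkcond /=; apply: eq_bigr => l _.
  rewrite coefZ coefXn eq_sym; case: eqP => _; last by rewrite mulr0.
  by rewrite mulr1 mevalZ mevalX.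
have : Q@_k = f@_k.
  rewrite raddf_sum /= big_mkcond (bigD1_seq k) ?msupp_uniq //= eqxx.
  rewrite big1 ?addr0; first by rewrite mcoeffZ mcoeffX eqxx mulr1.
  move=> l lk; case: ifP => // _.
  by rewrite mcoeffZ mcoeffX (negbTE lk) mulr0.
by rewrite Q0 mcoeff0 => /esym/eqP; rewrite mcoeff_eq0 kf.
Qed.

End Composition.

Lemma big_inord3 (T : Type) (idx : T) (op : Monoid.law idx) (F : 'I_3 -> T) :
  \big[op/idx]_(i < 3) F i = op (F (inord 0)) (op (F (inord 1)) (F (inord 2))).
Proof.
rewrite !big_ord_recl big_ord0 Monoid.mulm1.
by congr (op (F _) (op (F _) (F _))); apply/val_inj; rewrite /= inordK.
Qed.

Lemma big_inord4 (T : Type) (idx : T) (op : Monoid.law idx) (F : 'I_4 -> T) :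
  \big[op/idx]_(i < 4) F i =
  op (F (inord 0)) (op (F (inord 1)) (op (F (inord 2)) (F (inord 3)))).
Proof.
rewrite !big_ord_recl big_ord0 Monoid.mulm1.
by congr (op (F _) (op (F _) (op (F _) (F _)))); apply/val_inj; rewrite /= inordK.
Qed.

(** * Forms of degree nine with multiplicity four along the axes *)

Section NormalForm.

Variable K : numClosedFieldType.

Definition co3 (y : 'rV[K]_3) (i : nat) : K := y 0 (inord i).
Definition co4 (x : 'rV[K]_4) (i : nat) : K := x 0 (inord i).

Definition prod3 y : K := co3 y 0 * co3 y 1 * co3 y 2.
Definition nrm3 y : K := co3 y 0 ^+ 2 + co3 y 1 ^+ 2 + co3 y 2 ^+ 2.

Definition mk4 (a b c d : K) : 'rV[K]_4 := \row_i nth 0 [:: a; b; c; d] i.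

Lemma co_mk4 a b c d : [/\ co4 (mk4 a b c d) 0 = a, co4 (mk4 a b c d) 1 = b,
  co4 (mk4 a b c d) 2 = c & co4 (mk4 a b c d) 3 = d].
Proof. by rewrite /co4 !mxE !inordK. Qed.

(** With [x0] free this parametrizes a dense part of P^3; the Steiner surface is the locus
    [x0 = nrm3 y]. *)
Definition steiner_param (x0 : K) y : 'rV[K]_4 :=
  mk4 x0 (co3 y 1 * co3 y 2) (co3 y 0 * co3 y 2) (co3 y 0 * co3 y 1).

(** Used as an exponent: weight 1 on the coordinates that vanish on the axis spanned by the
    coordinate points 0 and [j], weight 0 on the other two. *)
Definition off_axis (j : nat) (i : 'I_4) : nat := (i != 0%N :> nat) && (i != j :> nat).

(* A monomial of weight at least 4 with respect to each [off_axis j] becomes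
   divisible by [prod3 y ^+ 4] at [steiner_param x0 y]. *)
Lemma normal_form (f : {mpoly K[4]}) : f \is 9.-homog ->
  (forall j, (0 < j < 4)%N -> forall x : 'I_4 -> K, exists q : {poly K}, forall t,
     f.@[fun i => t ^+ off_axis j i * x i] = t ^+ 4 * q.[t]) ->
  exists e : nat -> {mpoly K[3]},
    [/\ forall k, (k < 4)%N -> e k \is (6 - 2 * k).-homog,
        forall x0 y, f.@[steiner_param x0 y 0] =
          prod3 y ^+ 4 * \sum_(k < 4) x0 ^+ k * (e k).@[y 0] &
        forall j : 'I_3, (e 0%N).@[(delta_mx 0 j : 'rV[K]_3) 0] = 0].
Proof.
move=> /dhomogP hf Hf.
pose dg (k : 'X_{1..4}) (i : nat) : nat := k (inord i).
have deg k : k \in msupp f -> (dg k 0 + (dg k 1 + (dg k 2 + dg k 3)) = 9)%N.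
  move/hf; rewrite -[X in X = _]/(mdeg k) mdegE.
  by rewrite (@big_inord4 _ _ addn).
have wt j k : (0 < j < 4)%N -> k \in msupp f ->
    (4 <= (1 != j) * dg k 1 + ((2 != j) * dg k 2 + (3 != j) * dg k 3))%N.
  move=> j4 kf; have := weight_msupp (Hf j j4) kf.
  by rewrite (@big_inord4 _ _ addn) /off_axis !inordK.
have w1 k : k \in msupp f -> (4 <= dg k 2 + dg k 3)%N by move/(wt 1 k isT); rewrite /=; lia.
have w2 k : k \in msupp f -> (4 <= dg k 1 + dg k 3)%N by move/(wt 2 k isT); rewrite /=; lia.
have w3 k : k \in msupp f -> (4 <= dg k 1 + dg k 2)%N by move/(wt 3 k isT); rewrite /=; lia.
(* Each variable of the plane occurs in two coordinates of [steiner_param]; the subtracted 4 goes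
   into [prod3 y ^+ 4]. *)
pose ex (k : 'X_{1..4}) : 'X_{1..3} := [multinom nth 0%N [:: (dg k 2 + dg k 3 - 4)%N;
  (dg k 1 + dg k 3 - 4)%N; (dg k 1 + dg k 2 - 4)%N] i | i < 3].
exists (fun j => \sum_(k <- msupp f) (if dg k 0 == j then f@_k else 0) *: 'X_[ex k]); split.
- move=> j j4; rewrite big_seq; apply: rpred_sum => k kf.
  case: eqP => [e0|_]; last by rewrite scale0r rpred0.
  rewrite rpredZ // dhomogX; apply/eqP; rewrite -[LHS]/(mdeg _) mdegE.
  rewrite (@big_inord3 _ _ addn) !mnmE !inordK //=.
  by have := deg k kf; have := w1 k kf; have := w2 k kf; have := w3 k kf; move: e0; rewrite /dg; move: (k (inord 0)) (k (inord 1)) (k (inord 2)) (k (inord 3)) => a b c d; lia.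
- move=> x0 y; rewrite mevalE.
  transitivity (\sum_(k <- msupp f) prod3 y ^+ 4 *
     \sum_(j < 4) x0 ^+ j * ((if dg k 0 == j then f@_k else 0) * ('X_[ex k]).@[y 0])); last first.
    rewrite -mulr_sumr exchange_big; congr (_ * _); apply: eq_bigr => j _.
    by rewrite raddf_sum mulr_sumr; apply: eq_bigr => k _ /=; rewrite mevalZ.
  rewrite big_seq [RHS]big_seq; apply: eq_bigr => k kf.
  (* The three weight inequalities add up to degree at least 6 in the coordinates 1, 2, 3, out of
     9. *)
  have k04 : (dg k 0 < 4)%N.
    by have := deg k kf; have := w1 k kf; have := w2 k kf; have := w3 k kf; lia.
  have -> : \sum_(j < 4) x0 ^+ j * ((if dg k 0 == j then f@_k else 0) * ('X_[ex k]).@[y 0])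
      = x0 ^+ dg k 0 * (f@_k * ('X_[ex k]).@[y 0]).
    rewrite (bigD1 (Ordinal k04)) //= eqxx big1 ?addr0 //.
    move=> j jk; case: eqP => [e|_]; last by rewrite mul0r mulr0.
    by case/eqP: jk; apply/val_inj.
  rewrite mevalX (@big_inord3 _ _ *%R) (@big_inord4 _ _ *%R) !mnmE !inordK //=.
  rewrite -/(co3 y 0) -/(co3 y 1) -/(co3 y 2) !mxE !inordK //= !exprMn /prod3.
  have E (a : K) (p q : nat) : (4 <= p + q)%N -> a ^+ p * a ^+ q = a ^+ 4 * a ^+ (p + q - 4).
    by move=> pq; rewrite -!exprD; congr (_ ^+ _); lia.
  have E0 := E (co3 y 0) _ _ (w1 k kf); have E1 := E (co3 y 1) _ _ (w2 k kf).
  have E2 := E (co3 y 2) _ _ (w3 k kf).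
  rewrite -/(dg k 0) -/(dg k 1) -/(dg k 2) -/(dg k 3).
  move: E0 E1 E2; set A := co3 y 0; set B := co3 y 1; set C := co3 y 2.
  move: (_ ^+ (_ - 4)) (_ ^+ (_ - 4)) (_ ^+ (_ - 4)) => a b c.
  move: (x0 ^+ _) (A ^+ dg k 2) (A ^+ dg k 3) (B ^+ dg k 1) (B ^+ dg k 3)
    (C ^+ dg k 1) (C ^+ dg k 2) => x a2 a3 b1 b3 c1 c2 E0 E1 E2.
  transitivity (f@_k * x * (a2 * a3) * (b1 * b3) * (c1 * c2)); first by ring.
  by rewrite E0 E1 E2; ring.
(* A pure power of one variable in [e 0] would need two of the three pair sums to equal 4, which is
   impossible when the total is 9. *)
move=> j; rewrite raddf_sum /= big_seq big1 // => k kf; rewrite mevalZ mevalX.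
case: eqP => [e0|_]; last by rewrite mul0r.
have Hi (i : nat) : (i < 3)%N -> (delta_mx 0 j : 'rV[K]_3) 0 (inord i) = (i == j)%:R.
  by move=> i3; rewrite mxE eqxx /= -val_eqE /= inordK.
rewrite (@big_inord3 _ _ *%R) !mnmE !Hi // !inordK //=.
have := deg k kf; have := w1 k kf; have := w2 k kf; have := w3 k kf; rewrite e0.
have Z (a b : nat) : (0 < a + b)%N -> (0 : K) ^+ a * 0 ^+ b = 0.
  by move=> ab; rewrite -exprD expr0n; case: (a + b)%N ab.
rewrite /dg; move: (k (inord 1)) (k (inord 2)) (k (inord 3)) => k1 k2 k3 h3 h2 h1 h.
by case: j {Hi} => [[|[|[|j]]] //= _]; rewrite !expr1n ?mul1r ?mulr1 Z ?mulr0 //; lia.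
Qed.

End NormalForm.

(** * Forms restricted to the Steiner parametrization *)

Section SteinerSurface.

Variable K : numClosedFieldType.

Lemma zclosed_scale n (C : set 'rV[K]_n) z a : zclosed C -> a != 0 -> C z -> C (a *: z).
Proof.
move=> [S [hS ->]] a0 [z0 Hz]; split; first by rewrite scaler_eq0 negb_or a0.
move=> f Sf; have [d hf] := hS f Sf.
by rewrite (meval_homogZ _ _ hf) Hz ?mulr0.
Qed.

Lemma zclosed_neq0 n (C : set 'rV[K]_n) z : zclosed C -> C z -> z != 0.
Proof. by move=> [S [_ ->]] []. Qed.

Definition steiner_quartic (x : 'rV[K]_4) : K :=
  co4 x 1 ^+ 2 * co4 x 2 ^+ 2 - co4 x 0 * co4 x 1 * co4 x 2 * co4 x 3
  + co4 x 1 ^+ 2 * co4 x 3 ^+ 2 + co4 x 2 ^+ 2 * co4 x 3 ^+ 2.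

Lemma meval_steiner (x : 'rV[K]_4) : (steiner_form K).@[x 0] = steiner_quartic x.
Proof.
by rewrite /steiner_form /= !(mevalD, mevalB, mevalN, mevalM, rmorphXn) /= !mevalXU /steiner_quartic /co4 !expr2.
Qed.

Lemma steiner_homog : steiner_form K \is 4.-homog.
Proof.
have X (i : 'I_4) : ('X_i : {mpoly K[4]}) \is 1.-homog by rewrite dhomogX; apply/eqP/mdeg1.
have X2 (i : 'I_4) : ('X_i ^+ 2 : {mpoly K[4]}) \is 2.-homog := dhomogMn 2 (X i).
rewrite /steiner_form !rpredD ?rpredN //; try exact: (dhomogM (X2 _) (X2 _)).
exact: (dhomogM (dhomogM (dhomogM (X _) (X _)) (X _)) (X _)).
Qed.

(** Where one of the three coordinates vanishes, the quartic is the square of the product of the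
    other two. *)
Lemma steiner_quartic_axes x : steiner_quartic x = 0 -> co4 x 1 * co4 x 2 * co4 x 3 = 0 ->
  [\/ co4 x 1 = 0 /\ co4 x 2 = 0, co4 x 1 = 0 /\ co4 x 3 = 0 |
      co4 x 2 = 0 /\ co4 x 3 = 0].
Proof.
move=> s0 /eqP; rewrite !mulf_eq0 -orbA.
have sq (a b : K) : (a * b) ^+ 2 = 0 -> a = 0 \/ b = 0.
  by move/eqP; rewrite expf_eq0 mulf_eq0 => /= /orP [] /eqP; [left | right].
move=> /or3P [] /eqP e.
- have [h|h] : co4 x 2 = 0 \/ co4 x 3 = 0.
    by apply: sq; rewrite -s0 /steiner_quartic e; ring.
  by constructor 1. by constructor 2.
- have [h|h] : co4 x 1 = 0 \/ co4 x 3 = 0.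
    by apply: sq; rewrite -s0 /steiner_quartic e; ring.
  by constructor 1. by constructor 3.
have [h|h] : co4 x 1 = 0 \/ co4 x 2 = 0.
  by apply: sq; rewrite -s0 /steiner_quartic e; ring.
by constructor 2. by constructor 3.
Qed.

(** The standard quadratic Cremona map in the coordinates 1, 2, 3; it inverts [steiner_param] up to
    scalars. *)
Definition xi (x : 'rV[K]_4) : 'rV[K]_3 :=
  \row_i nth 0 [:: co4 x 2 * co4 x 3; co4 x 1 * co4 x 3; co4 x 1 * co4 x 2] i.

Lemma co_xi x : [/\ co3 (xi x) 0 = co4 x 2 * co4 x 3, co3 (xi x) 1 = co4 x 1 * co4 x 3
  & co3 (xi x) 2 = co4 x 1 * co4 x 2].
Proof. by rewrite /co3 !mxE !inordK. Qed.

Lemma ord4E (i : nat) (i4 : (i < 4)%N) : Ordinal i4 = inord i :> 'I_4.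
Proof. by apply/val_inj; rewrite /= inordK. Qed.

Lemma ord3E (i : nat) (i3 : (i < 3)%N) : Ordinal i3 = inord i :> 'I_3.
Proof. by apply/val_inj; rewrite /= inordK. Qed.

Lemma steiner_param_xi x : steiner_param (nrm3 (xi x) - steiner_quartic x) (xi x) =
  (co4 x 1 * co4 x 2 * co4 x 3) *: x.
Proof.
have [e0 e1 e2] := co_xi x; apply/rowP => i; rewrite !mxE /nrm3 e0 e1 e2 /steiner_quartic.
by case: i => [[|[|[|[|i]]]] //= h]; rewrite ord4E -/(co4 _ _); ring.
Qed.

Lemma xi_steiner_param x0 y : xi (steiner_param x0 y) = prod3 y *: y.
Proof.
have [_ e1 e2 e3] := co_mk4 x0 (co3 y 1 * co3 y 2) (co3 y 0 * co3 y 2) (co3 y 0 * co3 y 1).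
rewrite /xi /steiner_param e1 e2 e3 /prod3; apply/rowP => i; rewrite !mxE.
by case: i => [[|[|[|i]]] //= h]; rewrite ord3E -/(co3 _ _); ring.
Qed.

Lemma steiner_quartic_param y phi : steiner_quartic (steiner_param (nrm3 y - phi) y) = prod3 y ^+ 2 * phi.
Proof.
have [e0 e1 e2 e3] := co_mk4 (nrm3 y - phi) (co3 y 1 * co3 y 2) (co3 y 0 * co3 y 2) (co3 y 0 * co3 y 1).
by rewrite /steiner_quartic /steiner_param e0 e1 e2 e3 /nrm3 /prod3; ring.
Qed.

Lemma steiner_paramZ (a : K) (y : 'rV[K]_3) : steiner_param (nrm3 (a *: y)) (a *: y) =
  a ^+ 2 *: steiner_param (nrm3 y) y.
Proof.
have e i : co3 (a *: y) i = a * co3 y i by rewrite /co3 mxE.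
apply/rowP => i; rewrite !mxE /nrm3 !e.
by case: i => [[|[|[|[|i]]]] //= h]; ring.
Qed.

Lemma axes_xi x : [\/ co4 x 1 = 0 /\ co4 x 2 = 0, co4 x 1 = 0 /\ co4 x 3 = 0 |
      co4 x 2 = 0 /\ co4 x 3 = 0] -> xi x = 0.
Proof.
move=> H; apply/rowP => i; rewrite !mxE.
by case: H => [] [-> ->]; case: i => [[|[|[|i]]] //= h]; rewrite ?mul0r ?mulr0.
Qed.

Variable M : 'M[K]_4.
Hypothesis uM : M \in unitmx.
Let N := invmx M.

Definition steiner_eq : {mpoly K[4]} := lin_subst M (steiner_form K).
Let F := steiner_eq.

Lemma meval_steiner_eq (v : 'rV[K]_4) : F.@[v 0] = steiner_quartic (v *m M).
Proof. by rewrite meval_lin_subst meval_steiner. Qed.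

Lemma steiner_eq_homog : F \is 4.-homog.
Proof. exact: lin_subst_homog steiner_homog. Qed.

Definition coordX (i : nat) : {mpoly K[4]} := lin_map M (inord i).

Lemma meval_coordX i (v : 'rV[K]_4) : (coordX i).@[v 0] = co4 (v *m M) i.
Proof. exact: meval_lin_map. Qed.

Lemma coordX_homog i : coordX i \is 1.-homog.
Proof. exact: lin_map_homog. Qed.

Definition xi_forms : 3.-tuple {mpoly K[4]} :=
  [tuple coordX 2 * coordX 3; coordX 1 * coordX 3; coordX 1 * coordX 2].

Lemma xi_forms_homog i : tnth xi_forms i \is 2.-homog.
Proof.
rewrite (tnth_nth 0); case: i => [[|[|[|i]]] //= h];
exact: (dhomogM (coordX_homog _) (coordX_homog _)).
Qed.

Lemma meval_xi_forms P (v : 'rV[K]_4) : (P \mPo xi_forms).@[v 0] = P.@[xi (v *m M) 0].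
Proof.
rewrite comp_mpoly_meval; apply: meval_eq => i; rewrite (tnth_nth 0) mxE.
by case: i => [[|[|[|i]]] //= h]; rewrite mevalM !meval_coordX.
Qed.

Lemma lin_form_eval (l : 'cV[K]_4) (v : 'rV[K]_4) : (\sum_i l i 0 *: 'X_i).@[v 0] = (v *m l) 0 0.
Proof.
rewrite raddf_sum mxE; apply: eq_bigr => i _ /=.
by rewrite mevalZ mevalXU mulrC.
Qed.

Lemma lin_form_homog (l : 'cV[K]_4) : (\sum_i l i 0 *: 'X_i : {mpoly K[4]}) \is 1.-homog.
Proof. by apply: rpred_sum => i _; apply: rpredZ; rewrite dhomogX; apply/eqP/mdeg1. Qed.

End SteinerSurface.

(** * The preimage of the curve in the plane *)

Section CurveOnSteiner.

Variable K : numClosedFieldType.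
Variable M : 'M[K]_4.
Hypothesis uM : M \in unitmx.
Let N := invmx M.
Let F := steiner_eq M.
Variable C : set 'rV[K]_4.
Hypothesis C_closed : zclosed C.
Hypothesis C_F : forall z, C z -> F.@[z 0] = 0.
Hypothesis C_smooth : forall z, C z -> smooth_at 1 C z.

(** The coordinate lines are left out: off them [xi] inverts the parametrization and the factor
    [prod3 y ^+ 4] of the normal form can be cancelled. *)
Definition pullback (y : 'rV[K]_3) : Prop :=
  prod3 y != 0 /\ C (steiner_param (nrm3 y) y *m N).
Let D := pullback.

Lemma pullback_scale y a : a != 0 -> D y -> D (a *: y).
Proof.
move=> a0 [y0 Cy]; split.
  have -> : prod3 (a *: y) = a ^+ 3 * prod3 y by rewrite /prod3 /co3 !mxE; ring.
  by rewrite mulf_neq0 ?expf_neq0.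
by rewrite steiner_paramZ -scalemxAl; apply: zclosed_scale => //; rewrite expf_neq0.
Qed.

Lemma curve_steiner_quartic z : C z -> steiner_quartic (z *m M) = 0.
Proof. by move=> /C_F; rewrite meval_steiner_eq. Qed.

Lemma curve_cases z (x := z *m M) : C z -> xi x = 0 \/
  D (xi x) /\ steiner_param (nrm3 (xi x)) (xi x) *m N = (co4 x 1 * co4 x 2 * co4 x 3) *: z.
Proof.
move=> Cz; have s0 : steiner_quartic x = 0 := curve_steiner_quartic Cz.
case: (eqVneq (co4 x 1 * co4 x 2 * co4 x 3) 0) => [h|h].
  by left; apply: axes_xi; apply: steiner_quartic_axes.
right; have := steiner_param_xi x; rewrite s0 subr0 => ->.
have E : ((co4 x 1 * co4 x 2 * co4 x 3) *: x) *m N = (co4 x 1 * co4 x 2 * co4 x 3) *: z.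
  by rewrite -scalemxAl mulmxK.
split=> //; split.
  have [e0 e1 e2] := co_xi x; rewrite /prod3 e0 e1 e2.
  by apply: contraNneq h => h; apply/eqP/eqP; rewrite -sqrf_eq0 -h; apply/eqP; ring.
have := steiner_param_xi x; rewrite s0 subr0 => ->.
by rewrite E; apply: zclosed_scale.
Qed.

Lemma smooth_not_point z : C z -> ~ forall v, tangent_space C z v -> (v <= z)%MS.
Proof.
move=> Cz H; have [T [Tfree TP]] := C_smooth Cz.
have : (T <= z)%MS.
  by apply/row_subP => i; apply/H/TP/row_sub.
move/mxrankS; rewrite (eqP Tfree) => h.
by have := leq_trans h (rank_leq_row z).
Qed.

(* If [z] were isolated, [f] times any linear form vanishing at [z] would vanish
   on [C], and the tangent space of [C] at [z] would reduce to [z]. *)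
Lemma smooth_not_isolated z d (f : {mpoly K[4]}) : C z -> f \is d.-homog -> f.@[z 0] != 0 ->
  (forall z', C z' -> f.@[z' 0] != 0 -> (z' <= z)%MS) -> False.
Proof.
move=> Cz hf fz Hf; apply: (smooth_not_point Cz) => v Tv.
rewrite submxE; apply/eqP/rowP => j; rewrite [RHS]mxE.
pose l : 'cV[K]_4 := col j (cokermx z); pose L := \sum_i l i 0 *: 'X_i : {mpoly K[4]}.
have Lv (u : 'rV[K]_4) : (u *m cokermx z) 0 j = L.@[u 0].
  by rewrite lin_form_eval mxE [RHS]mxE; apply: eq_bigr => i _; rewrite [l i 0]mxE.
have Lz (u : 'rV[K]_4) : (u <= z)%MS -> L.@[u 0] = 0.
  by rewrite submxE => /eqP e; rewrite -Lv e mxE.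
have := Tv (f * L) (d + 1)%N (dhomogM hf (lin_form_homog l)).
have -> : \sum_(i < 4) (f * L)^`M(i).@[z 0] * v 0 i = f.@[z 0] * L.@[v 0].
  rewrite lin_form_eval mxE [RHS]mulr_sumr; apply: eq_bigr => i _.
  rewrite mderivM mevalD !mevalM (Lz z) // mulr0 add0r -mulrA; congr (_ * _).
  suff -> : L^`M(i) = (l i 0)%:MP by rewrite mevalC mulrC.
  rewrite /L raddf_sum /= (bigD1 i) //= big1.
    rewrite addr0 mderivZ mderivX mnm1E eqxx scale1r.
    rewrite (_ : (U_(i) - U_(i))%MM = 0%MM); last by apply/mnmP => k; rewrite mnmBE mnm0E subnn.
    by rewrite mpolyX0 alg_mpolyC.
  by move=> k ki; rewrite mderivZ mderivX mnm1E (negbTE ki) scale0r scaler0.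
move=> /(_ _)/eqP; rewrite mulf_eq0 (negbTE fz) /= => e; rewrite Lv; apply/eqP/e.
move=> u Cu; rewrite mevalM; case: (eqVneq f.@[u 0] 0) => [->|fu]; first by rewrite mul0r.
by rewrite (Lz u) ?mulr0 //; apply: Hf.
Qed.

(** If [P] did not vanish at [y], its product with the three coordinates and with linear forms
    vanishing at the listed points other than [z] would be nonzero at [z] and at no other point of
    the curve, against [smooth_not_isolated]. *)
Lemma pullback_isolated n (P : {mpoly K[3]}) (l : seq 'rV[K]_3) : P \is n.-homog ->
  (forall y, D y -> P.@[y 0] = 0 \/ exists x a, x \in l /\ y = a *: x) -> van_on D P.
Proof.
move=> hP Hl y Dy; apply: contrapT => /eqP Py.
have [y0 Cy] := Dy; set z := steiner_param (nrm3 y) y *m N in Cy.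
have zM : z *m M = steiner_param (nrm3 y) y by rewrite mulmxKV.
have [_ e1 e2 e3] := co_mk4 (nrm3 y) (co3 y 1 * co3 y 2) (co3 y 0 * co3 y 2) (co3 y 0 * co3 y 1).
have z0 : z != 0 := zclosed_neq0 C_closed Cy.
(* A listed point may be [z] itself; the linear form then only has to be nonzero at [z]. *)
have sep x : exists L : {mpoly K[4]}, [/\ L \is 1.-homog, L.@[z 0] != 0 &
    (z <= steiner_param (nrm3 x) x *m N)%MS \/ forall u : 'rV[K]_4, (u <= steiner_param (nrm3 x) x *m N)%MS -> L.@[u 0] = 0].
  set zx := _ *m N; case: (boolP (z <= zx)%MS) => h.
    have [i zi] : exists i, z 0 i != 0.
      apply: contrapT => H; case/eqP: z0; apply/rowP => i; rewrite [RHS]mxE.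
      by apply/eqP/negPn/negP => hi; apply: H; exists i.
    exists 'X_i; rewrite mevalXU; split=> //; last by left.
    by rewrite dhomogX; apply/eqP/mdeg1.
  move: h; rewrite submxE => h; have [j zj] : exists j, (z *m cokermx zx) 0 j != 0.
    apply: contrapT => H; case/eqP: h; apply/rowP => i; rewrite [RHS]mxE.
    by apply/eqP/negPn/negP => hi; apply: H; exists i.
  exists (\sum_i (col j (cokermx zx)) i 0 *: 'X_i).
  have Lv (u : 'rV[K]_4) : (\sum_i (col j (cokermx zx)) i 0 *: 'X_i).@[u 0] = (u *m cokermx zx) 0 j.
    by rewrite lin_form_eval mxE [RHS]mxE; apply: eq_bigr => i _; rewrite [col _ _ _ _]mxE.
  split; rewrite ?Lv //; first exact: lin_form_homog.
  by right => u; rewrite submxE => /eqP e; rewrite Lv e [LHS]mxE.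
have {sep} [L LP] := choice sep.
pose f := coordX M 1 * coordX M 2 * coordX M 3 * (P \mPo xi_forms M) * \prod_(x <- l) L x.
have [d hd] : exists d, f \is d.-homog.
  have [e he] : exists e, \prod_(x <- l) L x \is e.-homog.
    elim: (l) => [|x r [e IH]]; first by exists 0%N; rewrite big_nil; apply: dhomog1.
    by exists (1 + e)%N; rewrite big_cons; apply: dhomogM => //; have [] := LP x.
  have h3 := dhomogM (dhomogM (coordX_homog M 1) (coordX_homog M 2)) (coordX_homog M 3).
  by eexists; apply: (dhomogM (dhomogM h3 (comp_mpoly_homog hP (xi_forms_homog M))) he).
apply: (smooth_not_isolated Cy hd).
  rewrite /f !mevalM !meval_coordX meval_xi_forms zM xi_steiner_param.
  rewrite (meval_homogZ _ _ hP) /steiner_param e1 e2 e3 !mulf_neq0 ?expf_neq0 //;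
    try by move: y0; rewrite /prod3 !mulf_eq0 !negb_or => /andP [/andP []].
  rewrite rmorph_prod /= prodf_seq_neq0; apply/allP => x _; apply/implyP => _.
  by have [] := LP x.
move=> z' Cz' fz'.
have [h|[Dx E]] := curve_cases Cz'.
  move/eqP: fz'; case; rewrite /f !mevalM meval_xi_forms h.
  rewrite !meval_coordX (_ : co4 (z' *m M) 1 * _ * _ = 0) ?mul0r //.
  have [_ _ e] := co_xi (z' *m M); rewrite -e h /co3 mxE mul0r //.
have [h|[x [a [xl E']]]] := Hl _ Dx.
  by move/eqP: fz'; case; rewrite /f !mevalM meval_xi_forms h mulr0 mul0r.
have [_ _ [h|h]] := LP x.
  have s0 : co4 (z' *m M) 1 * co4 (z' *m M) 2 * co4 (z' *m M) 3 != 0.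
    apply/eqP => s0; move/eqP: fz'; case.
    by rewrite /f !mevalM !meval_coordX s0 !mul0r.
  rewrite E' steiner_paramZ -scalemxAl in E.
  have [b zb] := sub_rVP h.
  have b0 : b != 0 by apply: contraNneq z0 => b0; rewrite zb b0 scale0r.
  have E2 : z' = ((co4 (z' *m M) 1 * co4 (z' *m M) 2 * co4 (z' *m M) 3)^-1 * a ^+ 2 / b) *: z.
    by rewrite zb scalerA mulfVK // -scalerA E scalerA mulVf // scale1r.
  by rewrite E2 scalemx_sub.
move/eqP: fz'; case; rewrite /f mevalM rmorph_prod /= (_ : \prod_(_ <- _) _ = 0) ?mulr0 //.
apply/eqP; rewrite prodf_seq_eq0; apply/hasP; exists x => //=; apply/eqP; apply: h.
have s0 : co4 (z' *m M) 1 * co4 (z' *m M) 2 * co4 (z' *m M) 3 != 0.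
  have [/negP h _] := Dx; apply/eqP => s0; apply: h.
  by have [a0 a1 a2] := co_xi (z' *m M); rewrite /prod3 a0 a1 a2; apply/eqP;
    transitivity ((co4 (z' *m M) 1 * co4 (z' *m M) 2 * co4 (z' *m M) 3) ^+ 2); [ring | rewrite s0 expr0n].
rewrite E' steiner_paramZ -scalemxAl in E.
rewrite -[z']scale1r -(mulVf s0) -scalerA -E scalerA.
exact: scalemx_sub.
Qed.

End CurveOnSteiner.

(** * No conic contains the preimage of the curve *)

Section LinearSystem.

Variable K : numClosedFieldType.
Variable M : 'M[K]_4.
Hypothesis uM : M \in unitmx.
Let N := invmx M.
Let F := steiner_eq M.
Variable C : set 'rV[K]_4.
Hypothesis C_closed : zclosed C.
Hypothesis C_F : forall z, C z -> F.@[z 0] = 0.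
Variables (p : 'rV[K]_4) (L : 'I_3 -> 'M[K]_(2, 4)) (s : 'I_8 -> {mpoly K[4]}).
Hypothesis p_axes : [/\ co4 (p *m M) 1 = 0, co4 (p *m M) 2 = 0 & co4 (p *m M) 3 = 0].
Hypothesis L_axes : forall i z, plinear (L i) z ->
  [\/ co4 (z *m M) 1 = 0 /\ co4 (z *m M) 2 = 0, co4 (z *m M) 1 = 0 /\ co4 (z *m M) 3 = 0 |
      co4 (z *m M) 2 = 0 /\ co4 (z *m M) 3 = 0].
Hypothesis F_p : mult_ge 3 F p.
Hypothesis F_L : forall i, mult_ge_along 2 F (plinear (L i)).
Hypothesis s_system : forall f : {mpoly K[4]}, f \is 9.-homog ->
  ((exists a : 'I_8 -> K, f = \sum_(i < 8) a i *: s i) <->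
   [/\ mult_ge 6 f p, forall i, mult_ge_along 4 f (plinear (L i)) & mult_ge_along 2 f C]).
Hypothesis s_fixed : no_fixed_part s.
Let D := pullback M C.

Lemma steiner_eq_not_const c : F <> c%:MP.
Proof.
move=> Fc.
have e v : steiner_quartic (v *m M) = c by rewrite -meval_steiner_eq -/F Fc mevalC.
have st0 : steiner_quartic (0 : 'rV[K]_4) = 0 by rewrite /steiner_quartic /co4 !mxE; ring.
have c0 : c = 0 by rewrite -(e 0) mul0mx.
have := e (mk4 0 1 1 1 *m N); rewrite mulmxKV // c0.
have [e0 e1 e2 e3] := co_mk4 (0 : K) 1 1 1.
rewrite /steiner_quartic e0 e1 e2 e3 (_ : _ + _ = 3%:R); last by ring.
by apply/eqP; rewrite pnatr_eq0.
Qed.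

(** If the coefficient matrix were invertible, every [s i] would be a combination of the [w i], and
    [F] would be a fixed part of the system. *)
Lemma span_divisible (w : 'I_8 -> {mpoly K[4]}) :
  (forall i, exists a : 'I_8 -> K, w i = \sum_(j < 8) a j *: s j) ->
  (forall i, exists r, w i = r * F) ->
  exists2 b : 'rV[K]_8, b != 0 & \sum_i b 0 i *: w i = 0.
Proof.
move=> /choice [a aE] wF; pose A : 'M[K]_8 := \matrix_(i, j) a i j.
have comb (b : 'rV[K]_8) : \sum_i b 0 i *: w i = \sum_j (b *m A) 0 j *: s j.
  transitivity (\sum_i \sum_j (b 0 i * A i j) *: s j).
    apply: eq_bigr => i _; rewrite aE scaler_sumr; apply: eq_bigr => j _.
    by rewrite scalerA mxE.
  rewrite exchange_big; apply: eq_bigr => j _.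
  by rewrite mxE scaler_suml.
case: (boolP (\det A == 0)) => [/det0P [b b0 bA]|dA].
  by exists b => //; rewrite comb bA big1 // => j _; rewrite mxE scale0r.
have uA : A \in unitmx by rewrite unitmxE unitfE.
have [r rE] := choice wF.
suff sF : forall i, exists q, s i = q * F.
  by have [c Fc] := s_fixed sF; case: (@steiner_eq_not_const c).
move=> j; pose b : 'rV[K]_8 := delta_mx 0 j *m invmx A.
exists (\sum_i b 0 i *: r i).
have dj : \sum_k (delta_mx 0 j : 'rV[K]_8) 0 k *: s k = s j.
  rewrite (bigD1 j) //= mxE !eqxx scale1r big1 ?addr0 // => i ij.
  by rewrite mxE (negbTE ij) andbF scale0r.
have := comb b; rewrite mulmxKV // dj => <-; rewrite mulr_suml; apply: eq_bigr => i _.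
by rewrite rE scalerAl.
Qed.

Lemma curve_mult1 (f : {mpoly K[4]}) (P : {mpoly K[3]}) :
  P \is 2.-homog -> van_on D P -> mult_ge_along 1 (P \mPo xi_forms M) C.
Proof.
move=> hP vP z Cz; apply: mult_ge1; rewrite meval_xi_forms.
have [->|[Dx _]] := curve_cases uM C_closed C_F Cz; last exact: vP.
by rewrite -(scale0r 0) (meval_homogZ _ _ hP) expr0n mul0r.
Qed.

(* If a conic [P] vanished on the curve, the forms [F * P(xi) * X_k] and
   [F ^+ 2 * X_k] would be members of the system spanning eight dimensions, and
   [F] would divide the whole system. *)
Lemma pullback_low n (P : {mpoly K[3]}) : (n <= 2)%N -> P \is n.-homog ->
  van_on D P -> P = 0.
Proof.
(* Powers of a variable raise a form of lower degree to a conic. *)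
move=> n2 hP vP; pose Q := P * 'X_(inord 0) ^+ (2 - n).
suff Q0 : Q = 0.
  move/eqP: Q0; rewrite mulf_eq0 => /orP [/eqP //|]; rewrite expf_eq0 => /andP [_].
  by move/eqP/(congr1 (meval (fun _ => 1))); rewrite mevalXU meval0 => /eqP; rewrite oner_eq0.
have hQ : Q \is 2.-homog.
  have hX : ('X_(inord 0) : {mpoly K[3]}) \is 1.-homog by rewrite dhomogX; apply/eqP/mdeg1.
  by have := dhomogM hP (dhomogMn (2 - n) hX); rewrite mul1n subnKC.
have vQ : van_on D Q by move=> y Dy; rewrite mevalM vP ?mul0r.
move: Q hQ vQ => {n n2 hP vP}P hP vP; apply: contrapT => /eqP P0.
pose PX := P \mPo xi_forms M.
have hPX : PX \is 4.-homog := comp_mpoly_homog hP (xi_forms_homog M).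
have X1 i z : co4 (z *m M) i = 0 -> mult_ge 1 (coordX M i) z.
  by move=> e; apply: mult_ge1; rewrite meval_coordX.
have PXp : mult_ge 4 PX p.
  have [a1 a2 a3] := p_axes.
  apply: (comp_mpoly_mult_ge (e := 2) hP) => i; rewrite (tnth_nth 0).
  by case: i => [[|[|[|i]]] //= h]; apply: (@mult_geM _ _ 1 1); apply: X1.
have PXL i : mult_ge_along 2 PX (plinear (L i)).
  move=> z Lz; apply: (comp_mpoly_mult_ge (e := 1) hP) => j; rewrite (tnth_nth 0).
  have l10 k l : mult_ge 1 (coordX M k) z -> mult_ge 1 (coordX M k * coordX M l) z.
    by move=> h; apply: (@mult_geM _ _ 1 0).
  have l01 k l : mult_ge 1 (coordX M l) z -> mult_ge 1 (coordX M k * coordX M l) z.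
    by move=> h; apply: (@mult_geM _ _ 0 1).
  by have [] := L_axes Lz => -[a b]; case: j => [[|[|[|j]]] //= h];
    first [apply: l10; exact: X1 | apply: l01; exact: X1].
have PXC : mult_ge_along 1 PX C := curve_mult1 0 hP vP.
have FC : mult_ge_along 1 F C by move=> z Cz; apply: mult_ge1; apply: C_F.
have memb (f g : {mpoly K[4]}) k : f = F * g -> g \is 4.-homog -> mult_ge 3 g p ->
    (forall i, mult_ge_along 2 g (plinear (L i))) -> mult_ge_along 1 g C ->
    exists a : 'I_8 -> K, f * coordX M k = \sum_(j < 8) a j *: s j.
  move=> -> hg gp gL gC; apply/s_system.
    exact: (dhomogM (dhomogM (steiner_eq_homog M) hg) (coordX_homog M k)).
  split=> [|i z Lz|z Cz].
  - by apply: (@mult_geM _ _ 6 0) => //; apply: (@mult_geM _ _ 3 3).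
  - by apply: (@mult_geM _ _ 4 0) => //; apply: (@mult_geM _ _ 2 2); [apply: F_L Lz | apply: gL Lz].
  by apply: (@mult_geM _ _ 2 0) => //; apply: (@mult_geM _ _ 1 1); [apply: FC | apply: gC].
pose w (i : 'I_8) : {mpoly K[4]} := if (i < 4)%N then F * PX * coordX M i else F * F * coordX M (i - 4).
have [||b b0 bw] := @span_divisible w.
- move=> i; rewrite /w; case: ifP => _; first by apply: (memb _ PX) => //; apply: mult_geW PXp.
  by apply: (memb _ F) => //; apply: steiner_eq_homog.
- move=> i; rewrite /w; case: ifP => _; first by exists (PX * coordX M i); rewrite /F; ring.
  by exists (F * coordX M (i - 4)); ring.
pose bb (k : nat) : K := b 0 (inord k).
pose l1 := \sum_(k < 4) bb k *: coordX M k; pose l2 := \sum_(k < 4) bb (4 + k)%N *: coordX M k.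
have E : F * (PX * l1 + F * l2) = 0.
  rewrite -bw -[8%N]/(4 + 4)%N big_split_ord /= mulrDr; congr (_ + _).
    rewrite mulrA /l1 mulr_sumr; apply: eq_bigr => k _; rewrite /w /= ltn_ord scalerAr.
    by congr (_ * (_ *: _)); rewrite /bb; congr (b 0 _); apply/val_inj; rewrite /= inordK // (leq_trans (ltn_ord k)).
  rewrite mulrA /l2 mulr_sumr; apply: eq_bigr => k _.
  rewrite /w /= scalerAr addKn.
  congr (_ * (_ *: _)); rewrite /bb; congr (b 0 _); apply/val_inj; rewrite /= inordK //.
  by rewrite -[8%N]/(4 + 4)%N ltn_add2l.
have F0 : F != 0 by apply/eqP => h; apply: (@steiner_eq_not_const 0); rewrite h mpolyC0.
have {}E : PX * l1 + F * l2 = 0 by move/eqP: E; rewrite mulf_eq0 (negbTE F0) => /eqP.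
have l1E (v : 'rV[K]_4) : l1.@[v 0] = \sum_(k < 4) bb k * co4 (v *m M) k.
  by rewrite raddf_sum; apply: eq_bigr => k _ /=; rewrite mevalZ meval_coordX.
have l2E (v : 'rV[K]_4) : l2.@[v 0] = \sum_(k < 4) bb (4 + k)%N * co4 (v *m M) k.
  by rewrite raddf_sum; apply: eq_bigr => k _ /=; rewrite mevalZ meval_coordX.
(* On the surface the relation leaves [P * q = 0], where [q] is [l1] in the parametrization. Its
   four quadrics are independent, so [l1 = 0], and then [l2 = 0]. *)
pose q (y : 'rV[K]_3) : K := bb 0 * nrm3 y + bb 1 * (co3 y 1 * co3 y 2) + bb 2 * (co3 y 0 * co3 y 2)
  + bb 3 * (co3 y 0 * co3 y 1).
have qE (y : 'rV[K]_3) : P.@[y 0] * prod3 y != 0 -> q y = 0.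
  move=> Py; have := congr1 (meval ((steiner_param (nrm3 y) y *m N) 0)) E.
  rewrite meval0 mevalD !mevalM -/(_.@[_]) meval_xi_forms meval_steiner_eq l1E mulmxKV //.
  have := steiner_quartic_param y 0; rewrite subr0 mulr0 => ->; rewrite mul0r addr0.
  rewrite xi_steiner_param (meval_homogZ _ _ hP) => /eqP.
  have -> : \sum_(k < 4) bb k * co4 (steiner_param (nrm3 y) y) k = q y.
    have [e0 e1 e2 e3] := co_mk4 (nrm3 y) (co3 y 1 * co3 y 2) (co3 y 0 * co3 y 2) (co3 y 0 * co3 y 1).
    rewrite (@big_inord4 _ _ +%R) !inordK //= /steiner_param e0 e1 e2 e3 /q; ring.
  have n0 : prod3 y ^+ 2 * P.@[y 0] != 0.
    move: Py; rewrite mulf_eq0 negb_or => /andP [Py y0].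
    by rewrite mulf_neq0 ?expf_neq0.
  by rewrite mulf_eq0 (negbTE n0) => /eqP.
have pc i : polyfun (fun y : 'rV[K]_3 => co3 y i) by apply: polyfun_coord.
have pprod : polyfun (fun y : 'rV[K]_3 => prod3 y) by rewrite /prod3; polyf.
have pq : polyfun q by rewrite /q /nrm3; polyf.
have [y0 Py0] : exists y : 'rV[K]_3, P.@[y 0] * prod3 y != 0.
  apply: (@polyfun_nonzero_mul K 3 (fun y => P.@[y 0]) (fun y => prod3 y)) => //; first by exists P.
    apply: contrapT => H; case/eqP: P0; apply: mpoly_vanishing => v.
    have -> : P.@[v] = P.@[(\row_i v i) 0] by apply: meval_eq => i; rewrite mxE.
    by apply/eqP/negPn/negP => h; apply: H; exists (\row_i v i).
  by exists (const_mx 1); rewrite /prod3 /co3 !mxE !mul1r oner_neq0.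
have q0 (y : 'rV[K]_3) : q y = 0.
  apply: (polyfun_dense pq (g := fun y => P.@[y 0] * prod3 y) _ Py0) => //.
  by apply: (@polyfun_mul _ _ (fun y => P.@[y 0])) => //; exists P.
pose mk3 a b c : 'rV[K]_3 := \row_i nth 0 [:: a; b; c] i.
have mkE x1 x2 x3 : [/\ co3 (mk3 x1 x2 x3) 0 = x1, co3 (mk3 x1 x2 x3) 1 = x2 & co3 (mk3 x1 x2 x3) 2 = x3].
  by rewrite /co3 !mxE !inordK.
have bb0 : bb 0 = 0.
  by rewrite -(q0 (mk3 1 0 0)) /q /nrm3; have [-> -> ->] := mkE 1 0 0; ring.
have bb1 : bb 1 = 0.
  by rewrite -(q0 (mk3 0 1 1)) /q /nrm3 bb0; have [-> -> ->] := mkE 0 1 1; ring.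
have bb2 : bb 2 = 0.
  by rewrite -(q0 (mk3 1 0 1)) /q /nrm3 bb0; have [-> -> ->] := mkE 1 0 1; ring.
have bb3 : bb 3 = 0.
  by rewrite -(q0 (mk3 1 1 0)) /q /nrm3 bb0; have [-> -> ->] := mkE 1 1 0; ring.
have l10 : l1 = 0.
  rewrite /l1 (@big_inord4 _ _ +%R) !inordK //= bb0 bb1 bb2 bb3 !scale0r.
  by rewrite !addr0.
have l20 : l2 = 0.
  by move/eqP: E; rewrite l10 mulr0 add0r mulf_eq0 (negbTE F0) => /eqP.
have bb4 k : (k < 4)%N -> bb (4 + k)%N = 0.
  move=> k4; have := l2E (delta_mx 0 (inord k) *m N); rewrite l20 meval0 mulmxKV //.
  rewrite (bigD1 (Ordinal k4)) //= /co4 mxE !eqxx mulr1 big1 ?addr0 // => i ik.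
  rewrite mxE eqxx /= -val_eqE /= !inordK // -[(i : nat) == k]/((i : nat) == Ordinal k4).
  by rewrite val_eqE (negbTE ik) mulr0.
case/eqP: b0; apply/rowP => i; rewrite mxE.
have -> : b 0 i = bb i by rewrite /bb inord_val.
case: (ltnP i 4) => i4.
  by case: i i4 => [[|[|[|[|i]]]] //= h] _.
by rewrite -(subnKC i4) bb4 // ltn_subLR.
Qed.

End LinearSystem.

(** * The normal form of the linear system *)

Section Subspaces.

Variable K : fieldType.

Lemma subspace_matrix n (Z : 'rV[K]_n -> Prop) : Z 0 ->
  (forall a u v, Z u -> Z v -> Z (a *: u + v)) ->
  exists B : 'M[K]_n, forall a, Z a <-> (a <= B)%MS.
Proof.
move=> Z0 Zlin.
pose P k := `[< exists B : 'M[K]_n, \rank B = k /\ forall a : 'rV_n, (a <= B)%MS -> Z a >].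
have exP : exists k, P k.
  exists 0%N; apply/asboolP; exists 0; rewrite mxrank0; split=> // a.
  by rewrite submx0 => /eqP ->.
have bound k : P k -> (k <= n)%N by move/asboolP => [B [<- _]]; apply: rank_leq_row.
case: (ex_maxnP exP bound) => k /asboolP [B [rB HB]] Hmax; exists B => a; split; last exact: HB.
move=> Za; apply/negPn/negP => aB.
have : P (\rank (B + a)%MS).
  apply/asboolP; exists (B + a)%MS; split=> // v /sub_addsmxP [[D1 D2]] /= ->.
  rewrite addrC [D2]mx11_scalar mul_scalar_mx; apply: Zlin => //.
  by apply: HB; apply: submxMl.
move/Hmax; rewrite -rB leqNgt => /negP; apply.
have := mxrank_leqif_sup (addsmxSl B a) => /ltn_leqif ->.
by apply: contra aB; apply: submx_trans; apply: addsmxSr.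
Qed.

(** Otherwise a complement of Z' in Z contains r + 1 independent vectors, and a nontrivial
    combination of them would lie in Z'. *)
Lemma rank_step n r (Z Z' : 'rV[K]_n -> Prop) (B B' : 'M[K]_n) :
  (forall a, Z a <-> (a <= B)%MS) -> (forall a, Z' a <-> (a <= B')%MS) ->
  (forall v : 'I_r.+1 -> 'rV[K]_n, (forall i, Z (v i)) ->
     exists2 c : 'rV[K]_r.+1, c != 0 & Z' (\sum_i c 0 i *: v i)) ->
  (\rank B <= \rank B' + r)%N.
Proof.
move=> ZB ZB' H; rewrite leqNgt; apply/negP => h.
have rd : (r < \rank (B :\: B'))%N.
  have := mxrank_cap_compl B B'; have := mxrankS (capmxSr B B'); lia.
pose R := row_base (B :\: B')%MS; pose w := widen_ord rd.
have Rsub i : (row i R <= B :\: B')%MS.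
  by apply: submx_trans (row_sub i R) _; rewrite eq_row_base.
have [c c0 Zc] := H (fun i => row (w i) R) (fun i =>
  (ZB _).2 (submx_trans (Rsub (w i)) (diffmxSl B B'))).
case/eqP: c0; move/ZB': Zc => Zc.
have u0 : \sum_i c 0 i *: row (w i) R = 0.
  apply/eqP; rewrite -submx0 -(capmx_diff B B') sub_capmx Zc andbT.
  by apply: summx_sub => i _; apply: scalemx_sub.
have E : (\sum_i c 0 i *: (delta_mx 0 (w i) : 'rV[K]__)) *m R = 0.
  rewrite -u0 mulmx_suml; apply: eq_bigr => i _.
  by rewrite -scalemxAl -rowE.
have /rowP c'0 : \sum_i c 0 i *: delta_mx 0 (w i) = 0 :> 'rV[K]_(\rank (B :\: B')).
  apply/eqP; rewrite -submx0; have <- : kermx R = 0 by apply/eqP; rewrite kermx_eq0 row_base_free.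
  by apply/sub_kermxP.
apply/rowP => i; have := c'0 (w i); rewrite !mxE summxE (bigD1 i) //= big1.
  by rewrite !mxE !eqxx mulr1 addr0.
move=> j ji; rewrite !mxE eqxx /= (_ : (w i == w j) = false) ?mulr0 //.
by rewrite -val_eqE /= eq_sym; apply: negbTE.
Qed.

Lemma left_kernel m n (A : 'M[K]_(m, n)) : (n < m)%N ->
  exists2 c : 'rV[K]_m, c != 0 & c *m A = 0.
Proof.
move=> nm; have : kermx A != 0.
  rewrite kermx_eq0 /row_free; apply/eqP => h.
  by have := rank_leq_col A; rewrite h leqNgt nm.
case/rowV0Pn => c /sub_kermxP cA c0; by exists c.
Qed.

End Subspaces.

Section TernaryForms.

Variable K : numClosedFieldType.

Lemma form_expand n (P : {mpoly K[3]}) : P \is n.-homog -> exists c : nat -> nat -> K,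
  forall y : 'rV[K]_3, P.@[y 0] = \sum_(i < n.+1) \sum_(k < n.+1 - i)
    c i k * (co3 y 0 ^+ (n - i - k) * co3 y 1 ^+ k * co3 y 2 ^+ i).
Proof.
move=> hP; pose p := deh 0 0 P; exists (fun i k => p`_i`_k) => y.
have -> : P = homogenize 0 0 n p.
  apply/subr0_eq/(@deh_inj _ 0 0 n); first by rewrite rpredB // homogenize_homog.
  rewrite -[P in P - _]scale1r -scaleN1r deh_is_linear homogenizeK; last exact: tdeg_le_deh.
  by rewrite polyCN polyC1 scale1r scaleN1r subrr.
rewrite meval_homogenize; apply: eq_bigr => i _; apply: eq_bigr => k _.
by rewrite !mul0r !subr0.
Qed.

Lemma linear_form3 (P : {mpoly K[3]}) : P \is 1.-homog -> exists c : nat -> K,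
  forall y : 'rV[K]_3, P.@[y 0] = c 1 * co3 y 0 + c 2 * co3 y 1 + c 3 * co3 y 2.
Proof.
move=> /form_expand [c cE]; exists (nth (0 : K) [:: 0 : K; c 0 0; c 0 1; c 1 0]) => y.
rewrite cE !big_ord_recl !big_ord0 /= /bump /=; ring.
Qed.

Lemma quadratic_form3 (P : {mpoly K[3]}) : P \is 2.-homog -> exists c : nat -> K,
  forall y : 'rV[K]_3, P.@[y 0] = c 1 * co3 y 0 ^+ 2 + c 2 * co3 y 1 ^+ 2 + c 3 * co3 y 2 ^+ 2
    + c 4 * co3 y 0 * co3 y 1 + c 5 * co3 y 0 * co3 y 2 + c 6 * co3 y 1 * co3 y 2.
Proof.
move=> /form_expand [c cE].
exists (nth (0 : K) [:: 0 : K; c 0 0; c 0 2; c 2 0; c 0 1; c 1 0; c 1 1]) => y.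
rewrite cE !big_ord_recl !big_ord0 /= /bump /=; ring.
Qed.

Lemma cubic_form3 (P : {mpoly K[3]}) : P \is 3.-homog -> exists c : nat -> K,
  forall y : 'rV[K]_3, P.@[y 0] = c 1 * co3 y 0 ^+ 3 + c 2 * co3 y 1 ^+ 3 + c 3 * co3 y 2 ^+ 3
  + c 4 * co3 y 0 ^+ 2 * co3 y 1 + c 5 * co3 y 0 ^+ 2 * co3 y 2
  + c 6 * co3 y 1 ^+ 2 * co3 y 0 + c 7 * co3 y 1 ^+ 2 * co3 y 2
  + c 8 * co3 y 2 ^+ 2 * co3 y 0 + c 9 * co3 y 2 ^+ 2 * co3 y 1
  + c 0 * co3 y 0 * co3 y 1 * co3 y 2.
Proof.
move=> /form_expand [c cE].
exists (nth (0 : K) [:: c 1 1; c 0 0; c 0 3; c 3 0; c 0 1; c 1 0; c 0 2; c 1 2; c 2 0; c 2 1]) => y.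
rewrite cE !big_ord_recl !big_ord0 /= /bump /=; ring.
Qed.

Lemma meval_const_form (P : {mpoly K[3]}) (y y' : 'rV[K]_3) :
  P \is 0.-homog -> P.@[y 0] = P.@[y' 0].
Proof.
move=> hP; have e u := meval_homogZ 0 u hP.
by have := e y; have := e y'; rewrite !scale0r !expr0 !mul1r => <- <-.
Qed.

End TernaryForms.

(** * The system restricted to the Steiner parametrization *)

Section SteinerSystem.

Variable K : numClosedFieldType.

Lemma mult_ge_poly_curve n m (f : {mpoly K[n]}) (h : 'I_n -> {poly K}) (z : 'rV[K]_n) :
  (forall i, (h i).[0] = z 0 i) -> mult_ge m f z ->
  exists q : {poly K}, forall t, f.@[fun i => (h i).[t]] = t ^+ m * q.[t].
Proof.
move=> h0 mf.
have H i : exists w : {poly K}, h i = (z 0 i)%:P + 'X * w.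
  have : root (h i - (z 0 i)%:P) 0 by rewrite rootE !hornerE h0 subrr.
  move/factor_theorem => [w]; rewrite subr0 => /(canRL (subrK _)) ->.
  by exists w; rewrite addrC mulrC.
have [w wE] := choice H.
have [q qE] := mult_ge_curve w mf.
by exists q => t; rewrite -qE; apply: meval_eq => i; rewrite wE !hornerE.
Qed.

Definition nrm_form : {mpoly K[3]} :=
  'X_(inord 0) ^+ 2 + 'X_(inord 1) ^+ 2 + 'X_(inord 2) ^+ 2.

Lemma nrm_form_homog : nrm_form \is 2.-homog.
Proof.
have X (i : 'I_3) : ('X_i : {mpoly K[3]}) \is 1.-homog by rewrite dhomogX; apply/eqP/mdeg1.
have X2 (i : 'I_3) : ('X_i ^+ 2 : {mpoly K[3]}) \is 2.-homog := dhomogMn 2 (X i).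
by rewrite !rpredD.
Qed.

Lemma nrm3_delta j : nrm3 (delta_mx 0 j : 'rV[K]_3) = 1.
Proof.
rewrite /nrm3 /co3 !mxE !eqxx /=; case: j => [[|[|[|j]]] //= h];
by rewrite -!val_eqE /= !inordK //= !expr2 !mulr0 !mulr1 ?addr0 ?add0r.
Qed.

Variables (M : 'M[K]_4) (L : 'I_3 -> 'M[K]_(2, 4)).
Hypothesis uM : M \in unitmx.
Let N := invmx M.

Hypothesis axes_L : forall j, (0 < j < 4)%N -> exists i, forall x : 'rV[K]_4, x != 0 ->
  (forall k, off_axis j k != 0%N -> x 0 k = 0) -> plinear (L i) (x *m N).

Lemma normal_form_phi (f : {mpoly K[4]}) : f \is 9.-homog ->
  (forall i, mult_ge_along 4 f (plinear (L i))) ->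
  exists H : nat -> {mpoly K[3]},
    [/\ forall k, (k < 4)%N -> H k \is (6 - 2 * k).-homog,
        forall phi (y : 'rV[K]_3), f.@[(steiner_param (nrm3 y - phi) y *m N) 0] =
          prod3 y ^+ 4 * \sum_(k < 4) phi ^+ k * (H k).@[y 0] &
        forall j : 'I_3, \sum_(k < 4) (H k).@[(delta_mx 0 j : 'rV[K]_3) 0] = 0].
Proof.
move=> hf fL; pose g := lin_subst N f.
have hg : g \is 9.-homog by apply: lin_subst_homog.
have [j jP x|e [he eE e0]] := normal_form hg.
  have [i Li] := axes_L jP.
  (* The weighted point is [xa + t *: xb]: a line that starts on the axis. *)
  pose xa : 'rV[K]_4 := \row_k (if off_axis j k != 0%N then 0 else x k).
  pose xb : 'rV[K]_4 := \row_k (if off_axis j k != 0%N then x k else 0).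
  have xE t : g.@[fun k => t ^+ off_axis j k * x k] = f.@[(xa *m N + t *: (xb *m N)) 0].
    rewrite scalemxAl -mulmxDl -meval_lin_subst; apply: meval_eq => k; rewrite !mxE.
    by rewrite /off_axis; case: (_ && _); rewrite /= ?expr1 ?expr0 ?mulr0 ?mul1r ?add0r ?addr0.
  (* If [xa = 0] there is no point of the axis to start from, but homogeneity gives the factor
     t^9. *)
  case: (eqVneq xa 0) => [xa0|xan0].
    exists ('X^5 * (f.@[(xb *m N) 0])%:P) => t.
    rewrite xE xa0 mul0mx add0r (meval_homogZ _ _ hf) hornerM hornerC hornerXn mulrA -exprD //.
  have Lx : plinear (L i) (xa *m N) by apply: Li => // k jk; rewrite mxE jk.
  have [q qE] := mult_ge_curve (fun k => ((xb *m N) 0 k)%:P) (fL i _ Lx).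
  by exists q => t; rewrite xE -qE; apply: meval_eq => k; rewrite hornerC !mxE.
(* The coefficients of the sum of [(Q - phi) ^+ k * e k] as a polynomial in [phi]. *)
pose Q := nrm_form;
exists (nth 0 [:: e 0%N + e 1%N * Q + e 2%N * Q ^+ 2 + e 3%N * Q ^+ 3;
   - (e 1%N + 2%:R *: (e 2%N * Q) + 3%:R *: (e 3%N * Q ^+ 2));
   e 2%N + 3%:R *: (e 3%N * Q); - e 3%N]).
have ev (y : 'rV[K]_3) phi : \sum_(k < 4) phi ^+ k * (nth 0 [:: e 0%N + e 1%N * Q + e 2%N * Q ^+ 2 + e 3%N * Q ^+ 3;
   - (e 1%N + 2%:R *: (e 2%N * Q) + 3%:R *: (e 3%N * Q ^+ 2));
   e 2%N + 3%:R *: (e 3%N * Q); - e 3%N] k).@[y 0] =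
   \sum_(k < 4) (nrm3 y - phi) ^+ k * (e k).@[y 0].
  rewrite !big_ord_recl !big_ord0 /= /bump /= !(mevalD, mevalN, mevalZ, mevalM, rmorphXn) /= !mevalXU /nrm3 /co3.
  ring.
split.
- have Q1 := nrm_form_homog.
  have Qn k : Q ^+ k \is (2 * k).-homog := dhomogMn k Q1.
  move=> [|[|[|[|k]]]] //= _.
  + rewrite !rpredD //; first exact: he.
    * exact: dhomogM (he 1%N _) Q1.
    * exact: dhomogM (he 2%N _) (Qn 2%N).
    * exact: dhomogM (he 3%N _) (Qn 3%N).
  + rewrite rpredN !rpredD ?rpredZ //; first exact: he.
    * exact: dhomogM (he 2%N _) Q1.
    * exact: dhomogM (he 3%N _) (Qn 2%N).
  + rewrite rpredD ?rpredZ //; first exact: he.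
    exact: dhomogM (he 3%N _) Q1.
  by rewrite rpredN; apply: he.
- by move=> phi y; rewrite ev -eE -meval_lin_subst.
(* At a vertex and [phi = 1] the coordinate [x0] is zero, so only [e 0] contributes. *)
move=> j; have := ev (delta_mx 0 j) 1.
rewrite nrm3_delta subrr => E.
transitivity (\sum_(k < 4) (0 : K) ^+ k * (e k).@[(delta_mx 0 j : 'rV[K]_3) 0]).
  by rewrite -E; apply: eq_bigr => k _; rewrite expr1n mul1r.
by rewrite big_ord_recl big1 /= ?expr0 ?mul1r ?e0 ?addr0 // => k _; rewrite /bump /= expr0n mul0r.
Qed.

Variable C : set 'rV[K]_4.
Let D := pullback M C.

(** The arc given by [y + t *: w] and [phi = b * t] meets the curve at t = 0, where [prod3] is
    nonzero; hence t^2 is coprime to the factor [prod3 ^+ 4] and divides the remaining one. *)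
Lemma pullback_order2 (f : {mpoly K[4]}) (H : nat -> {mpoly K[3]}) (y w : 'rV[K]_3) b :
  (forall phi (y : 'rV[K]_3), f.@[(steiner_param (nrm3 y - phi) y *m N) 0] =
     prod3 y ^+ 4 * \sum_(k < 4) phi ^+ k * (H k).@[y 0]) ->
  mult_ge_along 2 f C -> D y ->
  exists q : {poly K}, forall t,
    \sum_(k < 4) (b * t) ^+ k * (H k).@[(y + t *: w) 0] = t ^+ 2 * q.[t].
Proof.
move=> fE fC [y0 Cy].
pose Y i : {poly K} := (co3 y i)%:P + (co3 w i)%:P * 'X.
have YE i t : (Y i).[t] = co3 (y + t *: w) i by rewrite /Y !hornerE /co3 !mxE mulrC.
pose X (i : nat) : {poly K} := nth 0 [:: Y 0 ^+ 2 + Y 1 ^+ 2 + Y 2 ^+ 2 - b *: 'X;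
  Y 1 * Y 2; Y 0 * Y 2; Y 0 * Y 1] i.
have XE (i : 'I_4) t : (X i).[t] = steiner_param (nrm3 (y + t *: w) - b * t) (y + t *: w) 0 i.
  by rewrite mxE /X /nrm3 -!YE; case: i => [[|[|[|[|i]]]] //= h]; rewrite !hornerE //= !expr2.
pose h (i : 'I_4) : {poly K} := \sum_(k < 4) X k * (N k i)%:P.
have hE i t : (h i).[t] = (steiner_param (nrm3 (y + t *: w) - b * t) (y + t *: w) *m N) 0 i.
  by rewrite mxE /h horner_sum; apply: eq_bigr => k _; rewrite hornerM hornerC XE.
have [||q qE] := @mult_ge_poly_curve _ 2 f h (steiner_param (nrm3 y) y *m N).
- by move=> i; rewrite hE scale0r addr0 mulr0 subr0.
- exact: fC.
pose P : {poly K} := Y 0%N * Y 1%N * Y 2%N.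
have PE t : P.[t] = prod3 (y + t *: w) by rewrite /P !hornerM !YE.
pose G : {poly K} := \sum_(k < 4) (b *: 'X) ^+ k * curve (H k) (fun i => Y i).
have GE t : G.[t] = \sum_(k < 4) (b * t) ^+ k * (H k).@[(y + t *: w) 0].
  rewrite /G horner_sum; apply: eq_bigr => k _.
  rewrite hornerM horner_exp hornerZ hornerX horner_curve; congr (_ * _).
  by apply: meval_eq => i; rewrite YE /co3 inord_val.
have PG : P ^+ 4 * G = 'X^2 * q.
  apply/subr0_eq/poly_vanishing => t; rewrite hornerD hornerN (hornerM (P ^+ 4)) (hornerM 'X^2) !horner_exp hornerX PE GE.
  by rewrite -qE -fE -(@meval_eq _ _ (fun i => (h i).[t])) ?subrr.
have coXP : coprimep 'X^2 (P ^+ 4).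
  apply/coprimep_expl/coprimep_expr; rewrite -['X]subr0 coprimep_sym coprimep_XsubC.
  by rewrite rootE PE scale0r addr0.
have : 'X^2 %| G by rewrite -(Gauss_dvdpr _ coXP) PG dvdp_mulIl.
case/dvdpP => g gE; exists g => t.
by rewrite -GE gE hornerM hornerXn mulrC.
Qed.

(** Arcs inside the surface ([phi = 0]) give the condition on [H 0]; the arc with [y] fixed and
    [phi = t] gives the one on [H 1]. *)
Lemma normal_form_double (f : {mpoly K[4]}) (H : nat -> {mpoly K[3]}) :
  (forall phi (y : 'rV[K]_3), f.@[(steiner_param (nrm3 y - phi) y *m N) 0] =
     prod3 y ^+ 4 * \sum_(k < 4) phi ^+ k * (H k).@[y 0]) ->
  mult_ge_along 2 f C -> double_on D (H 0%N) /\ van_on D (H 1%N).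
Proof.
move=> fE fC; split=> [y Dy w|y Dy].
  have [q qE] := pullback_order2 w 0 fE fC Dy; exists q => t.
  rewrite -qE big_ord_recl big1 => [|k _]; first by rewrite mul0r expr0 mul1r addr0.
  by rewrite /bump /= mul0r expr0n mul0r.
have [q qE] := pullback_order2 0 1 fE fC Dy.
pose P : {poly K} := \sum_(k < 4) (H k).@[y 0] *: 'X^k.
have PE : P = 'X^2 * q.
  apply/subr0_eq/poly_vanishing => t; rewrite hornerD hornerN hornerM hornerXn -qE /P horner_sum.
  apply/eqP; rewrite subr_eq0; apply/eqP/eq_bigr => k _.
  by rewrite hornerZ hornerXn mul1r scaler0 addr0 mulrC.
have := congr1 (fun p : {poly K} => p`_1) PE.
rewrite coefXnM /= /P !big_ord_recl big_ord0 /= !coefD !coefZ !coefXn /=.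
by rewrite !mulr0 mulr1 add0r coef0 !addr0.
Qed.

End SteinerSystem.

(** * Members of the system in terms of T and S *)

Section CubicModel.

Variable K : numClosedFieldType.

Lemma double_on_comb (D : 'rV[K]_3 -> Prop) n (P : 'I_n -> {mpoly K[3]}) (a : 'I_n -> K) :
  (forall i, double_on D (P i)) -> double_on D (\sum_i a i *: P i).
Proof.
move=> dP y Dy w; have [q qE] := choice (fun i => dP i y Dy w).
exists (\sum_i a i *: q i) => t.
rewrite raddf_sum horner_sum mulr_sumr; apply: eq_bigr => i _ /=.
by rewrite mevalZ qE hornerZ mulrCA.
Qed.

Lemma van_on_comb (D : 'rV[K]_3 -> Prop) n (P : 'I_n -> {mpoly K[3]}) (a : 'I_n -> K) :
  (forall i, van_on D (P i)) -> van_on D (\sum_i a i *: P i).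
Proof.
move=> vP y Dy; rewrite raddf_sum big1 // => i _ /=.
by rewrite mevalZ vP // mulr0.
Qed.

Definition model_t (c : nat -> K) (phi : K) (y : 'rV[K]_3) (cy : K) (k : nat) : K :=
  nth 0 [:: cy - phi * (c 1 * co3 y 0 + c 2 * co3 y 1 + c 3 * co3 y 2);
            phi * co3 y 0; phi * co3 y 1; phi * co3 y 2] k.

Definition cubic3 (c : nat -> K) (y : 'rV[K]_3) : K :=
  cub c (nth 0 [:: 0; co3 y 0; co3 y 1; co3 y 2]).

(* The conditions at the vertices make the coefficients of [T j ^+ 2] vanish. *)
Lemma model_column (c : nat -> K) (cP l : {mpoly K[3]}) (al : K) (H : nat -> {mpoly K[3]}) :
  (forall y : 'rV[K]_3, cP.@[y 0] = cubic3 c y) ->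
  (forall k, (k < 4)%N -> H k \is (6 - 2 * k).-homog) ->
  (forall j : 'I_3, \sum_(k < 4) (H k).@[(delta_mx 0 j : 'rV[K]_3) 0] = 0) ->
  l \is 1.-homog -> H 0%N = al *: cP ^+ 2 -> H 1%N = cP * l ->
  exists n : nat -> K, forall phi (y : 'rV[K]_3) (T := model_t c phi y (cubic3 c y)),
    \sum_(k < 4) phi ^+ k * (H k).@[y 0] =
    \sum_(k < 8) vecn T (phi ^+ 3 - (T 1%N ^+ 2 + T 2%N ^+ 2 + T 3%N ^+ 2)) k * n k.
Proof.
move=> cE hH He hl H0 H1.
have [la laE] := linear_form3 hl.
have [p pE] := quadratic_form3 (hH 2%N isT).
pose h := (H 3%N).@[(0 : 'rV[K]_3) 0].
have hE (y : 'rV[K]_3) : (H 3%N).@[y 0] = h := meval_const_form y 0 (hH 3%N isT).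
have sumE phi (y : 'rV[K]_3) : \sum_(k < 4) phi ^+ k * (H k).@[y 0] =
    al * cubic3 c y ^+ 2 + phi * (cubic3 c y * l.@[y 0]) + phi ^+ 2 * (H 2%N).@[y 0] + phi ^+ 3 * h.
  rewrite !big_ord_recl big_ord0 /= /bump /= H0 H1 hE mevalZ expr2 !mevalM !cE; ring.
have pj (j : 'I_3) : al * c j.+1 ^+ 2 + c j.+1 * la j.+1 + p j.+1 + h = 0.
  have := sumE 1 (delta_mx 0 j).
  have -> : \sum_(k < 4) 1 ^+ k * (H k).@[(delta_mx 0 j : 'rV[K]_3) 0] = 0.
    by rewrite -[RHS](He j); apply: eq_bigr => k _; rewrite expr1n mul1r.
  move=> ->; rewrite laE pE /cubic3 /cub /co3 !mxE !eqxx /=.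
  by case: j => [[|[|[|j]]] //= j3]; rewrite -!val_eqE /= !inordK //=; ring.
have [p1 p2 p3] := And3 (pj (inord 0)) (pj (inord 1)) (pj (inord 2)).
rewrite !inordK // in p1 p2 p3.
(* Substitute T_0 + sum c_j T_j for the cubic and T_j for phi y_(j-1). By [pj] the coefficient of
   each T_j^2 is [- h], which completes [h * phi ^+ 3] to [h] times the last coordinate. *)
exists (nth 0 [:: al; 2%:R * al * c 1 + la 1; 2%:R * al * c 2 + la 2; 2%:R * al * c 3 + la 3;
  2%:R * al * c 1 * c 2 + c 1 * la 2 + c 2 * la 1 + p 4;
  2%:R * al * c 1 * c 3 + c 1 * la 3 + c 3 * la 1 + p 5;
  2%:R * al * c 2 * c 3 + c 2 * la 3 + c 3 * la 2 + p 6; h]) => phi y /=.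
rewrite sumE laE pE !big_ord_recl big_ord0 /= /bump /= /vecn /model_t /=.
set C := cubic3 c y.
have e1 : p 1 = - (al * c 1 ^+ 2 + c 1 * la 1 + h) by apply/eqP; rewrite -addr_eq0 -p1; apply/eqP; ring.
have e2 : p 2 = - (al * c 2 ^+ 2 + c 2 * la 2 + h) by apply/eqP; rewrite -addr_eq0 -p2; apply/eqP; ring.
have e3 : p 3 = - (al * c 3 ^+ 2 + c 3 * la 3 + h) by apply/eqP; rewrite -addr_eq0 -p3; apply/eqP; ring.
rewrite e1 e2 e3; ring.
Qed.

End CubicModel.

(** * The dimension count and the matrix of the system *)

Section RankCount.

Variable K : numClosedFieldType.

Lemma comb_form n m (P : 'I_m -> {mpoly K[n]}) d (a : 'I_m -> K) :
  (forall i, P i \is d.-homog) -> \sum_i a i *: P i \is d.-homog.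
Proof. by move=> hP; apply: rpred_sum => i _; apply/rpredZ/hP. Qed.

Definition mk3 (a b c : K) : 'rV[K]_3 := \row_i nth 0 [:: a; b; c] i.

Lemma co_mk3 a b c : [/\ co3 (mk3 a b c) 0 = a, co3 (mk3 a b c) 1 = b & co3 (mk3 a b c) 2 = c].
Proof. by rewrite /co3 !mxE !inordK. Qed.

Lemma quadratic_form_zero (P : {mpoly K[3]}) : P \is 2.-homog ->
  (forall j : 'I_3, P.@[(delta_mx 0 j : 'rV[K]_3) 0] = 0) ->
  P.@[mk3 0 1 1 0] = 0 -> P.@[mk3 1 0 1 0] = 0 -> P.@[mk3 1 1 0 0] = 0 -> P = 0.
Proof.
move=> /quadratic_form3 [c cE] d q0 q1 q2.
have cj (j : 'I_3) : c j.+1 = 0.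
  have := d j; rewrite cE /co3 !mxE !eqxx => <-.
  by case: j => [[|[|[|j]]] //= j3]; rewrite -!val_eqE /= !inordK //=; ring.
have c1 := cj (inord 0); have c2 := cj (inord 1); have c3 := cj (inord 2).
rewrite !inordK // in c1 c2 c3.
have [a0 a1 a2] := co_mk3 0 1 1; have [b0 b1 b2] := co_mk3 1 0 1.
have [d0 d1 d2] := co_mk3 1 1 0.
rewrite cE a0 a1 a2 c1 c2 c3 !(mul0r, mulr0, mulr1, add0r, addr0) in q0.
rewrite cE b0 b1 b2 c1 c2 c3 !(mul0r, mulr0, mulr1, add0r, addr0) in q1.
rewrite cE d0 d1 d2 c1 c2 c3 !(mul0r, mulr0, mulr1, add0r, addr0) in q2.
apply: mpoly_vanishing => v.
rewrite -(@meval_eq _ _ ((\row_i v i) 0)) => [|i]; last by rewrite mxE.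
by rewrite cE c1 c2 c3 q0 q1 q2; ring.
Qed.

Variables (M : 'M[K]_4) (s : 'I_8 -> {mpoly K[4]}) (D : 'rV[K]_3 -> Prop).
Hypothesis uM : M \in unitmx.
Let N := invmx M.
Hypothesis s_homog : forall i, s i \is 9.-homog.
Hypothesis s_indep : forall a : 'rV[K]_8, \sum_i a 0 i *: s i = 0 -> a = 0.
Hypothesis D_scale : forall y a, a != 0 -> D y -> D (a *: y).
Hypothesis D_isolated : forall n (P : {mpoly K[3]}) (l : seq 'rV[K]_3), P \is n.-homog ->
  (forall y, D y -> P.@[y 0] = 0 \/ exists x a, x \in l /\ y = a *: x) -> van_on D P.
Hypothesis D_low : forall n (P : {mpoly K[3]}), (n <= 2)%N -> P \is n.-homog ->
  van_on D P -> P = 0.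

Variable H : 'I_8 -> nat -> {mpoly K[3]}.
Hypothesis H_homog : forall i k, (k < 4)%N -> H i k \is (6 - 2 * k).-homog.
Hypothesis HE : forall i phi (y : 'rV[K]_3), (s i).@[(steiner_param (nrm3 y - phi) y *m N) 0] =
  prod3 y ^+ 4 * \sum_(k < 4) phi ^+ k * (H i k).@[y 0].
Hypothesis H_vertex : forall i (j : 'I_3), \sum_(k < 4) (H i k).@[(delta_mx 0 j : 'rV[K]_3) 0] = 0.
Hypothesis H0_double : forall i, double_on D (H i 0%N).
Hypothesis H1_van : forall i, van_on D (H i 1%N).

Let comb (a : 'rV[K]_8) k := \sum_i a 0 i *: H i k.

Lemma comb_steiner (a : 'rV[K]_8) phi (y : 'rV[K]_3) :
  (\sum_i a 0 i *: s i).@[(steiner_param (nrm3 y - phi) y *m N) 0] =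
  prod3 y ^+ 4 * \sum_(k < 4) phi ^+ k * (comb a k).@[y 0].
Proof.
rewrite raddf_sum /=; under eq_bigr do rewrite mevalZ HE mulrCA mulr_sumr.
rewrite -mulr_sumr exchange_big /=; congr (_ * _); apply: eq_bigr => k _.
by rewrite raddf_sum mulr_sumr; apply: eq_bigr => i _ /=; rewrite mevalZ mulrCA.
Qed.

(* Every point off the coordinate planes is proportional to a parametrized one. *)
Lemma steiner_param_dense (f : {mpoly K[4]}) d : f \is d.-homog ->
  (forall phi (y : 'rV[K]_3), prod3 y != 0 ->
     f.@[(steiner_param (nrm3 y - phi) y *m N) 0] = 0) -> f = 0.
Proof.
move=> hf f0; apply: mpoly_vanishing => v.
pose g (x : 'rV[K]_4) := co4 x 1 * co4 x 2 * co4 x 3.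
have pg : polyfun g.
  by apply: polyfun_mul; [apply: polyfun_mul|]; apply: polyfun_coord.
have pf : polyfun (fun x : 'rV[K]_4 => f.@[(x *m N) 0]).
  by apply: (@polyfun_meval _ _ _ f (fun i x => (x *m N) 0 i)) => i; apply: polyfun_mulmx.
have g1 : g (mk4 0 1 1 1) != 0.
  by have [_ e1 e2 e3] := co_mk4 (0 : K) 1 1 1; rewrite /g e1 e2 e3 !mulr1 oner_neq0.
have := polyfun_dense pf pg g1 _ ((\row_i v i) *m M).
rewrite mulmxK // (@meval_eq _ _ _ v) => [-> //|i]; last by rewrite mxE.
move=> x gx.
have [e0 e1 e2] := co_xi x.
have px : prod3 (xi x) != 0.
  rewrite /prod3 e0 e1 e2 (_ : _ * _ = g x ^+ 2) ?expf_neq0 //.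
  by rewrite /g; ring.
have := f0 (steiner_quartic x) _ px; rewrite steiner_param_xi -/(g x) -scalemxAl (meval_homogZ _ _ hf).
by move/eqP; rewrite mulf_eq0 expf_eq0 (negbTE gx) andbF => /eqP.
Qed.

Lemma comb_inj (a : 'rV[K]_8) : (forall k, (k < 4)%N -> comb a k = 0) -> a = 0.
Proof.
move=> a0; apply/s_indep/(steiner_param_dense (comb_form _ s_homog)) => phi y _.
by rewrite comb_steiner big1 ?mulr0 // => k _; rewrite a0 // meval0 mulr0.
Qed.

Lemma comb_linear n (v : 'I_n -> 'rV[K]_8) (a : 'I_n -> K) k :
  comb (\sum_i a i *: v i) k = \sum_i a i *: comb (v i) k.
Proof.
rewrite /comb; under [RHS]eq_bigr do rewrite scaler_sumr.
rewrite exchange_big /=; apply: eq_bigr => j _.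
by rewrite summxE scaler_suml; apply: eq_bigr => i _; rewrite mxE scalerA.
Qed.

Let Z k a := forall j, (j < k)%N -> comb a j = 0.

Lemma Z_matrix k : exists B : 'M[K]_8, forall a, Z k a <-> (a <= B)%MS.
Proof.
apply: subspace_matrix => [j _|a u v Zu Zv j jk].
  by rewrite /comb big1 // => i _; rewrite mxE scale0r.
have := comb_linear (fun i : 'I_2 => if i == 0 then u else v) (fun i => if i == 0 then a else 1) j.
by rewrite !big_ord_recl !big_ord0 /= !scale1r !addr0 => ->; rewrite Zu // Zv // scaler0 addr0.
Qed.

(* Otherwise the coefficients of [phi ^+ 0], of [phi ^+ 1], and of the last two
   powers of [phi] impose at most 1, 2 and 4 conditions on the eight-dimensional
   system. *)
Lemma cubic_exists : exists c : {mpoly K[3]}, [/\ c \is 3.-homog, c != 0,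
    forall P, P \is 4.-homog -> van_on D P -> exists2 l, l \is 1.-homog & P = c * l &
    forall P, P \is 6.-homog -> double_on D P -> exists a, P = a *: c ^+ 2].
Proof.
case: (quartic_cubic D_scale D_isolated D_low) => // dep4.
have [B0 B0E] := Z_matrix 0; have [B1 B1E] := Z_matrix 1.
have [B2 B2E] := Z_matrix 2; have [B4 B4E] := Z_matrix 4.
have r0 : \rank B0 = 8%N.
  apply/eqP; rewrite eqn_leq rank_leq_row -[X in (X <= _)%N](mxrank1 K 8).
  by apply/mxrankS/row_subP => i; apply/B0E => j.
have r1 : (\rank B0 <= \rank B1 + 1)%N.
  apply: rank_step B0E B1E _ => v _.
  have hv i : comb (v i) 0 \is 6.-homog by apply: comb_form => j; apply: H_homog.
  have dv i : double_on D (comb (v i) 0) by apply: double_on_comb.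
  have [a [b [ab E]]] := double_on_dep D_scale D_isolated D_low (hv 0) (hv 1) (dv 0) (dv 1).
  exists (\row_i if i == 0 then a else b).
    by apply: contraTneq ab => /rowP h; have := h 0; have := h 1; rewrite !mxE /= => -> ->; rewrite eqxx.
  case=> // _; rewrite comb_linear !big_ord_recl big_ord0 !mxE /= addr0 -E.
  by congr (_ *: comb (v _) _ + _ *: comb (v _) _); apply/val_inj.
have r2 : (\rank B1 <= \rank B2 + 2)%N.
  apply: rank_step B1E B2E _ => v Zv.
  have [|a a0 E] := dep4 (fun i => comb (v i) 1).
    move=> i; split; first by apply: comb_form => j; apply: H_homog.
    by apply: van_on_comb.
  exists a => // -[|[|//]] _; rewrite comb_linear // big1 // => i _.
  by rewrite Zv // scaler0.
have r4 : (\rank B2 <= \rank B4 + 4)%N.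
  apply: rank_step B2E B4E _ => v Zv.
  (* Four conditions suffice: once [comb a 0], [comb a 1] and [comb a 3] vanish, the vertex
     relations give the values of the conic [comb a 2] at the vertices. *)
  pose fl (a : 'rV[K]_8) (j : nat) : K := nth 0 [:: (comb a 2).@[mk3 0 1 1 0];
    (comb a 2).@[mk3 1 0 1 0]; (comb a 2).@[mk3 1 1 0 0]; (comb a 3).@[mk3 0 0 0 0]] j.
  have [a a0 E] := left_kernel (\matrix_(i < 5, j < 4) fl (v i) j) isT.
  exists a => //; set u := \sum_i _.
  have flu (j : 'I_4) : fl u j = 0.
    have /rowP/(_ j) := E; rewrite !mxE => <-.
    have sumE k y : (comb u k).@[y] = \sum_i a 0 i * (comb (v i) k).@[y].
      by rewrite comb_linear raddf_sum; apply: eq_bigr => i _ /=; rewrite mevalZ.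
    by case: j => [[|[|[|[|j]]]] //= j4]; rewrite /fl /= sumE; apply: eq_bigr => i _; rewrite mxE.
  have hu k : (k < 4)%N -> comb u k \is (6 - 2 * k).-homog.
    by move=> k4; apply: comb_form => i; apply: H_homog.
  have u0 : comb u 0 = 0 by rewrite comb_linear big1 // => i _; rewrite Zv // scaler0.
  have u1 : comb u 1 = 0 by rewrite comb_linear big1 // => i _; rewrite Zv // scaler0.
  have u3 : comb u 3 = 0.
    apply: mpoly_vanishing => w; rewrite -(@meval_eq _ _ ((\row_i w i) 0)) => [|i]; last by rewrite mxE.
    by rewrite (meval_const_form _ (mk3 0 0 0) (hu 3 isT)); apply: (flu (@Ordinal 4 3 isT)).
  have u2 : comb u 2 = 0.
    apply: quadratic_form_zero (hu 2 isT) _ (flu (@Ordinal 4 0 isT)) (flu (@Ordinal 4 1 isT)) (flu (@Ordinal 4 2 isT)) => j.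
    have : \sum_(k < 4) (comb u k).@[(delta_mx 0 j : 'rV[K]_3) 0] = 0.
      rewrite /comb; under eq_bigr do rewrite raddf_sum.
      rewrite exchange_big big1 //= => i _; under eq_bigr do rewrite mevalZ.
      by rewrite -mulr_sumr H_vertex mulr0.
    by rewrite !big_ord_recl big_ord0 /= /bump /= u0 u1 u3 !meval0 !add0r !addr0.
  by case=> [|[|[|[|k]]]].
have r5 : \rank B4 = 0%N.
  apply/eqP; rewrite mxrank_eq0; apply/eqP/row_matrixP => i; rewrite row0.
  by apply/comb_inj/B4E/row_sub.
by exfalso; move: r0 r1 r2 r4 r5; lia.
Qed.

(** The columns of [B] come from [model_column]; a vector in the kernel of [B] would be a linear
    relation between the [s i]. *)
Lemma system_matrix : exists c (B : 'M[K]_8), [/\ B \in unitmx,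
  exists y : 'rV[K]_3, cubic3 c y != 0 &
  forall phi (y : 'rV[K]_3) (T := model_t c phi y (cubic3 c y)),
    eval_map s (steiner_param (nrm3 y - phi) y *m N) =
    prod3 y ^+ 4 *: (vec T (phi ^+ 3 - (T 1%N ^+ 2 + T 2%N ^+ 2 + T 3%N ^+ 2)) *m B)].
Proof.
have [cP [hc c0 c1 c2]] := cubic_exists.
have [c cE] := cubic_form3 hc.
have cE' (y : 'rV[K]_3) : cP.@[y 0] = cubic3 c y by rewrite cE.
have col i : exists n : nat -> K, forall phi (y : 'rV[K]_3) (T := model_t c phi y (cubic3 c y)),
    \sum_(k < 4) phi ^+ k * (H i k).@[y 0] =
    \sum_(k < 8) vecn T (phi ^+ 3 - (T 1%N ^+ 2 + T 2%N ^+ 2 + T 3%N ^+ 2)) k * n k.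
  have [l hl H1E] := c1 _ (@H_homog i 1%N isT) (H1_van i).
  have [al H0E] := c2 _ (@H_homog i 0%N isT) (H0_double i).
  exact: (model_column cE' (@H_homog i) (H_vertex i) hl H0E H1E).
have [n nE] := choice col.
pose B : 'M[K]_8 := \matrix_(k, i) n i k.
have BE phi (y : 'rV[K]_3) (T := model_t c phi y (cubic3 c y)) :
    eval_map s (steiner_param (nrm3 y - phi) y *m N) =
    prod3 y ^+ 4 *: (vec T (phi ^+ 3 - (T 1%N ^+ 2 + T 2%N ^+ 2 + T 3%N ^+ 2)) *m B).
  apply/rowP => i; rewrite !mxE HE nE; congr (_ * _).
  by apply: eq_bigr => k _; rewrite !mxE.
exists c, B; split => //; last first.
  apply: contrapT => h; case/eqP: c0; apply: mpoly_vanishing => v.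
  rewrite -(@meval_eq _ _ ((\row_i v i) 0)) => [|i]; last by rewrite mxE.
  by rewrite cE'; apply/eqP/negPn/negP => h'; apply: h; exists (\row_i v i).
rewrite unitmxE unitfE -det_tr; apply/negP => /det0P [a a0 aB]; case/eqP: a0.
apply/s_indep/(steiner_param_dense (comb_form _ s_homog)) => phi y _.
transitivity ((eval_map s (steiner_param (nrm3 y - phi) y *m N) *m a^T) 0 0).
  by rewrite raddf_sum mxE; apply: eq_bigr => i _ /=; rewrite mevalZ !mxE mulrC.
rewrite BE -scalemxAl -mulmxA -[B]trmxK -trmx_mul aB.
by rewrite trmx0 mulmx0 scaler0 mxE.
Qed.

End RankCount.

(** * From the linear system to the threefold *)

Section Birational.

Variable K : numClosedFieldType.

Lemma zclosed_zeros1 n (f : {mpoly K[n]}) d : f \is d.-homog -> zclosed (zeros [set f]).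
Proof. by move=> hf; exists [set f]; split=> // _ ->; exists d. Qed.

Variables (n m : nat) (X : set 'rV[K]_n) (phi : 'I_m -> {mpoly K[n]}) (s : 'I_n -> {mpoly K[m]}).
Hypothesis X_irr : irreducible X.
Hypothesis phi_s : birational_inverse X (@pspace K m) phi s.

Lemma polyfun_eval_map i : polyfun (fun w => eval_map s w 0 i).
Proof. by exists (s i) => w; rewrite mxE. Qed.

(** The equations of [X] hold at the image of a general point, hence by density at every image. *)
Lemma image_in w : eval_map s w != 0 -> X (eval_map s w).
Proof.
move=> sw; have [[S [hS XS]] _ _] := X_irr.
rewrite XS; split=> // f Sf.
have [_ _ _ [_ [[T [hT ->]] TX HX]]] := phi_s.
have [v0 [v00 [g [Tg gv0]]]] : exists v0 : 'rV[K]_m, v0 != 0 /\ exists g, T g /\ g.@[v0 0] != 0.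
  apply: contrapT => H; apply: TX => v v0; split=> // g Tg.
  by apply/eqP/negPn/negP => gv; apply: H; exists v; split=> //; exists g.
have [i vi] : exists i, v0 0 i != 0.
  apply: contrapT => H; case/eqP: v00; apply/rowP => i; rewrite mxE.
  by apply/eqP/negPn/negP => vi; apply: H; exists i.
have pf : polyfun (fun w => f.@[eval_map s w 0]).
  by apply: (@polyfun_meval _ _ _ f (fun i w => eval_map s w 0 i)); apply: polyfun_eval_map.
have pg : polyfun (fun w : 'rV[K]_m => g.@[w 0] * w 0 i).
  by apply: polyfun_mul; [exists g | apply: polyfun_coord].
apply: (polyfun_dense pf pg (v0 := v0)); first by rewrite mulf_neq0.
move=> v; rewrite mulf_eq0 negb_or => /andP [gv v_i].
have [|h|+ _] := HX v.
- by apply: contraNneq v_i => ->; rewrite mxE.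
- by case: h => _ /(_ g Tg) /eqP; apply/negP.
by rewrite XS => -[_]; apply.
Qed.

Variables (f : 'rV[K]_n -> K) (g : 'rV[K]_m -> K) (w0 : 'rV[K]_m).
Hypotheses (pf : polyfun f) (pg : polyfun g) (gw0 : g w0 != 0).
Hypothesis fs : forall w, g w != 0 -> forall a, f (a *: eval_map s w) = 0.

(** Vanishing at all multiples [a *: eval_map s w] separates the homogeneous components of [f]. Each
    of them vanishes on the part of [X] where the inverse is defined, hence on [X] by
    irreducibility. *)
Lemma image_dense v : X v -> f v = 0.
Proof.
move=> Xv; have [F fF] := pf.
pose G d := pihomog mdeg d F.
have FE u : F.@[u] = \sum_(d < msize F) (G d).@[u].
  by rewrite {1}(pihomog_partitionE (leqnn (msize F))) raddf_sum.
rewrite fF FE big1 // => d _.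
have hG e : G e \is e.-homog by apply: pihomogP.
have [Xcl _ Xirr] := X_irr.
have [_ _ [Z [Zcl XZ HZ]] _] := phi_s.
have Gs w a : (G d).@[(a *: eval_map s w) 0] = 0.
  rewrite (meval_homogZ _ _ (hG d)) (_ : (G d).@[_] = 0) ?mulr0 //.
  have pG : polyfun (fun w => (G d).@[eval_map s w 0]).
    by apply: (@polyfun_meval _ _ _ (G d) (fun i w => eval_map s w 0 i)); apply: polyfun_eval_map.
  apply: (polyfun_dense pG pg gw0) => u gu.
  pose p : {poly K} := \poly_(i < msize F) (G i).@[eval_map s u 0].
  have : p = 0.
    apply: poly_vanishing => b; rewrite horner_poly -[RHS](fs gu b) fF FE.
    by apply: eq_bigr => i _; rewrite (meval_homogZ _ _ (hG i)) mulrC.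
  by move/polyP/(_ d); rewrite coef_poly coef0 ltn_ord.
have XU : X `<=` Z `|` zeros [set G d].
  move=> u Xu; case: (pselect (Z u)) => [Zu|nZu]; [by left | right].
  have [_ /eqmxP/eqmx_sym uE] := HZ u Xu nZu.
  split; first by move: Xu; have [S [_ ->]] := Xcl => -[].
  move=> _ ->; have /sub_rVP [a ->] : (u <= eval_map s (eval_map phi u))%MS by rewrite uE.
  exact: Gs.
have [|XG] := Xirr _ _ Zcl (zclosed_zeros1 (hG d)) XU; first by move/XZ.
by have [_ ->] := XG v Xv.
Qed.

End Birational.

(** * The threefold and the explicit model *)

Section ModelOfImage.

Variable K : numClosedFieldType.
Variables (X : set 'rV[K]_8) (phi : 'I_4 -> {mpoly K[8]}) (s : 'I_8 -> {mpoly K[4]}).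
Hypothesis X_irr : irreducible X.
Hypothesis phi_s : birational_inverse X (@pspace K 4) phi s.
Hypothesis s_homog : forall i, s i \is 9.-homog.

(** A relation between the [s i] is a hyperplane containing the image, hence [X]. *)
Lemma nondegenerate_indep : Defs.nondegenerate X ->
  forall a : 'rV[K]_8, \sum_i a 0 i *: s i = 0 -> a = 0.
Proof.
move=> Xn a a0; suff : a^T = 0 by move/(congr1 trmx); rewrite trmxK trmx0.
apply: Xn => v Xv; apply/matrixP => i j; rewrite !ord1 [RHS]mxE.
apply: (@image_dense _ _ _ _ _ _ X_irr phi_s (fun v => (v *m a^T) 0 0) (fun _ => 1) 0 _ _ _ _ v Xv).
- exact: polyfun_mulmx.
- exact: polyfun_cst.
- exact: oner_neq0.
move=> w _ b; rewrite -scalemxAl mxE (_ : (_ *m _) 0 0 = 0) ?mulr0 //.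
rewrite -[RHS](meval0 (w 0)) -a0 raddf_sum mxE; apply: eq_bigr => k _ /=.
by rewrite mevalZ !mxE mulrC.
Qed.

Variables (M : 'M[K]_4) (c : nat -> K) (B : 'M[K]_8).
Hypotheses (uM : M \in unitmx) (uB : B \in unitmx).
Hypothesis c_neq0 : exists y : 'rV[K]_3, cubic3 c y != 0.
Hypothesis sE : forall f (y : 'rV[K]_3) (T := model_t c f y (cubic3 c y)),
  eval_map s (steiner_param (nrm3 y - f) y *m invmx M) =
  prod3 y ^+ 4 *: (vec T (f ^+ 3 - (T 1%N ^+ 2 + T 2%N ^+ 2 + T 3%N ^+ 2)) *m B).

Lemma eval_mapZ a w : eval_map s (a *: w) = a ^+ 9 *: eval_map s w.
Proof. by apply/rowP => i; rewrite !mxE (meval_homogZ _ _ (s_homog i)). Qed.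

(** By [steiner_param_xi] a general point of P^3 is proportional to a parametrized one, whose image
    is known; each equation then passes to [X] by [image_dense]. *)
Lemma model_on_X v : X v -> model_eqs c (co (v *m invmx B)).
Proof.
pose g (x : 'rV[K]_4) := co4 (x *m M) 1 * co4 (x *m M) 2 * co4 (x *m M) 3.
have pg : polyfun g.
  by apply: polyfun_mul; [apply: polyfun_mul|]; apply: (polyfun_mulmx M).
have g1 : g (mk4 0 1 1 1 *m invmx M) != 0.
  have [_ e1 e2 e3] := co_mk4 (0 : K) 1 1 1.
  by rewrite /g mulmxKV // e1 e2 e3 !mulr1 oner_neq0.
have eqs w : g w != 0 -> forall a, model_eqs c (co (a *: eval_map s w *m invmx B)).
  move=> gw a; set x := w *m M.
  pose T := model_t c (steiner_quartic x) (xi x) (cubic3 c (xi x)).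
  pose u := steiner_quartic x ^+ 3 - (T 1%N ^+ 2 + T 2%N ^+ 2 + T 3%N ^+ 2).
  have E : g w ^+ 9 *: eval_map s w = prod3 (xi x) ^+ 4 *: (vec T u *m B).
    by rewrite -sE steiner_param_xi -/(g w) -scalemxAl mulmxK // eval_mapZ.
  have Tu : lin c T * u = gam c T.
    rewrite /u /gam /lin /T /model_t /cubic3 /cub /=; ring.
  have -> : a *: eval_map s w *m invmx B = (a * (g w ^- 9 * prod3 (xi x) ^+ 4)) *: vec T u.
    have -> : eval_map s w = (g w ^- 9 * prod3 (xi x) ^+ 4) *: (vec T u *m B).
      by rewrite -scalerA -E scalerA mulVf ?scale1r ?expf_neq0.
    by rewrite scalerA -scalemxAl mulmxK.
  rewrite coZ; apply: model_eqsZ; apply: eq_model_eqs (model_eqs_vecn Tu) => k k8.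
  by rewrite co_vec.
have pc k : polyfun (fun v => co (v *m invmx B) k).
  have [P PE] := polyfun_co K k; apply: (@polyfun_eq _ _ (fun v => P.@[(v *m invmx B) 0])) => [u|].
    by rewrite -PE.
  by apply: (@polyfun_meval _ _ _ P (fun i v => (v *m invmx B) 0 i)) => i; apply: polyfun_mulmx.
have red (E1 E2 : (nat -> K) -> K) : polyfun (fun v => E1 (co (v *m invmx B))) ->
    polyfun (fun v => E2 (co (v *m invmx B))) -> (forall w, model_eqs c w -> E1 w = E2 w) ->
    forall v, X v -> E1 (co (v *m invmx B)) = E2 (co (v *m invmx B)).
  move=> p1 p2 H u Xu; apply/eqP; rewrite -subr_eq0; apply/eqP.
  apply: (@image_dense _ _ _ _ _ _ X_irr phi_s (fun v => E1 (co (v *m invmx B)) - E2 (co (v *m invmx B)))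
    g _ _ pg g1 _ u Xu).
    by apply: polyfun_add => //; apply: polyfun_opp.
  by move=> w gw a; rewrite (H _ (eqs w gw a)) subrr.
move=> Xv; split.
- refine (red (@b12 K) (fun _ => 0) _ _ _ v Xv); last by move=> w [].
    by rewrite /b12; polyf.
  exact: polyfun_cst.
- refine (red (@b13 K) (fun _ => 0) _ _ _ v Xv); last by move=> w [].
    by rewrite /b13; polyf.
  exact: polyfun_cst.
- refine (red (@b23 K) (fun _ => 0) _ _ _ v Xv); last by move=> w [].
    by rewrite /b23; polyf.
  exact: polyfun_cst.
- by refine (red (fun w => w 1%N * w 6%N) (fun w => w 2%N * w 5%N) _ _ _ v Xv);
    [polyf | polyf | move=> w []].
- by refine (red (fun w => w 1%N * w 6%N) (fun w => w 3%N * w 4%N) _ _ _ v Xv);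
    [polyf | polyf | move=> w []].
- refine (red (fun w => lin c w * w 0%N * w 7%N) (gam c) _ _ _ v Xv); last by move=> w [].
    by have pl := polyfun_lin c pc; polyf.
  exact: (polyfun_gam c pc).
refine (red (fun w => (w 1%N * w 6%N + c 1 * w 4%N * w 5%N + c 2 * w 4%N * w 6%N
                + c 3 * w 5%N * w 6%N) * w 7%N) (fun w => cub3 c (w 4%N) (w 5%N) (w 6%N)
      - (w 1%N * w 4%N * w 5%N + w 2%N * w 4%N * w 6%N + w 3%N * w 5%N * w 6%N)) _ _ _ v Xv);
  last by move=> w [].
  by polyf.
by rewrite /cub3; polyf.
Qed.

(** The map (phi, y) -> T is inverted: phi is a cube root of [cub t / lin t], and y = (t_1, t_2,
    t_3) / phi. *)
Lemma model_in_X_generic t u : lin c t != 0 -> cub c t != 0 ->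
  t 1%N * t 2%N * t 3%N != 0 -> lin c t * u = gam c t -> X (vec t u *m B).
Proof.
move=> lt ct nt tu.
have v0 : vec t u != 0.
  apply: contraNneq nt => /rowP/(_ (@Ordinal 8 4 isT)); rewrite !mxE /vecn /= => ->.
  by rewrite mul0r.
pose f : K := 3.-root (cub c t / lin c t).
have f3 : f ^+ 3 = cub c t / lin c t by rewrite rootCK.
have f0 : f != 0 by rewrite rootC_eq0 // mulf_neq0 ?invr_neq0.
pose y := mk3 (t 1%N / f) (t 2%N / f) (t 3%N / f).
have [y0 y1 y2] := co_mk3 (t 1%N / f) (t 2%N / f) (t 3%N / f).
have fK k : f * (t k / f) = t k by rewrite mulrC divfK.
have cy : cubic3 c y = lin c t.
  have e : f ^+ 3 * cubic3 c y = f ^+ 3 * lin c t.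
    rewrite f3 divfK // /cubic3 /cub /= y0 y1 y2 -[in RHS](fK 1%N) -[in RHS](fK 2%N) -[in RHS](fK 3%N).
    rewrite -f3; ring.
  by apply: (mulfI (x := f ^+ 3)) e; rewrite expf_neq0.
have Tt k : (k < 4)%N -> model_t c f y (cubic3 c y) k = t k.
  case: k => [|[|[|[|]]]] //= _; rewrite /model_t /= ?y0 ?y1 ?y2 ?fK //.
  transitivity (cubic3 c y - (c 1 * (f * (t 1%N / f)) + c 2 * (f * (t 2%N / f)) + c 3 * (f * (t 3%N / f)))).
    by ring.
  by rewrite !fK cy /lin; ring.
have uE : u = f ^+ 3 - (t 1%N ^+ 2 + t 2%N ^+ 2 + t 3%N ^+ 2).
  apply: (mulfI lt); rewrite tu /gam f3 mulrBr mulrCA divff // mulr1 //.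
have := sE f y; rewrite /= !Tt // -uE.
have -> : vec (model_t c f y (cubic3 c y)) u = vec t u.
  by apply/rowP => i; rewrite !mxE /vecn !Tt.
move=> E.
have p0 : prod3 y != 0.
  by rewrite /prod3 y0 y1 y2; move: nt; rewrite !mulf_eq0 !invr_eq0 (negbTE f0) !orbF.
have sv : eval_map s (steiner_param (nrm3 y - f) y *m invmx M) != 0.
  rewrite E scaler_eq0 expf_eq0 (negbTE p0) /=; apply: contraNneq v0 => h.
  by rewrite -[vec t u](mulmxK uB) h mul0mx.
have -> : vec t u *m B = prod3 y ^- 4 *: eval_map s (steiner_param (nrm3 y - f) y *m invmx M).
  by rewrite E scalerA mulVf ?scale1r ?expf_neq0.
apply: zclosed_scale; [by case: X_irr | by rewrite invr_neq0 ?expf_neq0 |].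
exact: (image_in X_irr phi_s sv).
Qed.

(** Multiplied by [lin t], the parametrized point has the polynomial coordinates [W]; an equation of
    [X] holding for general t thus holds for all t. *)
Lemma model_in_X t u : lin c t != 0 -> lin c t * u = gam c t -> vec t u != 0 ->
  X (vec t u *m B).
Proof.
move=> lt tu v0; have [[S [hS XS]] _ _] := X_irr.
rewrite XS; split=> [|h Sh].
  by apply: contraNneq v0 => e; rewrite -[vec t u](mulmxK uB) e mul0mx.
pose tt (x : 'rV[K]_4) (k : nat) : K := nth 0 [:: co4 x 0; co4 x 1; co4 x 2; co4 x 3] k.
have ptt k : polyfun (fun x => tt x k).
  by case: k => [|[|[|[|k]]]]; try exact: polyfun_coord; rewrite /tt /= nth_nil; apply: polyfun_cst.
have plin : polyfun (fun x => lin c (tt x)) by rewrite /lin; polyf.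
have pcub : polyfun (fun x => cub c (tt x)) by rewrite /cub; polyf.
have pgam : polyfun (fun x => gam c (tt x)) by rewrite /gam; polyf.
pose W x : 'rV[K]_8 := \row_j (if j == 7 :> nat then gam c (tt x) else lin c (tt x) * vecn (tt x) 0 j).
have WE x q : lin c (tt x) * q = gam c (tt x) -> W x = lin c (tt x) *: vec (tt x) q.
  move=> e; apply/rowP => j; rewrite !mxE; case: eqP => [->|]; first by rewrite -e.
  by case: j => [[|[|[|[|[|[|[|[|]]]]]]]] //= j8].
have pW j : polyfun (fun x => W x 0 j).
  case: (eqVneq (j : nat) 7) => j7.
    by apply: (@polyfun_eq _ _ (fun x => gam c (tt x))) => // x; rewrite mxE j7.
  apply: (@polyfun_eq _ _ (fun x => lin c (tt x) * vecn (tt x) 0 j)) => [x|]; first by rewrite mxE (negbTE j7).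
  by apply: polyfun_mul => //; case: j {j7} => [[|[|[|[|[|[|[|[|]]]]]]]] //= j8]; rewrite /vecn /=; polyf.
pose g (x : 'rV[K]_4) := lin c (tt x) * (cub c (tt x) * (tt x 1%N * tt x 2%N * tt x 3%N)).
have [x0 gx0] : exists x, g x != 0.
  apply: polyfun_nonzero_mul => //; first by polyf.
    by exists (mk4 1 0 0 0); have [e0 e1 e2 e3] := co_mk4 (1 : K) 0 0 0;
       rewrite /lin /tt /= e0 e1 e2 e3 !mulr0 !addr0 oner_neq0.
  apply: polyfun_nonzero_mul => //; first by polyf.
    have [y cy] := c_neq0; exists (mk4 0 (co3 y 0) (co3 y 1) (co3 y 2)).
    have [e0 e1 e2 e3] := co_mk4 0 (co3 y 0) (co3 y 1) (co3 y 2).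
    by rewrite /cub /tt /= e1 e2 e3.
  exists (mk4 0 1 1 1); have [e0 e1 e2 e3] := co_mk4 (0 : K) 1 1 1.
  by rewrite /tt /= e1 e2 e3 !mulr1 oner_neq0.
have [d hd] := hS h Sh.
have hW : forall x, h.@[(W x *m B) 0] = 0.
  apply: (polyfun_dense (g := g) _ _ gx0).
  - apply: (@polyfun_meval _ _ _ h (fun i x => (W x *m B) 0 i)) => i.
    apply: (@polyfun_eq _ _ (fun x => \sum_j W x 0 j * B j i)) => [x|]; first by rewrite mxE.
    by apply: polyfun_sum => j; apply: polyfun_mul => //; apply: polyfun_cst.
  - by rewrite /g; polyf.
  move=> x; rewrite /g mulf_eq0 negb_or => /andP [lx].
  rewrite mulf_eq0 negb_or => /andP [cx nx].
  have qE : lin c (tt x) * (gam c (tt x) / lin c (tt x)) = gam c (tt x) by rewrite mulrC divfK.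
  rewrite (WE _ _ qE) -scalemxAl (meval_homogZ _ _ hd).
  by have := model_in_X_generic lx cx nx qE; rewrite XS => -[_ /(_ h Sh) ->]; rewrite mulr0.
pose x := mk4 (t 0%N) (t 1%N) (t 2%N) (t 3%N).
have xE k : (k < 4)%N -> tt x k = t k.
  have [e0 e1 e2 e3] := co_mk4 (t 0%N) (t 1%N) (t 2%N) (t 3%N).
  by case: k => [|[|[|[|]]]].
have := hW x; rewrite (@WE x u) (eq_lin c xE) ?(eq_gam c xE) // -scalemxAl (meval_homogZ _ _ hd).
have -> : vec (tt x) u = vec t u by apply/rowP => i; rewrite !mxE /vecn !xE.
by move/eqP; rewrite mulf_eq0 expf_eq0 (negbTE lt) andbF => /eqP.
Qed.

Lemma model_conclusion : one_apparent_double_point X.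
Proof.
have [Xcl _ _] := X_irr; have [y cy] := c_neq0.
have pc : polyfun (cubic3 c) by rewrite /cubic3 /cub /co3 /=; polyf; apply: polyfun_coord.
have pp : polyfun (@prod3 K) by rewrite /prod3 /co3; polyf; apply: polyfun_coord.
have [||w] := polyfun_nonzero_mul pc pp; first by exists y.
  by exists (mk3 1 1 1); have [e0 e1 e2] := co_mk3 (1 : K) 1 1; rewrite /prod3 e0 e1 e2 !mulr1 oner_neq0.
rewrite mulf_eq0 negb_or => /andP [cw pw].
apply: (@model_oadp _ c X B (nth 0 [:: 0; co3 w 0; co3 w 1; co3 w 2])) => //.
- by move=> v; apply: zclosed_neq0.
- by move=> v a a0; apply: zclosed_scale.
- by move=> t u; apply: model_in_X.
exact: model_on_X.
Qed.

End ModelOfImage.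

(** * The double lines are the coordinate axes *)

Section SteinerLines.

Variable K : numClosedFieldType.
Variable M : 'M[K]_4.
Hypothesis uM : M \in unitmx.
Let N := invmx M.
Let F := steiner_eq M.

Lemma mult_ge_steiner m (z : 'rV[K]_4) (u : 'rV[K]_4) : mult_ge m F z ->
  exists q : {poly K}, forall t, steiner_quartic (z *m M + t *: u) = t ^+ m * q.[t].
Proof.
move=> /(mult_ge_curve (fun i => ((u *m N) 0 i)%:P)) [q qE]; exists q => t.
have -> : z *m M + t *: u = (z + t *: (u *m N)) *m M.
  by rewrite mulmxDl -scalemxAl mulmxKV.
rewrite -meval_steiner_eq -qE; apply: meval_eq => i.
by rewrite hornerC !mxE.
Qed.

Lemma co4D (x u : 'rV[K]_4) t i : co4 (x + t *: u) i = co4 x i + t * co4 u i.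
Proof. by rewrite /co4 !mxE. Qed.

Lemma quadratic_order2 (a b : K) (q : {poly K}) :
  (forall t, a + b * t = t ^+ 2 * q.[t]) -> a = 0 /\ b = 0.
Proof.
move=> H; have E : a%:P + b *: 'X = 'X^2 * q.
  apply/subr0_eq/poly_vanishing => t.
  by rewrite hornerD hornerN hornerM hornerXn -H !hornerE subrr.
split; first by have := congr1 (fun p : {poly K} => p`_0) E; rewrite coefXnM coefD coefC coefZ coefX /= mulr0 addr0.
by have := congr1 (fun p : {poly K} => p`_1) E; rewrite coefXnM coefD coefC coefZ coefX /= mulr1 add0r.
Qed.

(** The quartic is affine in coordinate 0 with slope - x_1 x_2 x_3, so order two in that direction
    kills both the quartic and this product. *)
Lemma mult2_axes (z : 'rV[K]_4) : mult_ge 2 F z ->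
  [\/ co4 (z *m M) 1 = 0 /\ co4 (z *m M) 2 = 0, co4 (z *m M) 1 = 0 /\ co4 (z *m M) 3 = 0 |
      co4 (z *m M) 2 = 0 /\ co4 (z *m M) 3 = 0].
Proof.
move=> /(mult_ge_steiner (mk4 1 0 0 0)) [q qE]; set x := z *m M in qE *.
have [e0 e1 e2 e3] := co_mk4 (1 : K) 0 0 0.
have [|a b] := @quadratic_order2 (steiner_quartic x) (- (co4 x 1 * co4 x 2 * co4 x 3)) q.
  by move=> t; rewrite -qE /steiner_quartic !co4D e0 e1 e2 e3; ring.
by apply: steiner_quartic_axes => //; apply: oppr_inj; rewrite b oppr0.
Qed.

(** At a point of an axis whose remaining coordinate is b, the quartic equals b^2 t^2 in the
    direction of one of the vanishing coordinates. *)
Lemma mult3_axes (z : 'rV[K]_4) : mult_ge 3 F z ->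
  [/\ co4 (z *m M) 1 = 0, co4 (z *m M) 2 = 0 & co4 (z *m M) 3 = 0].
Proof.
move=> z3; have ax := mult2_axes (mult_geW (isT : (2 <= 3)%N) z3).
have sq (b : K) (q : {poly K}) : (forall t, b ^+ 2 * t ^+ 2 = t ^+ 3 * q.[t]) -> b = 0.
  move=> H; have E : (b ^+ 2) *: 'X^2 = 'X^3 * q.
    apply/subr0_eq/poly_vanishing => t.
    by rewrite hornerD hornerN hornerM !hornerXn -H hornerZ hornerXn subrr.
  have := congr1 (fun p : {poly K} => p`_2) E; rewrite coefXnM coefZ coefXn /= mulr1.
  by move/eqP; rewrite expf_eq0 => /eqP.
case: ax => [] [a b]; rewrite a b; split=> //.
- have [q qE] := mult_ge_steiner (mk4 0 1 0 0) z3; apply: (sq _ q) => t.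
  have [e0 e1 e2 e3] := co_mk4 (0 : K) 1 0 0.
  by rewrite -qE /steiner_quartic !co4D e0 e1 e2 e3 a b; ring.
- have [q qE] := mult_ge_steiner (mk4 0 1 0 0) z3; apply: (sq _ q) => t.
  have [e0 e1 e2 e3] := co_mk4 (0 : K) 1 0 0.
  by rewrite -qE /steiner_quartic !co4D e0 e1 e2 e3 a b; ring.
have [q qE] := mult_ge_steiner (mk4 0 0 1 0) z3; apply: (sq _ q) => t.
have [e0 e1 e2 e3] := co_mk4 (0 : K) 0 1 0.
by rewrite -qE /steiner_quartic !co4D e0 e1 e2 e3 a b; ring.
Qed.

Variable L : 'I_3 -> 'M[K]_(2, 4).
Hypothesis F_L : forall i, mult_ge_along 2 F (plinear (L i)).
Hypothesis L_free : forall i, row_free (L i).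
Hypothesis L_distinct : forall i j, (L i == L j)%MS -> i = j.

Lemma line_two_zeros i (z : 'rV[K]_4) j k : (z <= L i)%MS -> (0 < j < 4)%N -> (0 < k < 4)%N -> j != k ->
  co4 (z *m M) j * co4 (z *m M) k = 0.
Proof.
move=> zL jP kP jk; case: (eqVneq z 0) => [->|z0].
  by rewrite mul0mx /co4 mxE mul0r.
have ax := mult2_axes (F_L (conj z0 zL)).
case: j jP jk => [|[|[|[|j]]]] // _; case: k kP => [|[|[|[|k]]]] // _ _;
by case: ax => [] [a b]; rewrite ?a ?b ?mul0r ?mulr0.
Qed.

(* If points of the line had nonzero coordinates on different axes, their sum would
   contradict [line_two_zeros]. *)
Lemma line_axis i : exists j : 'I_3, forall z : 'rV[K]_4, (z <= L i)%MS ->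
  forall k : 'I_4, off_axis j.+1 k != 0%N -> (z *m M) 0 k = 0.
Proof.
case: (pselect (exists j (z : 'rV[K]_4), [/\ (z <= L i)%MS, (0 < j < 4)%N & co4 (z *m M) j != 0])); last first.
  move=> H; exists ord0 => z zL k; rewrite /off_axis => hk; apply/eqP/negPn/negP => zk; apply: H.
  exists k, z; split=> //; last by rewrite /co4 inord_val.
  by rewrite ltn_ord andbT lt0n; case: (k : nat) hk.
move=> [j [z1 [zL1 jP zj]]].
have j3 : (j.-1 < 3)%N by case: j jP {zj} => [|[|[|[|]]]].
have jS : j.-1.+1 = j by case: j jP {zj j3}.
exists (Ordinal j3) => z zL k; rewrite /= jS /off_axis => hk; apply/eqP/negPn/negP => zk.
have [k0 kj] : k != 0%N :> nat /\ j != k.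
  have /andP [k0 kj] : (k != 0%N :> nat) && (k != j :> nat) by case: (_ && _) hk.
  by split=> //; rewrite eq_sym.
have kP : (0 < k < 4)%N by rewrite lt0n k0 ltn_ord.
have ck : co4 (z *m M) k = (z *m M) 0 k by rewrite /co4 inord_val.
have zj0 : co4 (z *m M) j = 0.
  have /eqP := line_two_zeros zL jP kP kj.
  by rewrite mulf_eq0 ck (negbTE zk) orbF => /eqP.
have zk0 : co4 (z1 *m M) k = 0.
  have /eqP := line_two_zeros zL1 jP kP kj.
  by rewrite mulf_eq0 (negbTE zj) => /eqP.
have D l : co4 ((z1 + z) *m M) l = co4 (z1 *m M) l + co4 (z *m M) l.
  by rewrite mulmxDl /co4 [LHS]mxE.
have /eqP := line_two_zeros (addmx_sub zL1 zL) jP kP kj.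
by rewrite !D zj0 zk0 addr0 add0r mulf_eq0 (negbTE zj) ck (negbTE zk).
Qed.

Lemma axis_sub i (j : 'I_3) : (forall z : 'rV[K]_4, (z <= L i)%MS ->
    forall k : 'I_4, off_axis j.+1 k != 0%N -> (z *m M) 0 k = 0) ->
  forall x : 'rV[K]_4, (forall k, off_axis j.+1 k != 0%N -> x 0 k = 0) -> (x *m N <= L i)%MS.
Proof.
move=> H; pose A : 'M[K]_(1 + 1, 4) := col_mx (delta_mx 0 0) (delta_mx 0 (lift ord0 j)).
have xA (x : 'rV[K]_4) : (forall k, off_axis j.+1 k != 0%N -> x 0 k = 0) -> (x <= A)%MS.
  move=> x0; suff -> : x = row_mx (x 0 0)%:M (x 0 (lift ord0 j))%:M *m A by apply: submxMl.
  rewrite mul_row_col !mul_scalar_mx; apply/rowP => k; rewrite !mxE /=.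
  case: (eqVneq k 0) => [->|k0].
    by rewrite mulr1 (_ : (0 == lift ord0 j) = false) ?mulr0 ?addr0.
  case: (eqVneq k (lift ord0 j)) => [->|kj]; first by rewrite mulr0 mulr1 add0r.
  rewrite !mulr0 addr0; apply: x0; rewrite /off_axis.
  have -> : (k != 0%N :> nat) by [].
  suff -> : (k != j.+1 :> nat) by [].
  by apply: contraNneq kj => e; apply/eqP/val_inj; rewrite /= e.
have LA : (L i *m M <= A)%MS.
  by apply/row_subP => k; apply: xA => l lP; rewrite row_mul; apply: H => //; apply: row_sub.
have rL : \rank (L i *m M) = 2%N.
  by rewrite mxrankMfree ?row_free_unit //; apply/eqP/L_free.
have AL : (A <= L i *m M)%MS.
  have := mxrank_leqif_sup LA => -[_ <-].
  by rewrite rL eqn_leq -{1}rL mxrankS // rank_leq_row.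
move=> x /xA /submx_trans - /(_ _ _ AL) /(submxMr N).
by rewrite mulmxK.
Qed.

(** Each line is an axis by [axis_sub], distinct lines are distinct axes, and an injection of ['I_3]
    into itself is a bijection. *)
Lemma axes_lines j : (0 < j < 4)%N -> exists i, forall x : 'rV[K]_4, x != 0 ->
  (forall k, off_axis j k != 0%N -> x 0 k = 0) -> plinear (L i) (x *m N).
Proof.
move=> jP; have [a aP] := choice line_axis.
have a_inj : injective a.
  move=> i i' e; apply: L_distinct; apply/andP.
  have sub l l' : a l = a l' -> (L l <= L l')%MS.
    move=> ll; apply/row_subP => k; rewrite -[row k _](mulmxK uM).
    by apply: (axis_sub (aP l')) => h; rewrite -ll; apply: aP; apply: row_sub.
  by split; apply: sub.
have j3 : (j.-1 < 3)%N by case: j jP => [|[|[|[|]]]].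
have [b _ ab] := injF_bij a_inj.
exists (b (Ordinal j3)) => x x0 xj; split.
  by apply: contraNneq x0 => h; rewrite -[x](mulmxKV uM) h mul0mx.
apply: (axis_sub (aP _)) => k; rewrite ab /= prednK; first exact: xj.
by case/andP: jP.
Qed.

End SteinerLines.

Lemma general_point (K : numClosedFieldType) n (X : set 'rV[K]_n) P :
  general X P -> exists2 x, X x & P x.
Proof.
move=> [Z [_ XZ H]]; apply: contrapT => h; apply: XZ => x Xx.
by apply: contrapT => Zx; apply: h; exists x => //; apply: H.
Qed.

(** One point [x] with its data is enough, as the conclusion does not mention [x]. *)
Lemma general_bronowski_degree9_oadp (K : numClosedFieldType) (X : set 'rV[K]_8) :
  general_bronowski_degree9 X -> one_apparent_double_point X.
Proof.
move=> [[X_irr _] X_nondeg _ _ /general_point [x _ [A [s [B [g [E [V [p [L [C]]]]]]]]]]].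
case=> _ phi_s [s_homog s_fixed] _ _ _ _ _ St _ _ [q [_ _ CE]] CV s_sys C_smooth _ _.
case: St => [[M [uM VE [F_p _] F_L]] p0 L_p L_dist].
have C_closed : zclosed C.
  rewrite CE /image_closure /zclosure; eexists; split; last by reflexivity.
  by move=> f [].
have C_F z : C z -> (steiner_eq M).@[z 0] = 0.
  by move/CV; rewrite VE => -[_ H]; apply: H.
have F_L2 i : mult_ge_along 2 (steiner_eq M) (plinear (L i)) by case: (F_L i).
have L_free i : row_free (L i) by case: (L_p i).
have L_axes i z : plinear (L i) z ->
    [\/ co4 (z *m M) 1 = 0 /\ co4 (z *m M) 2 = 0, co4 (z *m M) 1 = 0 /\ co4 (z *m M) 3 = 0 |
      co4 (z *m M) 2 = 0 /\ co4 (z *m M) 3 = 0].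
  by move=> zL; apply: (mult2_axes uM (F_L2 i z zL)).
have p_axes := mult3_axes uM F_p.
have s_indep := nondegenerate_indep X_irr phi_s X_nondeg.
have s_mult i : [/\ mult_ge 6 (s i) p, forall j, mult_ge_along 4 (s i) (plinear (L j))
    & mult_ge_along 2 (s i) C].
  apply/s_sys => //; exists (fun j => (i == j)%:R).
  rewrite (bigD1 i) //= eqxx scale1r big1 ?addr0 // => j ji.
  by rewrite eq_sym (negbTE ji) scale0r.
have axes := axes_lines uM F_L2 L_free L_dist.
have nf i : exists H : nat -> {mpoly K[3]},
    [/\ forall k, (k < 4)%N -> H k \is (6 - 2 * k).-homog,
        forall phi (y : 'rV[K]_3), (s i).@[(steiner_param (nrm3 y - phi) y *m invmx M) 0] =
          prod3 y ^+ 4 * \sum_(k < 4) phi ^+ k * (H k).@[y 0] &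
        forall j : 'I_3, \sum_(k < 4) (H k).@[(delta_mx 0 j : 'rV[K]_3) 0] = 0].
  by apply: normal_form_phi axes _ (s_homog i) _; case: (s_mult i).
have [H HP] := choice nf.
have dv i : double_on (pullback M C) (H i 0%N) /\ van_on (pullback M C) (H i 1%N).
  have [_ HE _] := HP i; have [_ _ sC] := s_mult i.
  exact: normal_form_double HE sC.
have [c [N [uN [y cy] sE]]] : exists c (N : 'M[K]_8), [/\ N \in unitmx,
  exists y : 'rV[K]_3, cubic3 c y != 0 &
  forall phi (y : 'rV[K]_3) (T := model_t c phi y (cubic3 c y)),
    eval_map s (steiner_param (nrm3 y - phi) y *m invmx M) =
    prod3 y ^+ 4 *: (vec T (phi ^+ 3 - (T 1%N ^+ 2 + T 2%N ^+ 2 + T 3%N ^+ 2)) *m N)].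
  apply: (@system_matrix _ M s (pullback M C) _ _ _ _ _ _ H) => //.
  - by move=> y a; apply: pullback_scale.
  - by move=> n P l; apply: pullback_isolated.
  - by move=> n P; apply: pullback_low L_axes F_p F_L2 s_sys s_fixed _ _.
  - by move=> i k k4; have [+ _ _] := HP i; apply.
  - by move=> i phi y; have [_ + _] := HP i; apply.
  - by move=> i; have [] := HP i.
  - by move=> i; have [] := dv i.
  by move=> i; have [] := dv i.
by apply: (model_conclusion X_irr phi_s s_homog uM uN _ sE); exists y.
Qed.

Theorem theorem4p5p2 (R : realType) (X : set 'rV[R[i]]_8) :
  general_bronowski_degree9 X -> one_apparent_double_point X.
Proof. exact: (@general_bronowski_degree9_oadp (R[i] : numClosedFieldType)). Qed.
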